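(* Suppose $f$ is a conformal mapping on the unit disk $\mathbb{D}$. For $r\in(0,1)$ let $M(r)=\max_{|z|=r}|f(z)|$ and $\psi(r)=\mathrm{area}\left(f(D(0,r))\right)$, where $D(0,r)$ is the disk centered at $0$ of radius $r$. Let $b(f)$ and $h(f)$ be the Bergman number and the Hardy number of $f$. Then (1) $\displaystyle b(f)=h(f)=\liminf_{r\to1}\frac{-\log(1-r)}{\log M(r)}$; (2) $\displaystyle b(f)=h(f)=2\liminf_{r\to1}\frac{-\log(1-r)}{\log\psi(r)}$; (3) $\displaystyle b(f)=h(f)=\sup\left\{\lambda>0:\ \lim_{r\to1}(1-r)M(r)^\lambda=0\right\}$; (4) $\displaystyle b(f)=h(f)=2\sup\left\{\lambda>0:\ \lim_{r\to1}(1-r)\psi(r)^\lambda=0\right\}$.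
   Context: A conformal mapping on $\mathbb{D}$ is an injective holomorphic function $f:\mathbb{D}\to\mathbb{C}$. For $p>0$, $\alpha>-1$, the weighted Bergman space $A_\alpha^p(\mathbb{D})$ is the set of holomorphic $f$ on $\mathbb{D}$ with $\int_{\mathbb{D}}|f(z)|^p(1-|z|^2)^\alpha\,dA(z)<\infty$, where $dA$ is Lebesgue area measure. For $p>0$, the Hardy space $H^p(\mathbb{D})$ is the set of holomorphic $f$ on $\mathbb{D}$ with $\sup_{0<r<1}\int_0^{2\pi}|f(re^{it})|^p\,dt<\infty$. For a conformal mapping $f$ on $\mathbb{D}$, the Bergman number and the Hardy number are $$b(f)=\sup\left\{\frac{p}{\alpha+2}:\ f\in A_\alpha^p(\mathbb{D})\right\},\qquad h(f)=\sup\{p>0: f\in H^p(\mathbb{D})\}.$$ Here $\mathrm{area}$ denotes Euclidean area, and $r\to1$ means $r\to 1$ with $r\in(0,1)$.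
   Formalization: In (1) and (2) the quotient is taken to be +∞ whenever M(r) ≤ 1 (resp. ψ(r) ≤ 1); literally the claim fails if M ≤ 1 (or ψ ≤ 1) for all r < 1, e.g. f(z) = z/2, where h(f) = +∞ but the raw quotient tends to −∞. *)

(* Defs.v *)
From HB Require Import structures.
From mathcomp Require Import all_boot all_order all_algebra.
From mathcomp Require Import all_classical all_reals all_analysis.
From mathcomp Require Import complex.

Set Implicit Arguments.
Unset Strict Implicit.
Unset Printing Implicit Defensive.

Import Order.TTheory GRing.Theory Num.Theory.
Import numFieldNormedType.Exports.
Import Normc.

Local Open Scope classical_set_scope.
Local Open Scope complex_scope.
Local Open Scope ring_scope.

(* The complex plane is R[i] over an arbitrary realType R; normc is the       *)
(* real-valued modulus. Functions on the disk are total functions of which    *)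
(* only the values on the disk matter.                                        *)

Definition disk (R : realType) (r : R) : set R[i] := [set z | normc z < r].

(* R[i]^o is R[i] as a normed module over itself, so that the difference      *)
(* quotient below has a complex increment.                                    *)
Definition holomorphic (R : realType) (U : set R[i]) (f : R[i] -> R[i]) :=
  forall z, U z -> derivable (f : R[i]^o -> R[i]^o) z 1.

Definition conformal (R : realType) (f : R[i] -> R[i]) :=
  holomorphic (disk 1) f /\ {in disk 1 &, injective f}.

Definition complex_of_pair (R : realType) (w : R * R) : R[i] := w.1 +i* w.2.

Definition area (R : realType) (U : set R[i]) : \bar R :=
  ((@lebesgue_measure R) \x (@lebesgue_measure R))%E
    (@complex_of_pair R @^-1` U).

Definition bergman_space (R : realType) (p alpha : R) : set (R[i] -> R[i]) :=
  [set f | holomorphic (disk 1) f /\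
    (\int[(@lebesgue_measure R) \x (@lebesgue_measure R)]_(w in
        @complex_of_pair R @^-1` disk 1)
      (normc (f (complex_of_pair w)) `^ p *
       (1 - normc (complex_of_pair w) ^+ 2) `^ alpha)%:E < +oo)%E].

Definition circle_integral (R : realType) (p : R) (f : R[i] -> R[i]) (r : R)
    : \bar R :=
  (\int[@lebesgue_measure R]_(t in `[0%R, (2 * pi)%R])
    (normc (f ((r * cos t) +i* (r * sin t))) `^ p)%:E)%E.

Definition hardy_space (R : realType) (p : R) : set (R[i] -> R[i]) :=
  [set f | holomorphic (disk 1) f /\
    (ereal_sup [set circle_integral p f r | r in `]0%R, 1%R[] < +oo)%E].

Definition bergman_number (R : realType) (f : R[i] -> R[i]) : \bar R :=
  ereal_sup [set x | exists p alpha : R,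
    [/\ 0 < p, -1 < alpha, bergman_space p alpha f
      & x = (p / (alpha + 2))%:E]].

Definition hardy_number (R : realType) (f : R[i] -> R[i]) : \bar R :=
  ereal_sup [set p%:E | p in [set p | 0 < p /\ hardy_space p f]].

(* For f continuous on the disk and 0 < r < 1 this supremum is attained.      *)
Definition max_modulus (R : realType) (f : R[i] -> R[i]) (r : R) : R :=
  sup [set normc (f z) | z in [set z | normc z = r]].

(* The area is finite for f continuous on the disk and 0 < r < 1, so that     *)
(* fine loses nothing.                                                        *)
Definition image_area (R : realType) (f : R[i] -> R[i]) (r : R) : R :=
  fine (area (f @` disk r)).

(* - log (1 - r) / log x, with the usual order-of-growth convention that log  *)
(* stands for max(log, 0) and that a positive number divided by 0 is +oo.     *)
(* This only matters if x = max_modulus f r (or image_area f r) stays <= 1    *)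
(* for all r < 1: for f z = z / 2, whose Hardy number is +oo, the             *)
(* unconventional quotients tend to -oo. Otherwise x > 1 for all r            *)
(* close to 1, by monotonicity.                                               *)
Definition log_quotient (R : realType) (r x : R) : \bar R :=
  if 1 < x then (- ln (1 - r) / ln x)%:E else +oo%E.

(* Main.v *)
Require Import Defs.
From HB Require Import structures.
From mathcomp Require Import all_boot all_order all_algebra.
From mathcomp Require Import all_classical all_reals all_analysis.
From mathcomp Require Import complex ring lra.
(* Every quantity of the theorem is compared with the set of those lam > 0 for
   which |f z| ^ lam (1 - |z|) is bounded on the unit disk.

   The main tool is a weak form of Koebe's theorem: if f is holomorphic and
   injective on D(a, d), then f(D(a, d)) contains the disk of center f(a) and
   radius d |f'(a)| / 512. Normalize to F on the unit disk with F(0) = 0, let v be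
   an omitted value of almost minimal modulus, and let g be the square root of
   1 - F / v with g(0) = 1. Then g(D) and - g(D) are disjoint and g(D) contains a
   fixed disk around 1, so 1 / (1 + g) is bounded, and Cauchy's estimate bounds
   its derivative F'(0) / (8 v) at 0. It follows that |f'| / |f| is at most a
   multiple of 1 / d when f has no zero (Harnack), and, applied to f - f(z1) for a
   suitable z1, that |f - f(a)| is at most a multiple of d |f'(a)| on D(a, d / 2).

   By Harnack, f in A^p_alpha gives the exponent p / (alpha + 2), and f in H^p the
   exponent p. Conversely, an exponent lam gives f in A^(lam alpha)_alpha for all
   alpha > 0, the integrand being bounded, and lam alpha / (alpha + 2) tends to
   lam. To get f in H^p for p < lam, compare |f| ^ (p / 2) on the consecutive
   circles |z| = 1 - 2 ^ -n: at 2 ^ n equispaced points the increments are bounded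
   by |f| ^ (p / 2 - 1) times the radii of disjoint disks in the image of f, so
   that an area count bounds the sum of their squares by a multiple of M(r) ^ p,
   and the increments in L^2(dt) are summable.

   For the area psi, the inclusion of f(D(0, r)) in a disk bounds psi by M ^ 2;
   conversely, Koebe's theorem bounds the increments of f along a radius by
   psi ^ (1/2), and at dyadic radii these sum up to a geometric series. *)

Set Implicit Arguments.
Unset Strict Implicit.
Unset Printing Implicit Defensive.
Import Order.TTheory GRing.Theory Num.Theory.
Import numFieldNormedType.Exports.
Import Normc.
Local Open Scope classical_set_scope.
Local Open Scope ring_scope.

(** * Complex differentiability *)

Section Modulus.
Variable R : realType.
Implicit Types (x y : R) (z w : R[i]).

(** Exponents do not see constant factors, so every step is an estimate up to a factor, and areas
    enter only through squares inside or around a set. The obstacle is the passage from growth to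
    H^p: a bound [|f| ^ lam <= C / (1 - |z|)], inserted in the circle means, leaves them unbounded.
    What saves them is injectivity. The derivative in r of the mean of [|f| ^ p] on [|z| = r] is
    governed by the integral of [|f| ^ (p - 2) |f'| ^ 2] over D(0, r), which is the integral of
    [|w| ^ (p - 2)] over the image and hence at most a multiple of [M(r) ^ p]. The squared
    increments of [|f| ^ (p / 2)] are a discrete form of this integrand. Between the circles of
    index n and n + 1 they contribute [M ^ p / 2 ^ n], of order [2 ^ (- n (1 - p / lam))]: this is
    where p < lam enters, a loss that the supremum defining h(f) absorbs. *)

Lemma normcE z : normc z = Num.sqrt (complex.Re z ^+ 2 + complex.Im z ^+ 2).
Proof. by case: z. Qed.

Lemma normc_ge0 z : 0 <= normc z.
Proof. by rewrite normcE sqrtr_ge0. Qed.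

Lemma sqr_normcE z : normc z ^+ 2 = complex.Re z ^+ 2 + complex.Im z ^+ 2.
Proof. by rewrite normcE sqr_sqrtr // addr_ge0 // sqr_ge0. Qed.

Lemma normc_eq0 z : (normc z == 0) = (z == 0).
Proof. by apply/eqP/eqP => [/eq0_normc//|->]; exact: normc0. Qed.

Lemma normc_gt0 z : (0 < normc z) = (z != 0).
Proof. by rewrite lt0r normc_ge0 andbT normc_eq0. Qed.

Lemma normcB z w : normc (z - w) = normc (w - z).
Proof. by rewrite -normcN opprB. Qed.

Lemma ler_normcB z w : normc z - normc w <= normc (z - w).
Proof. by rewrite lerBlDr; apply: le_trans (le_normcD _ _); rewrite subrK. Qed.

Lemma normc_triangle u z w : normc (z - w) <= normc (z - u) + normc (u - w).
Proof. by apply: le_trans (le_normcD _ _); rewrite addrA subrK. Qed.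

Lemma normcR x : normc x%:C%C = `|x|.
Proof. by rewrite normcE /= expr0n addr0 sqrtr_sqr. Qed.

Lemma cReD z w : complex.Re (z + w) = complex.Re z + complex.Re w.
Proof. by case: z; case: w. Qed.

Lemma cImD z w : complex.Im (z + w) = complex.Im z + complex.Im w.
Proof. by case: z; case: w. Qed.

Lemma cReN z : complex.Re (- z) = - complex.Re z.
Proof. by case: z. Qed.

Lemma cImN z : complex.Im (- z) = - complex.Im z.
Proof. by case: z. Qed.

Lemma cReM z w :
  complex.Re (z * w) = complex.Re z * complex.Re w - complex.Im z * complex.Im w.
Proof. by case: z; case: w. Qed.

Lemma cImM z w :
  complex.Im (z * w) = complex.Re z * complex.Im w + complex.Im z * complex.Re w.
Proof. by case: z; case: w. Qed.

Lemma normRe_le z : `|complex.Re z| <= normc z.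
Proof.
by rewrite normcE -sqrtr_sqr ler_wsqrtr // lerDl sqr_ge0.
Qed.

Lemma normIm_le z : `|complex.Im z| <= normc z.
Proof.
by rewrite normcE -sqrtr_sqr ler_wsqrtr // lerDr sqr_ge0.
Qed.

Lemma normc_le_ReIm z : normc z <= `|complex.Re z| + `|complex.Im z|.
Proof.
rewrite -(@ler_pXn2r _ 2) ?nnegrE ?normc_ge0 ?addr_ge0 // sqr_normcE sqrrD.
by rewrite !real_normK ?num_real // lerD2r lerDl mulrn_wge0 // mulr_ge0.
Qed.

Lemma Re_le_normc z : complex.Re z <= normc z.
Proof. exact: le_trans (ler_norm _) (normRe_le z). Qed.

Lemma normC_normc z : `|z| = (normc z)%:C%C.
Proof. by rewrite normc_def normcE. Qed.

Lemma complex_eq z w :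
  complex.Re z = complex.Re w -> complex.Im z = complex.Im w -> z = w.
Proof. by case: z => a b; case: w => c d /= -> ->. Qed.

End Modulus.

Section Differentiability.
Variable R : realType.
Implicit Types (f g q : R[i] -> R[i]) (z w l : R[i]).

Definition ccont f z := forall e : R, 0 < e -> exists2 d : R, 0 < d &
  forall w, normc (w - z) < d -> normc (f w - f z) < e.

(* Caratheodory's form of complex differentiability. *)
Definition cdiff f z l := exists2 q, ccont q z /\ q z = l &
  forall w, f w = f z + q w * (w - z).

Definition hol (a : R[i]) (d : R) f :=
  forall z, normc (z - a) < d -> exists l, cdiff f z l.

Lemma ccont_cst l z : ccont (fun=> l) z.
Proof. by move=> e e0; exists 1 => // w _; rewrite subrr normc0. Qed.

Lemma ccont_id z : ccont id z.
Proof. by move=> e e0; exists e. Qed.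

Lemma ccont_comp f g z : ccont f z -> ccont g (f z) -> ccont (g \o f) z.
Proof.
move=> cf cg e /cg[d d0 gd]; have [d' d'0 fd] := cf _ d0.
by exists d' => // w /fd /gd.
Qed.

Lemma ccont_local f g z d : 0 < d ->
  (forall w, normc (w - z) < d -> f w = g w) -> ccont g z -> ccont f z.
Proof.
move=> d0 fg cg e /cg[d' d'0 gd]; exists (Num.min d d') => [|w].
  by rewrite lt_min d0.
rewrite lt_min => /andP[wd wd']; rewrite !fg ?subrr ?normc0 //.
exact: gd.
Qed.

Lemma ccontD f g z : ccont f z -> ccont g z -> ccont (fun w => f w + g w) z.
Proof.
move=> cf cg e e0; have e2 : 0 < e / 2 by rewrite divr_gt0.
have [d1 d10 h1] := cf _ e2; have [d2 d20 h2] := cg _ e2.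
exists (Num.min d1 d2) => [|w]; first by rewrite lt_min d10.
rewrite lt_min => /andP[/h1 wd /h2 wd'].
rewrite opprD addrACA (le_lt_trans (le_normcD _ _)) //.
by rewrite [ltRHS]splitr ltrD.
Qed.

Lemma ccontM f g z : ccont f z -> ccont g z -> ccont (fun w => f w * g w) z.
Proof.
move=> cf cg e e0.
set A := 1 + normc (g z); set B := 1 + normc (f z).
have A0 : 0 < A by rewrite ltr_wpDr ?normc_ge0.
have B0 : 0 < B by rewrite ltr_wpDr ?normc_ge0.
have [d1 d10 h1] := cf _ (divr_gt0 (divr_gt0 e0 (ltr0n _ 2)) A0).
have [d2 d20 h2] := cg _ (divr_gt0 (divr_gt0 e0 (ltr0n _ 2)) B0).
have [d3 d30 h3] := cg _ ltr01.
exists (Num.min d1 (Num.min d2 d3)) => [|w]; first by rewrite !lt_min d10 d20.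
rewrite !lt_min => /and3P[/h1 w1 /h2 w2 /h3 w3].
have -> : f w * g w - f z * g z = (f w - f z) * g w + f z * (g w - g z).
  by ring.
rewrite (le_lt_trans (le_normcD _ _)) // !normcM [ltRHS]splitr ltr_leD //.
- rewrite (@le_lt_trans _ _ (normc (f w - f z) * A)) -?ltr_pdivlMr//.
  rewrite ler_wpM2l ?normc_ge0 // /A.
  by have := ler_normcB (g w) (g z); move: w3; lra.
- have -> : e / 2 = B * (e / 2 / B) by rewrite [RHS]mulrC divfK // gt_eqF.
  by apply: ler_pM; rewrite ?normc_ge0 ?(ltW w2) ?lerDr.
Qed.

Lemma ccontN f z : ccont f z -> ccont (fun w => - f w) z.
Proof.
move=> cf e /cf[d d0 h]; exists d => // w /h.
by rewrite -opprD normcN.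
Qed.

Lemma ccontB f g z : ccont f z -> ccont g z -> ccont (fun w => f w - g w) z.
Proof. by move=> cf cg; apply: ccontD => //; apply: ccontN. Qed.

Lemma ccont_neq0 f z : ccont f z -> f z != 0 ->
  exists2 d : R, 0 < d &
    forall w, normc (w - z) < d -> normc (f z) / 2 < normc (f w).
Proof.
move=> cf; rewrite -normc_gt0 => f0.
have [d d0 h] := cf _ (divr_gt0 f0 (ltr0n _ 2)); exists d => // w /h.
by have := ler_normcB (f z) (f w); rewrite normcB; lra.
Qed.

Lemma ccont_inv z : z != 0 -> ccont (@GRing.inv R[i]) z.
Proof.
move=> z0 e e0; have := z0; rewrite -normc_gt0 => nz0.
have [d d0 h] := ccont_neq0 (@ccont_id z) z0.
exists (Num.min d (e * (normc z ^+ 2 / 2))) => [|w].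
  by rewrite lt_min d0 /= mulr_gt0 // divr_gt0 ?exprn_gt0.
rewrite lt_min => /andP[/h wd we].
have w0 : 0 < normc w by rewrite (lt_trans _ wd) // divr_gt0.
have -> : w^-1 - z^-1 = - ((w - z) / (w * z)).
  by field; rewrite ?z0 -?normc_gt0 ?w0 ?nz0.
rewrite normcN normcM normcV normcM ltr_pdivrMr ?mulr_gt0 //.
apply: (lt_le_trans we); rewrite ler_pM2l // expr2 mulrAC ler_pM2r //.
exact: ltW.
Qed.

Lemma ccontV f z : ccont f z -> f z != 0 -> ccont (fun w => (f w)^-1) z.
Proof. by move=> cf f0; apply: (ccont_comp cf); apply: ccont_inv. Qed.

Lemma cdiff_cont f z l : cdiff f z l -> ccont f z.
Proof.
case=> q [cq _] fE; apply: (@ccont_local _ (fun w => f z + q w * (w - z)) _ 1) => //.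
apply: ccontD; first exact: ccont_cst.
by apply: ccontM => //; apply: ccontB; [exact: ccont_id|exact: ccont_cst].
Qed.

Lemma cdiff_cst l z : cdiff (fun=> l) z 0.
Proof.
by exists (fun=> 0); [split => //; exact: ccont_cst|move=> w; rewrite mul0r addr0].
Qed.

Lemma cdiff_id z : cdiff id z 1.
Proof.
exists (fun=> 1); first by split => //; exact: ccont_cst.
by move=> w; rewrite mul1r addrC subrK.
Qed.

Lemma cdiffD f g z l m : cdiff f z l -> cdiff g z m ->
  cdiff (fun w => f w + g w) z (l + m).
Proof.
case=> q [cq ql] fE [r [cr rl] gE]; exists (fun w => q w + r w).
  by split; [exact: ccontD|rewrite ql rl].
by move=> w; rewrite fE gE; ring.
Qed.

Lemma cdiffM f g z l m : cdiff f z l -> cdiff g z m ->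
  cdiff (fun w => f w * g w) z (l * g z + f z * m).
Proof.
move=> df dg; have cg := cdiff_cont dg.
case: df => q [cq ql] fE; case: dg => r [cr rl] gE.
exists (fun w => q w * g w + f z * r w).
  split; last by rewrite ql rl.
  by apply: ccontD; apply: ccontM => //; exact: ccont_cst.
by move=> w; rewrite fE gE; ring.
Qed.

Lemma cdiffZ f z l c : cdiff f z l -> cdiff (fun w => c * f w) z (c * l).
Proof.
by move=> df; have := cdiffM (cdiff_cst c z) df; rewrite mul0r add0r.
Qed.

Lemma cdiffB f g z l m : cdiff f z l -> cdiff g z m ->
  cdiff (fun w => f w - g w) z (l - m).
Proof.
case=> q [cq ql] fE [r [cr rl] gE]; exists (fun w => q w - r w).
  by split; [exact: ccontB|rewrite ql rl].
by move=> w; rewrite fE gE; ring.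
Qed.

Lemma cdiff_comp f g z l m : cdiff f z l -> cdiff g (f z) m ->
  cdiff (g \o f) z (m * l).
Proof.
move=> df; have cf := cdiff_cont df.
case: df => q [cq ql] fE [r [cr rl] gE].
exists (fun w => r (f w) * q w); first split.
- by apply: ccontM => //; exact: (ccont_comp cf cr).
- by rewrite rl ql.
- move=> w; rewrite /= gE; congr (_ + _); rewrite -mulrA; congr (_ * _).
  by rewrite fE; ring.
Qed.

Lemma cdiff_inv z : z != 0 -> cdiff (@GRing.inv R[i]) z (- z^-1 ^+ 2).
Proof.
(* At 0 the convention [0^-1 = 0] forces the value [z^-1 ^+ 2] of the slope function; near [z] only
   the other branch counts. *)
move=> z0; exists (fun w => if w == 0 then z^-1 ^+ 2 else - (w * z)^-1); first split.
- have [d d0 h] := ccont_neq0 (@ccont_id z) z0.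
  apply: (@ccont_local _ (fun w => - (w * z)^-1) _ d) => // [w /h wd|].
    rewrite ifF //; apply: negbTE; rewrite -normc_gt0.
    by apply: le_lt_trans wd; rewrite divr_ge0 ?normc_ge0.
  apply: ccontN; apply: ccontV; last by rewrite mulf_neq0.
  by apply: ccontM; [exact: ccont_id|exact: ccont_cst].
- by rewrite (negbTE z0); field; rewrite z0.
- move=> w; case: eqVneq => [->|w0]; last by field; rewrite z0.
  by rewrite invr0; field.
Qed.

Lemma cdiffV f z l : cdiff f z l -> f z != 0 ->
  cdiff (fun w => (f w)^-1) z (- (f z)^-1 ^+ 2 * l).
Proof. by move=> df f0; apply: (cdiff_comp df); exact: cdiff_inv. Qed.

Lemma cdiff_approx f z l : cdiff f z l -> forall e : R, 0 < e ->
  exists2 d : R, 0 < d & forall w, normc (w - z) < d ->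
    normc (f w - f z - l * (w - z)) <= e * normc (w - z).
Proof.
case=> q [cq <-] fE e /cq[d d0 h]; exists d => // w /h qw.
have -> : f w - f z - q z * (w - z) = (q w - q z) * (w - z) by rewrite fE; ring.
by rewrite normcM ler_wpM2r ?normc_ge0 // ltW.
Qed.

Lemma approx_cdiff f z l : (forall e : R, 0 < e ->
  exists2 d : R, 0 < d & forall w, normc (w - z) < d ->
    normc (f w - f z - l * (w - z)) <= e * normc (w - z)) -> cdiff f z l.
Proof.
move=> H; exists (fun w => if w == z then l else (f w - f z) / (w - z)); last first.
  move=> w; case: eqVneq => [->|wz]; first by rewrite subrr mulr0 addr0.
  by rewrite divfK ?subr_eq0 // addrC subrK.
rewrite eqxx; split => // e e0.
have [d d0 h] := H _ (divr_gt0 e0 (ltr0n _ 2)); exists d => // w /h wd.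
rewrite eqxx; case: eqVneq wd => [_ _|wz wd]; first by rewrite subrr normc0.
have wz0 : w - z != 0 by rewrite subr_eq0.
have -> : (f w - f z) / (w - z) - l = (f w - f z - l * (w - z)) / (w - z) by field.
rewrite normcM normcV ltr_pdivrMr ?normc_gt0 // (le_lt_trans wd) //.
by rewrite ltr_pM2r ?normc_gt0 //; lra.
Qed.

Lemma cdiff_local f g z l d : 0 < d ->
  (forall w, normc (w - z) < d -> f w = g w) -> cdiff g z l -> cdiff f z l.
Proof.
move=> d0 fg /cdiff_approx dg; apply: approx_cdiff => e /dg[d' d'0 h].
exists (Num.min d d') => [|w]; first by rewrite lt_min d0.
rewrite lt_min => /andP[wd wd']; rewrite !fg ?subrr ?normc0 //.
exact: h.
Qed.

Lemma derivable_cdiff f z :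
  derivable (f : R[i]^o -> R[i]^o) z 1 -> exists l, cdiff f z l.
Proof.
move=> /cvg_ex[/= l Hl]; exists l; apply: approx_cdiff => e e0.
have eC : (0 : R[i]) < e%:C%C by rewrite ltcR.
move/cvgrPdist_lt : Hl => /(_ _ eC).
rewrite near_withinE => /nbhs_ballP[/= d d0 Hd].
(* A positive element of [R[i]] has imaginary part 0, so the radius of the ball is real. *)
have dE : d = (complex.Re d)%:C%C.
  by case: d d0 {Hd} => a b; rewrite ltcE /= => /andP[/eqP -> _].
have d0' : 0 < complex.Re d by rewrite dE ltcR in d0.
exists (complex.Re d) => // w wd.
have [->|wz] := eqVneq w z; first by rewrite !subrr mulr0 subr0 normc0 mulr0.
have wz0 : w - z != 0 by rewrite subr_eq0.
have := Hd (w - z); rewrite /ball /= sub0r normrN normC_normc dE ltcR => /(_ wd wz0).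
rewrite normC_normc ltcR /=.
have -> : (w - z) *: (1 : R[i]^o) + z = w by rewrite [_ *: _]mulr1 subrK.
have -> : (l - (w - z)^-1 *: (f w - f z) : R[i]) =
          - ((f w - f z - l * (w - z)) / (w - z)).
  by rewrite /GRing.scale /=; field.
rewrite normcN normcM normcV ltr_pdivrMr ?normc_gt0 // => /ltW.
by [].
Qed.

End Differentiability.

(** * Bisection of squares and compactness *)

Section Bisection.
Variable R : realType.

Lemma halving_lt (s d : R) : 0 < d -> exists n, s / 2 ^+ n < d.
Proof.
move=> d0; exists (Num.truncn (s / d)).+1.
rewrite ltr_pdivrMr ?exprn_gt0 // mulrC -ltr_pdivrMr //.
apply: (lt_trans (truncnS_gt _)); rewrite -natrX ltr_nat.
exact: ltn_expl.
Qed.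

Lemma nested_point (x s : nat -> R) :
  (forall n, 0 <= s n) -> (forall n, x n <= x n.+1) ->
  (forall n, x n.+1 + s n.+1 <= x n + s n) ->
  exists p, forall n, x n <= p <= x n + s n.
Proof.
move=> s0 xi xs.
have mx : {homo x : n m / (n <= m)%N >-> n <= m}.
  by apply: homo_leq => //; exact: le_trans.
have ms n m : (n <= m)%N -> x m + s m <= x n + s n.
  elim: m => [|m IH]; first by rewrite leqn0 => /eqP->.
  rewrite leq_eqVlt => /predU1P[->//|]; rewrite ltnS => /IH.
  exact: le_trans.
have xm n m : x n <= x m + s m.
  have [nm|/ltnW mn] := leqP n m; first by rewrite (le_trans (mx _ _ nm)) // lerDl.
  by apply: le_trans (ms _ _ mn); rewrite lerDl.
have ub m : ubound (range x) (x m + s m) by move=> _ [n _ <-].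
have ne : range x !=set0 by exists (x 0%N), 0%N.
exists (sup (range x)) => n; apply/andP; split.
  by apply: ub_le_sup; [exists (x 0%N + s 0%N); exact: ub|exists n].
exact: ge_sup.
Qed.

(** A square on which [Q] fails has a quarter on which it fails; the nested quarters shrink to a
    point, where the last hypothesis is contradicted. This one compactness argument serves Goursat's
    theorem, the boundedness of continuous functions and the connectedness of segments. *)
Lemma bisection (Q : R -> R -> R -> Prop) (x0 y0 s0 : R) : 0 < s0 ->
  (forall x y s, 0 < s ->
    x0 <= x -> x + s <= x0 + s0 -> y0 <= y -> y + s <= y0 + s0 ->
    Q x y (s / 2) -> Q (x + s / 2) y (s / 2) ->
    Q x (y + s / 2) (s / 2) -> Q (x + s / 2) (y + s / 2) (s / 2) -> Q x y s) ->
  (forall px py, x0 <= px <= x0 + s0 -> y0 <= py <= y0 + s0 ->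
    exists2 d, 0 < d & forall x y s, 0 < s < d ->
    x0 <= x -> x + s <= x0 + s0 -> y0 <= y -> y + s <= y0 + s0 ->
    x <= px <= x + s -> y <= py <= y + s -> Q x y s) ->
  Q x0 y0 s0.
Proof.
move=> s0_gt0 Qcombine Qlocal; apply: contrapT => nQ.
(* Here [s] is the halved side. The fourth quarter is taken untested: if [Q] holds on the other
   three, it fails there by [Qcombine]. *)
pose step (s : R) (p : R * R) : R * R := let: (x, y) := p in
  if pselect (Q x y s) then
    if pselect (Q (x + s) y s) then
      if pselect (Q x (y + s) s) then (x + s, y + s) else (x, y + s)
    else (x + s, y)
  else (x, y).
pose s n := s0 / 2 ^+ n.
have s_gt0 n : 0 < s n by rewrite divr_gt0 // exprn_gt0.
have sS n : s n.+1 = s n / 2 by rewrite /s exprS; field; rewrite expf_neq0.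
pose u := fix u n := if n is m.+1 then step (s n) (u m) else (x0, y0).
have uS n : u n.+1 = step (s n.+1) (u n) by [].
have stepx n : (u n.+1).1 = (u n).1 \/ (u n.+1).1 = (u n).1 + s n.+1.
  by rewrite uS /step; case: (u n) => x y; do !case: pselect => ? /=; tauto.
have stepy n : (u n.+1).2 = (u n).2 \/ (u n.+1).2 = (u n).2 + s n.+1.
  by rewrite uS /step; case: (u n) => x y; do !case: pselect => ? /=; tauto.
have x_incr n : (u n).1 <= (u n.+1).1.
  by have := s_gt0 n.+1; case: (stepx n) => ->; lra.
have y_incr n : (u n).2 <= (u n.+1).2.
  by have := s_gt0 n.+1; case: (stepy n) => ->; lra.
have x_decr n : (u n.+1).1 + s n.+1 <= (u n).1 + s n.
  by have := s_gt0 n; have := sS n; case: (stepx n) => ->; lra.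
have y_decr n : (u n.+1).2 + s n.+1 <= (u n).2 + s n.
  by have := s_gt0 n; have := sS n; case: (stepy n) => ->; lra.
have s_0 : s 0%N = s0 by rewrite /s expr0 divr1.
have inside n : [/\ x0 <= (u n).1, (u n).1 + s n <= x0 + s0,
    y0 <= (u n).2 & (u n).2 + s n <= y0 + s0].
  elim: n => [|n [h1 h2 h3 h4]]; first by rewrite s_0.
  split; [exact: le_trans (x_incr n)|exact: le_trans (x_decr n) _|
          exact: le_trans (y_incr n)|exact: le_trans (y_decr n) _].
have nQn n : ~ Q (u n).1 (u n).2 (s n).
  elim: n => [|n IH]; first by rewrite s_0.
  have [h1 h2 h3 h4] := inside n.
  have := @Qcombine (u n).1 (u n).2 (s n) (s_gt0 n) h1 h2 h3 h4.
  rewrite uS /step; case: (u n) IH => x y /= IH; rewrite -sS.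
  by do !case: pselect => ? //=; tauto.
have [px hpx] := nested_point (fun n => ltW (s_gt0 n)) x_incr x_decr.
have [py hpy] := nested_point (fun n => ltW (s_gt0 n)) y_incr y_decr.
have [d d0 hd] : exists2 d, 0 < d & forall x y s, 0 < s < d ->
    x0 <= x -> x + s <= x0 + s0 -> y0 <= y -> y + s <= y0 + s0 ->
    x <= px <= x + s -> y <= py <= y + s -> Q x y s.
  by apply: Qlocal; [have := hpx 0%N|have := hpy 0%N]; rewrite s_0.
have [n sn] := halving_lt s0 d0.
have [h1 h2 h3 h4] := inside n.
by apply: (nQn n); apply: hd; rewrite // s_gt0.
Qed.

(** The bisected square sticks out of [K], so a local bound is asked for at every point of the
    plane; outside a closed [K] it holds vacuously on a small disk. *)
Lemma locally_bounded_bounded (K : set R[i]) (phi : R[i] -> R) (r : R) :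
  (forall z, K z -> normc z <= r) ->
  (forall z, exists2 d : R, 0 < d & exists B, forall w, K w ->
     normc (w - z) < d -> phi w <= B) ->
  exists B, forall z, K z -> phi z <= B.
Proof.
move=> Kr loc; set r1 := `|r| + 1.
have r1_gt0 : 0 < r1 by rewrite ltr_wpDl.
pose Q (x y s : R) := exists B, forall z, K z ->
  x <= complex.Re z <= x + s -> y <= complex.Im z <= y + s -> phi z <= B.
have [|x y s s_gt0 _ _ _ _ [B1 h1] [B2 h2] [B3 h3] [B4 h4]|px py _ _|B HB] :=
    @bisection Q (- r1) (- r1) (2 * r1).
- by rewrite mulr_gt0.
- exists (Num.max (Num.max B1 B2) (Num.max B3 B4)) => z Kz /andP[x1 x2] /andP[y1 y2].
  rewrite !le_max; have [xs|/ltW xs] := leP (complex.Re z) (x + s / 2);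
    have [ys|/ltW ys] := leP (complex.Im z) (y + s / 2).
  + by rewrite h1 // ?x1 ?y1.
  + by rewrite h3 ?orbT // ?x1 ?xs //; lra.
  + by rewrite h2 ?orbT // ?y1 ?ys //; lra.
  + by rewrite h4 ?orbT //; lra.
- have [d d0 [B HB]] := loc (px +i* py)%C.
  exists (d / 2) => [|x y s /andP[s0 sd] _ _ _ _ hx hy]; first by rewrite divr_gt0.
  exists B => z Kz hx' hy'; apply: HB => //.
  apply: (le_lt_trans (normc_le_ReIm _)); rewrite cReD cImD cReN cImN /=.
  have : `|complex.Re z - px| <= s by rewrite ler_norml; lra.
  have : `|complex.Im z - py| <= s by rewrite ler_norml; lra.
  lra.
exists B => z Kz; have := normRe_le z; have := normIm_le z; have := Kr z Kz.
have := ler_norm r; rewrite !ler_norml => hr h /andP[h1 h2] /andP[h3 h4].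
by apply: HB => //; rewrite /r1; lra.
Qed.

Lemma ccont_bounded (f : R[i] -> R[i]) (r : R) :
  (forall z, normc z <= r -> ccont f z) ->
  exists B, forall z, normc z <= r -> normc (f z) <= B.
Proof.
move=> fc; apply: (@locally_bounded_bounded [set z | normc z <= r] (fun z => normc (f z)) r) => [|z]; first by [].
have [zr|zr] := leP (normc z) r.
  have [d d0 h] := fc z zr _ ltr01.
  exists d => //; exists (normc (f z) + 1) => w _ /h.
  by have := ler_normcB (f w) (f z); lra.
exists (normc z - r); first by rewrite subr_gt0.
by exists 0 => w /=; have := ler_normcB z w; rewrite normcB; lra.
Qed.

End Bisection.

(** * Goursat's theorem and the maximum principle *)

Section RealContinuity.
Variable R : realType.

Lemma real_continuous (f : R -> R) (x : R) :
  (forall e, 0 < e -> exists2 d, 0 < d &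
    forall y, `|y - x| < d -> `|f y - f x| < e) -> {for x, continuous f}.
Proof.
move=> H; apply/cvgrPdist_lt => e /H[d d0 h].
apply/nbhs_ballP; exists d => // y; rewrite /ball /= distrC => /h.
by rewrite distrC.
Qed.

Lemma is_derive_approx (f : R -> R) (x l : R) : is_derive x 1 f l ->
  forall e, 0 < e -> exists2 d, 0 < d & forall y, `|y - x| < d ->
    `|f y - f x - l * (y - x)| <= e * `|y - x|.
Proof.
case=> df fl e e0.
have Hl : h^-1 *: (f (h *: (1 : R) + x) - f x) @[h --> 0^'] --> l.
  by rewrite -fl; exact: df.
move/cvgrPdist_lt : Hl => /(_ _ e0).
rewrite near_withinE => /nbhs_ballP[/= d d0 Hd]; exists d => // y yd.
have [->|yx] := eqVneq y x; first by rewrite !subrr mulr0 subr0 normr0 mulr0.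
have yx0 : y - x != 0 by rewrite subr_eq0.
have := Hd (y - x); rewrite /ball /= sub0r normrN => /(_ yd yx0).
have -> : (y - x) *: (1 : R) + x = y by rewrite [_ *: _]mulr1 subrK.
have -> : l - (y - x)^-1 *: (f y - f x) = - ((f y - f x - l * (y - x)) / (y - x)).
  by rewrite /GRing.scale /=; field.
rewrite normrN normrM normfV ltr_pdivrMr ?normr_gt0 // => /ltW.
by [].
Qed.

Definition cint (a b : R) (phi : R -> R) : R :=
  \int[@lebesgue_measure R]_(x in `[a, b]) phi x.

(** Two-sided continuity even at the end points, which passes to subintervals, sums and products at
    once. *)
Definition cont_on (a b : R) (phi : R -> R) :=
  forall x, a <= x <= b -> {for x, continuous phi}.

Lemma cont_on_within a b phi : cont_on a b phi -> {within `[a, b], continuous phi}.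
Proof.
move=> cphi; apply: continuous_in_subspaceT => x.
by rewrite inE /= in_itv /= => /cphi.
Qed.

Lemma cont_onB a b phi psi : cont_on a b phi -> cont_on a b psi ->
  cont_on a b (fun x => phi x - psi x).
Proof. by move=> h1 h2 x xab; apply: cvgB; [exact: h1|exact: h2]. Qed.

Lemma cont_on_cst a b (l : R) : cont_on a b (fun=> l).
Proof. by move=> x _; exact: cvg_cst. Qed.

Lemma cont_on_integrable a b phi : cont_on a b phi ->
  (@lebesgue_measure R).-integrable `[a, b] (EFin \o phi).
Proof.
move=> cphi; apply: continuous_compact_integrable; first exact: segment_compact.
exact: cont_on_within.
Qed.

Lemma cint_cst a b l : a <= b -> cint a b (fun=> l) = l * (b - a).
Proof.
move=> ab; rewrite /cint Rintegral_cst; last exact: measurable_itv.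
rewrite [X in fine X](@lebesgue_measure_itv R) /= lte_fin.
move: ab; rewrite le_eqVlt => /predU1P[->|->//].
by rewrite ltxx subrr.
Qed.

Lemma cint_split a b c phi : a <= c <= b -> cont_on a b phi ->
  cint a b phi = cint a c phi + cint c b phi.
Proof.
move=> /andP[ac cb] /cont_on_integrable iphi; rewrite /cint.
have := @Rintegral_itvB R phi (BLeft a) (BRight b) c iphi.
rewrite !bnd_simp => /(_ ac cb)/eqP; rewrite subr_eq addrC => /eqP ->.
rewrite Rintegral_itv_obnd_cbnd //; apply: integrableS iphi => //.
by apply: subset_itv; rewrite bnd_simp.
Qed.

Lemma cintB a b phi psi : cont_on a b phi -> cont_on a b psi ->
  cint a b (fun x => phi x - psi x) = cint a b phi - cint a b psi.
Proof.
by move=> /cont_on_integrable ? /cont_on_integrable ?; exact: RintegralB.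
Qed.

Lemma cint_le a b phi psi : cont_on a b phi -> cont_on a b psi ->
  (forall x, a <= x <= b -> phi x <= psi x) -> cint a b phi <= cint a b psi.
Proof.
move=> /cont_on_integrable ? /cont_on_integrable ? h; exact: le_Rintegral.
Qed.

Lemma cint_approx a b phi l e : a <= b -> cont_on a b phi ->
  (forall x, a <= x <= b -> `|phi x - l| <= e) ->
  `|cint a b phi - l * (b - a)| <= e * (b - a).
Proof.
move=> ab cphi h; rewrite ler_norml; apply/andP; split.
  rewrite lerBrDr -mulNr -mulrDl -cint_cst //; apply: cint_le => //.
    exact: cont_on_cst.
  by move=> x /h; rewrite ler_norml => /andP[h1 _]; move: h1; lra.
rewrite lerBlDr -mulrDl -cint_cst //; apply: cint_le => //.
  exact: cont_on_cst.
by move=> x /h; rewrite ler_norml => /andP[_ h1]; move: h1; lra.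
Qed.

End RealContinuity.

Section Goursat.
Variable R : realType.
Local Notation Cx x y := (Complex (x : R) (y : R)).

Lemma ccont_sectionx (F : R[i] -> R[i]) (x y : R) : ccont F (Cx x y) ->
  {for x, continuous (fun s => complex.Re (F (Cx s y)))} /\
  {for x, continuous (fun s => complex.Im (F (Cx s y)))}.
Proof.
move=> cF; split; apply: real_continuous => e /cF[d d0 h]; exists d => // s sd;
  have /h : normc (Cx s y - Cx x y) < d
    by rewrite (_ : _ - _ = (s - x)%:C%C) ?normcR //= /real_complex_def; apply: complex_eq; rewrite /= ?subrr.
- by apply: le_lt_trans; rewrite -cReN -cReD normRe_le.
- by apply: le_lt_trans; rewrite -cImN -cImD normIm_le.
Qed.

Lemma ccont_sectiony (F : R[i] -> R[i]) (x y : R) : ccont F (Cx x y) ->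
  {for y, continuous (fun t => complex.Re (F (Cx x t)))} /\
  {for y, continuous (fun t => complex.Im (F (Cx x t)))}.
Proof.
move=> cF; split; apply: real_continuous => e /cF[d d0 h]; exists d => // s sd;
  have /h : normc (Cx x s - Cx x y) < d
    by rewrite normcE /= subrr expr0n add0r sqrtr_sqr.
- by apply: le_lt_trans; rewrite -cReN -cReD normRe_le.
- by apply: le_lt_trans; rewrite -cImN -cImD normIm_le.
Qed.

(* Minus the real part of the integral of F(z) dz along the boundary of the
   square with lower left corner x + iy and side s. *)
Let J (F : R[i] -> R[i]) (x y s : R) : R :=
  (cint x (x + s) (fun u => complex.Re (F (Cx u y))) -
   cint x (x + s) (fun u => complex.Re (F (Cx u (y + s))))) -
  (cint y (y + s) (fun v => complex.Im (F (Cx (x + s) v))) -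
   cint y (y + s) (fun v => complex.Im (F (Cx x v)))).

(** An inner side is shared by two quarters, which traverse it in opposite directions. *)
Let J_quarters F x y s : 0 < s ->
  (forall u v, x <= u <= x + s -> y <= v <= y + s -> ccont F (Cx u v)) ->
  J F x y s = J F x y (s / 2) + J F (x + s / 2) y (s / 2) +
    (J F x (y + s / 2) (s / 2) + J F (x + s / 2) (y + s / 2) (s / 2)).
Proof.
move=> s0 cF; rewrite /J -!addrA -!splitr.
have hx v : y <= v <= y + s ->
    cint x (x + s) (fun u => complex.Re (F (Cx u v))) =
    cint x (x + s / 2) (fun u => complex.Re (F (Cx u v))) +
    cint (x + s / 2) (x + s) (fun u => complex.Re (F (Cx u v))).
  move=> hv; rewrite (@cint_split _ _ _ (x + s / 2)) //; first lra.
  by move=> u hu; have [] := ccont_sectionx (cF u v hu hv).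
have hy u : x <= u <= x + s ->
    cint y (y + s) (fun v => complex.Im (F (Cx u v))) =
    cint y (y + s / 2) (fun v => complex.Im (F (Cx u v))) +
    cint (y + s / 2) (y + s) (fun v => complex.Im (F (Cx u v))).
  move=> hu; rewrite (@cint_split _ _ _ (y + s / 2)) //; first lra.
  by move=> v hv; have [] := ccont_sectiony (cF u v hu hv).
by rewrite (hx y) ?(hx (y + s)) ?(hy x) ?(hy (x + s)); lra.
Qed.

Lemma goursat (F : R[i] -> R[i]) (x0 y0 s0 : R) : 0 < s0 ->
  (forall x y, x0 <= x <= x0 + s0 -> y0 <= y <= y0 + s0 ->
     exists l, cdiff F (Cx x y) l) ->
  cint x0 (x0 + s0) (fun u => complex.Re (F (Cx u y0))) -
  cint x0 (x0 + s0) (fun u => complex.Re (F (Cx u (y0 + s0)))) =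
  cint y0 (y0 + s0) (fun v => complex.Im (F (Cx (x0 + s0) v))) -
  cint y0 (y0 + s0) (fun v => complex.Im (F (Cx x0 v))).
Proof.
move=> s0_gt0 dF; apply/eqP; rewrite -subr_eq0 -/(J F x0 y0 s0) -normr_le0.
have cF u v : x0 <= u <= x0 + s0 -> y0 <= v <= y0 + s0 -> ccont F (Cx u v).
  by move=> hu hv; have [l] := dF u v hu hv; exact: cdiff_cont.
apply/ler_addgt0Pr => e' e'0; rewrite add0r.
pose e := e' / s0 ^+ 2; have e0 : 0 < e by rewrite divr_gt0 ?exprn_gt0.
have -> : e' = e * s0 ^+ 2 by rewrite /e divfK // expf_neq0 ?gt_eqF.
(* The bound [e * s ^+ 2] is the sum of the bounds for the four quarters, so that only small squares
   remain. *)
apply: (@bisection _ (fun x y s => `|J F x y s| <= e * s ^+ 2) x0 y0 s0) => //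
    [x y s s_gt0 x1 x2 y1 y2 h1 h2 h3 h4|px py hx hy].
  rewrite J_quarters //; last by move=> u v hu hv; apply: cF; lra.
  apply: (le_trans (ler_normD _ _)); apply: (le_trans (lerD (ler_normD _ _) (ler_normD _ _))).
  rewrite (_ : e * s ^+ 2 = e * (s / 2) ^+ 2 + e * (s / 2) ^+ 2 +
    (e * (s / 2) ^+ 2 + e * (s / 2) ^+ 2)); last by field.
  by apply: lerD; apply: lerD.
have [l /cdiff_approx dFp] := dF px py hx hy.
(* The points of the square are within [2 * s] of p, a difference of opposite sides involves two
   values, and there are two such differences: 8 = 2 * 2 * 2. *)
have [d d0 hd] := dFp _ (divr_gt0 e0 (ltr0n _ 8)).
exists (d / 2) => [|x y s /andP[s_gt0 sd] x1 x2 y1 y2 hpx hpy]; first by rewrite divr_gt0.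
have near_p u v : x <= u <= x + s -> y <= v <= y + s ->
    normc (F (Cx u v) - F (Cx px py) - l * (Cx u v - Cx px py)) <= e / 4 * s.
  move=> hu hv.
  have hn : normc (Cx u v - Cx px py) <= 2 * s.
    apply: (le_trans (normc_le_ReIm _)) => /=.
    have : `|u - px| <= s by rewrite ler_norml; lra.
    have : `|v - py| <= s by rewrite ler_norml; lra.
    lra.
  apply: (le_trans (hd _ _)); first by apply: (le_lt_trans hn); lra.
  rewrite (_ : e / 4 * s = e / 8 * (2 * s)); last by field.
  by rewrite ler_wpM2l // divr_ge0 // ltW.
(* The affine part of [F] at p contributes [beta * s] to both differences of opposite sides, and
   these contributions cancel in [J]. *)
set beta := complex.Im l.
have hU u : x <= u <= x + s ->
    `|complex.Re (F (Cx u y)) - complex.Re (F (Cx u (y + s))) - beta * s| <= e / 2 * s.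
  move=> hu; have yy : y <= y <= y + s by lra.
  have ys : y <= y + s <= y + s by lra.
  have H1 := le_trans (normRe_le _) (near_p u y hu yy).
  have H2 := le_trans (normRe_le _) (near_p u (y + s) hu ys).
  move: H1 H2; rewrite !(cReD, cReN, cReM, cImD, cImN) /= -/beta.
  rewrite !ler_norml => /andP[? ?] /andP[? ?]; apply/andP; split; lra.
have hV v : y <= v <= y + s ->
    `|complex.Im (F (Cx (x + s) v)) - complex.Im (F (Cx x v)) - beta * s| <= e / 2 * s.
  move=> hv; have xx : x <= x <= x + s by lra.
  have xs : x <= x + s <= x + s by lra.
  have H1 := le_trans (normIm_le _) (near_p x v xx hv).
  have H2 := le_trans (normIm_le _) (near_p (x + s) v xs hv).
  move: H1 H2; rewrite !(cImD, cImN, cImM, cReD, cReN) /= -/beta.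
  rewrite !ler_norml => /andP[? ?] /andP[? ?]; apply/andP; split; lra.
have [xle yle] : x <= x + s /\ y <= y + s by rewrite !lerDl ltW.
have [xx xs] : x <= x <= x + s /\ x <= x + s <= x + s by rewrite !lexx xle.
have [yy ys] : y <= y <= y + s /\ y <= y + s <= y + s by rewrite !lexx yle.
have cFs u v : x <= u <= x + s -> y <= v <= y + s -> ccont F (Cx u v).
  by move=> /andP[? ?] /andP[? ?]; apply: cF; apply/andP; split; lra.
have cx v : y <= v <= y + s ->
    cont_on x (x + s) (fun u => complex.Re (F (Cx u v))).
  by move=> hv u hu; have [] := ccont_sectionx (cFs u v hu hv).
have cy u : x <= u <= x + s ->
    cont_on y (y + s) (fun v => complex.Im (F (Cx u v))).
  by move=> hu v hv; have [] := ccont_sectiony (cFs u v hu hv).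
have := cint_approx xle (cont_onB (cx y yy) (cx (y + s) ys)) hU.
have := cint_approx yle (cont_onB (cy (x + s) xs) (cy x xx)) hV.
rewrite (cintB (cx y yy) (cx (y + s) ys)) (cintB (cy (x + s) xs) (cy x xx)).
rewrite /J (addrC x s) (addrC y s) !addrK; clear.
rewrite !ler_norml => /andP[? ?] /andP[? ?]; apply/andP; split; lra.
Qed.

End Goursat.

(** * Polar coordinates, the exponential function and the maximum principle *)

Section MeanValue.
Variable R : realType.
Local Notation Cx x y := (Complex (x : R) (y : R)).

Definition cis (t : R) : R[i] := Cx (cos t) (sin t).

Definition cexp (z : R[i]) : R[i] := (expR (complex.Re z))%:C%C * cis (complex.Im z).

Lemma normc_cis t : normc (cis t) = 1.
Proof. by rewrite normcE /= cos2Dsin2 sqrtr1. Qed.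

Lemma cisD s t : cis (s + t) = cis s * cis t.
Proof. by apply: complex_eq; rewrite ?cReM ?cImM /= ?cosD ?sinD; ring. Qed.

Lemma polarE (r t : R) : Cx (r * cos t) (r * sin t) = r%:C%C * cis t.
Proof. by apply: complex_eq; rewrite ?cReM ?cImM /=; ring. Qed.

Lemma polar_form (z : R[i]) :
  exists2 t : R, 0 <= t <= 2 * pi & z = (normc z)%:C%C * cis t.
Proof.
have [->|z0] := eqVneq z 0.
  by exists 0; rewrite ?lexx ?mulr_ge0 ?pi_ge0 // normc0 mul0r.
have nz : 0 < normc z by rewrite normc_gt0.
have Re1 : -1 <= complex.Re z / normc z <= 1.
  by rewrite -ler_norml normrM normfV (gtr0_norm nz) ler_pdivrMr // mul1r normRe_le.
have [t0 tpi] := acos_def Re1; set t := acos _ in t0 tpi *.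
have sq : sin t ^+ 2 = (complex.Im z / normc z) ^+ 2.
  rewrite sin2cos2 tpi !exprMn !exprVn sqr_normcE; field.
  by rewrite -sqr_normcE expf_neq0 // gt_eqF.
have sint : 0 <= sin t by apply: sin_ge0_pi.
have [Im0|Im0] := leP 0 (complex.Im z).
  exists t; first by have := pi_ge0 R; move: t0; lra.
  have st : sin t = complex.Im z / normc z.
    by apply/eqP; rewrite -(@eqrXn2 _ 2) ?sq // divr_ge0 // ltW.
  by apply: complex_eq; rewrite ?cReM ?cImM /= ?tpi ?st; field; rewrite gt_eqF.
exists (2 * pi - t); first by have := pi_ge0 R; move: t0; lra.
have st : sin t = - (complex.Im z / normc z).
  apply/eqP; rewrite -(@eqrXn2 _ 2) ?sqrrN ?sq // -mulNr divr_ge0 ?ltW //.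
  by rewrite oppr_gt0.
rewrite mulr_natl cisD /cis cos2pi sin2pi cosN sinN st tpi.
by apply: complex_eq; rewrite ?(cReM, cImM) /=; field; rewrite gt_eqF.
Qed.

Lemma cexpE x y : cexp (Cx x y) = (expR x)%:C%C * cis y.
Proof. by []. Qed.

Lemma normc_cexp z : normc (cexp z) = expR (complex.Re z).
Proof. by rewrite normcM normc_cis mulr1 normcR ger0_norm // expR_ge0. Qed.

Lemma cexpD z w : cexp (z + w) = cexp z * cexp w.
Proof.
rewrite /cexp cReD cImD expRD cisD.
by apply: complex_eq; rewrite ?(cReM, cImM) /=; ring.
Qed.

Lemma cdiff_cexp0 : cdiff cexp 0 1.
Proof.
apply: approx_cdiff => e e0.
(* The errors of the two coordinates will be at most [4 * (e' * m)] and [5 * (e' * m)]. *)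
have [e' [e'0 e'1 e'e]] : exists e', [/\ 0 < e', e' <= 1 & e' <= e / 16].
  exists (Num.min (e / 16) 1).
  by rewrite lt_min ltr01 divr_gt0 // !ge_min !lexx orbT.
have [d1 d10 h1] := is_derive_approx (is_derive_expR 0) e'0.
have [d2 d20 h2] := is_derive_approx (is_derive_cos 0) e'0.
have [d3 d30 h3] := is_derive_approx (is_derive_sin 0) e'0.
exists (Num.min e' (Num.min d1 (Num.min d2 d3))).
  by rewrite !lt_min e'0 d10 d20.
case=> s t; rewrite subr0 !lt_min => /and4P[we w1 w2 w3].
have hs : `|s| <= normc (Cx s t) := normRe_le (Cx s t).
have ht : `|t| <= normc (Cx s t) := normIm_le (Cx s t).
set m := normc (Cx s t) in we w1 w2 w3 hs ht *.
have m0 : 0 <= m by exact: normc_ge0.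
have H1 : `|expR s - 1 - s| <= e' * m.
  have := h1 s; rewrite subr0 expR0 mul1r => /(_ (le_lt_trans hs w1)) H.
  by apply: (le_trans H); rewrite ler_wpM2l // ltW.
have H2 : `|cos t - 1| <= e' * m.
  have := h2 t; rewrite subr0 cos0 sin0 oppr0 mul0r subr0 => /(_ (le_lt_trans ht w2)) H.
  by apply: (le_trans H); rewrite ler_wpM2l // ltW.
have H3 : `|sin t - t| <= e' * m.
  have := h3 t; rewrite !subr0 cos0 sin0 mul1r subr0 => /(_ (le_lt_trans ht w3)) H.
  by apply: (le_trans H); rewrite ler_wpM2l // ltW.
have em : e' * m <= m by rewrite ler_piMl.
have Es : `|expR s - 1| <= 2 * m.
  by have := ler_normD (expR s - 1 - s) s; rewrite subrK; lra.
have Es2 : `|expR s| <= 3.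
  have := ler_normD (expR s - 1) 1; rewrite subrK normr1; lra.
apply: (le_trans (normc_le_ReIm _)).
rewrite !(cReD, cImD, cReN, cImN, cReM, cImM) /= expR0 cos0 sin0.
set A := expR s in H1 Es Es2 *; set c := cos t in H2 *; set d := sin t in H3 *.
have B1 : `|A * c - 1 - s| <= 4 * (e' * m).
  rewrite (_ : _ - s = (A - 1 - s) + A * (c - 1)); last by ring.
  apply: (le_trans (ler_normD _ _)); rewrite normrM.
  have := ler_pM (normr_ge0 _) (normr_ge0 _) Es2 H2; lra.
have B2 : `|A * d - t| <= 5 * (e' * m).
  rewrite (_ : _ - t = A * (d - t) + (A - 1) * t); last by ring.
  apply: (le_trans (ler_normD _ _)); rewrite !normrM.
  have := ler_pM (normr_ge0 _) (normr_ge0 _) Es2 H3.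
  have := ler_pM (normr_ge0 _) (normr_ge0 _) Es (le_trans ht (ltW we)).
  lra.
have -> : A * c - 0 * d - (1 * 1 - 0 * 0) - (1 * s - 0 * t) = A * c - 1 - s by ring.
have -> : A * d + 0 * c - (1 * 0 + 0 * 1) - (1 * t + 0 * s) = A * d - t by ring.
apply: (le_trans (lerD B1 B2)).
have := ler_wpM2r m0 e'e; have := mulr_ge0 (ltW e0) m0; lra.
Qed.

Lemma cdiff_cexp z : cdiff cexp z (cexp z).
Proof.
have dB : cdiff (fun w => w - z) z (1 - 0).
  by apply: cdiffB; [exact: cdiff_id|exact: cdiff_cst].
have dE : cdiff cexp (z - z) 1 by rewrite subrr; exact: cdiff_cexp0.
have := cdiffZ (cexp z) (cdiff_comp dB dE); rewrite subr0 !mulr1.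
congr (cdiff _ _ _); apply/funext => w /=.
by rewrite -cexpD addrC subrK.
Qed.

(* The mean of k over |z| = e^s does not depend on s: apply Goursat to
   k o exp on squares of side 2 pi, two sides of which cancel by periodicity. *)
Lemma disk_max (k : R[i] -> R[i]) (r r0 B : R) : 0 < r < r0 -> ccont k 0 ->
  (forall z, 0 < normc z < r0 -> exists l, cdiff k z l) ->
  (forall z, normc z = r -> normc (k z) <= B) -> normc (k 0) <= B.
Proof.
move=> /andP[r_gt0 rr0] ck dk kB.
have B0 : 0 <= B.
  by apply: le_trans (kB r%:C%C _); rewrite ?normc_ge0 // normcR gtr0_norm.
have [->|k0] := eqVneq (k 0) 0; first by rewrite normc0.
have nk0 : 0 < normc (k 0) by rewrite normc_gt0.
(* With this factor the imaginary part of [c * k 0] is [|k 0| ^ 2], and it suffices to average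
   imaginary parts, which Goursat's identity compares on vertical sides. *)
pose c : R[i] := (0 +i* 1)%C * (k 0)^*%C.
have nc : normc c = normc (k 0).
  rewrite /c normcM normcE /= expr0n expr1n add0r sqrtr1 mul1r.
  by rewrite !normcE; case: (k 0) => a b /=; rewrite sqrrN.
pose F z := c * k (cexp z).
pose b := ln r; have bE : expR b = r by rewrite lnK.
pose p := 2 * pi : R; have p0 : 0 < p by rewrite mulr_gt0 // pi_gt0.
have dF x y : x <= b -> exists l, cdiff F (Cx x y) l.
  move=> xb; have [|l dl] := dk (cexp (Cx x y)).
    by rewrite normc_cexp /= expR_gt0 (le_lt_trans _ rr0) // -bE ler_expR.
  exists (c * (l * cexp (Cx x y))); apply: cdiffZ.
  exact: (cdiff_comp (cdiff_cexp _) dl).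
have cF x : x <= b -> cont_on 0 p (fun v => complex.Im (F (Cx x v))).
  move=> xb y _; have [l /cdiff_cont cFy] := dF x y xb.
  by have [] := ccont_sectiony cFy.
pose m x := cint 0 p (fun v => complex.Im (F (Cx x v))).
have mS x : x <= b -> m (x - p) = m x.
  move=> xb; have := @goursat R F (x - p) 0 p p0.
  rewrite add0r subrK => /(_ _)/esym H; rewrite /m.
  have /H {H} : forall x0 y, x - p <= x0 <= x -> 0 <= y <= p ->
      exists l, cdiff F (Cx x0 y) l.
    by move=> u v /andP[_ ux] _; apply: dF; exact: le_trans xb.
  have -> : (fun u => complex.Re (F (Cx u p))) = (fun u => complex.Re (F (Cx u 0))).
    apply/funext => u; rewrite /F !cexpE /p mulr_natl.
    by rewrite /cis cos2pi sin2pi cos0 sin0.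
  by move=> E; apply/esym/subr0_eq; rewrite E; exact: subrr.
have nb n : b - p * n%:R <= b.
  by rewrite gerBl; apply: mulr_ge0; [exact: ltW|exact: ler0n].
have mn n : m (b - p * n%:R) = m b.
  elim: n => [|n IH]; first by rewrite mulr0 subr0.
  rewrite -IH -(mS _ (nb n)).
  by congr m; rewrite -natr1; ring.
have mb : `|m b - 0 * (p - 0)| <= normc (k 0) * B * (p - 0).
  apply: cint_approx; [exact: ltW|exact: cF|move=> v _].
  rewrite subr0 (le_trans (normIm_le _)) // /F normcM nc ler_pM2l // kB //.
  by rewrite normc_cexp.
rewrite leNgt; apply/negP => kB'.
pose e := (normc (k 0) - B) / 2; have e0 : 0 < e by rewrite divr_gt0 // subr_gt0.
have [d d0 hd] := ck _ e0.
(* So many periods to the left that the circle of radius [expR (b - p * n%:R)] lies where [k] is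
   [e]-close to [k 0]. *)
pose n := (Num.truncn ((b - ln d) / p)).+1.
have md : `|m (b - p * n%:R) - normc (k 0) ^+ 2 * (p - 0)| <= normc (k 0) * e * (p - 0).
  apply: cint_approx; [exact: ltW|by apply: cF; exact: nb|move=> v _].
  have -> : normc (k 0) ^+ 2 = complex.Im (c * k 0).
    rewrite sqr_normcE /c; case: (k 0) => x y.
    by rewrite !(cImM, cReM) /=; ring.
  rewrite -cImN -cImD (le_trans (normIm_le _)) // /F -mulrBr normcM nc ler_pM2l //.
  apply: ltW; apply: hd; rewrite subr0 normc_cexp /= -[ltRHS]lnK ?posrE // ltr_expR.
  rewrite ltrBlDr -ltrBlDl mulrC -ltr_pdivrMr //.
  exact: truncnS_gt.
move: mb md; rewrite mn mul0r !subr0 !ler_norml => /andP[_ m1] /andP[m2 _].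
have H : normc (k 0) ^+ 2 * p <= normc (k 0) * (B + e) * p by lra.
move: H; rewrite ler_pM2r // expr2 ler_pM2l // /e; lra.
Qed.

End MeanValue.

(** * Cauchy estimates and injective functions *)

Section CauchyEstimates.
Variable R : realType.
Implicit Types (f g k : R[i] -> R[i]) (a z w l v : R[i]).

Definition cinj (a : R[i]) (d : R) f :=
  forall z w, normc (z - a) < d -> normc (w - a) < d -> f z = f w -> z = w.

Lemma cdiff_shift f a z l : cdiff f (a + z) l -> cdiff (fun w => f (a + w)) z l.
Proof.
move=> df; rewrite -[l]mulr1; apply: (@cdiff_comp _ (fun w => a + w) f) => //.
by rewrite -[1]add0r; apply: cdiffD; [exact: cdiff_cst|exact: cdiff_id].
Qed.

(** Continuity at [a] and differentiability around it are exactly what is known of a slope function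
    in Caratheodory's form, whose value at [a] is the derivative; the lemma is applied to such
    functions and to their inverses. *)
Lemma disk_max_at k a (r r0 B : R) : 0 < r < r0 -> ccont k a ->
  (forall z, 0 < normc (z - a) < r0 -> exists l, cdiff k z l) ->
  (forall z, normc (z - a) = r -> normc (k z) <= B) -> normc (k a) <= B.
Proof.
move=> rr0 ck dk kB; rewrite -[a]addr0.
apply: (@disk_max _ (fun z => k (a + z)) r r0) => //.
- move=> e /ck[d d0 h]; exists d => // w; rewrite subr0 addr0 => wd.
  by apply: h; rewrite addrC addKr.
- move=> z zr; have [|l dl] := dk (a + z); first by rewrite addrC addKr.
  by exists l; exact: cdiff_shift.
- by move=> z zr; apply: kB; rewrite addrC addKr.
Qed.

Lemma caratheodory_cdiff f q a z l : z != a ->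
  (forall w, f w = f a + q w * (w - a)) -> cdiff f z l ->
  exists m, cdiff q z m.
Proof.
move=> za fE df; have za0 : z - a != 0 by rewrite subr_eq0.
have dB : cdiff (fun w => w - a) z (1 - 0).
  by apply: cdiffB; [exact: cdiff_id|exact: cdiff_cst].
have := cdiffM (cdiffB df (cdiff_cst (f a) z)) (cdiffV dB za0).
set m := (X in cdiff _ _ X) => dq; exists m.
apply: (@cdiff_local _ q _ z m (normc (z - a))) dq; first by rewrite normc_gt0.
move=> w wz; have wa : w - a != 0.
  rewrite subr_eq0; apply/eqP => wa; move: wz.
  by rewrite wa normcB ltxx.
by rewrite fE addrC addKr mulfK.
Qed.

(** This is the maximum principle for the slope function [q]: on the circle [|q| = |f z - f a| / r],
    which is at most [2 * B / r]. *)
Lemma cauchy_estimate f a l (r r0 B : R) : 0 < r < r0 -> hol a r0 f ->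
  (forall z, normc (z - a) = r -> normc (f z) <= B) -> cdiff f a l ->
  normc l <= 2 * B / r.
Proof.
move=> rr0 hf fB df; have [r_gt0 lr] := andP rr0.
have fa : normc (f a) <= B.
  apply: disk_max_at rr0 (cdiff_cont df) _ fB => z /andP[_]; exact: hf.
case: df => q [cq <-] fE.
apply: disk_max_at rr0 cq _ _ => [z /andP[za zr]|z zr].
  have [m dm] := hf z zr; apply: (caratheodory_cdiff _ fE dm).
  by rewrite -subr_eq0 -normc_gt0.
have /(congr1 (@normc R)) : f z - f a = q z * (z - a) by rewrite fE addrC addKr.
rewrite normcM zr => h; rewrite ler_pdivlMr // -h.
by have := le_normcD (f z) (- f a); rewrite normcN; have := fB z zr; lra.
Qed.

Lemma annulus_min f a (r1 r2 : R) : 0 < r1 ->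
  (forall z, r1 <= normc (z - a) <= r2 -> ccont f z /\ f z != 0) ->
  exists2 m : R, 0 < m & forall z, r1 <= normc (z - a) <= r2 -> m <= normc (f z).
Proof.
move=> r1_gt0 hf.
have [|z|B hB] := @locally_bounded_bounded R [set z | r1 <= normc (z - a) <= r2]
    (fun z => (normc (f z))^-1) (normc a + r2).
- by move=> z /= /andP[_]; have := ler_normcB z a; lra.
- have [zr1|zr1] := ltP (normc (z - a)) r1.
    exists (r1 - normc (z - a)); first by rewrite subr_gt0.
    by exists 0 => w /= /andP[h _]; have := normc_triangle z w a; lra.
  have [zr2|zr2] := ltP r2 (normc (z - a)).
    exists (normc (z - a) - r2); first by rewrite subr_gt0.
    by exists 0 => w /= /andP[_ h]; have := normc_triangle w z a; rewrite (normcB z w); lra.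
  have [|cz fz] := hf z; first by rewrite zr1.
  have [d d0 hd] := ccont_neq0 cz fz; exists d => //.
  exists (normc (f z) / 2)^-1 => w _ /hd h.
  have f0 : 0 < normc (f z) / 2 by rewrite divr_gt0 // normc_gt0.
  by rewrite lef_pV2 ?posrE //; [exact: ltW|exact: lt_trans h].
exists (`|B| + 1)^-1 => [|z hz]; first by rewrite invr_gt0 ltr_wpDl.
have [_ fz] := hf z hz; have fz0 : 0 < normc (f z) by rewrite normc_gt0.
rewrite -[leRHS]invrK lef_pV2 ?posrE ?invr_gt0 ?ltr_wpDl //.
by have := hB z hz; have := ler_norm B; lra.
Qed.

Lemma cinj_sub f a d : 0 < d -> cinj a d f ->
  forall z, normc (z - a) < d -> z != a -> f z - f a != 0.
Proof.
move=> d0 fi z zd; apply: contra_neq => /eqP; rewrite subr_eq0 => /eqP.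
by apply: fi => //; rewrite subrr normc0.
Qed.

(** If [f] omitted [w], then [(f z - w)^-1] would exceed [(m / 2)^-1] in modulus at [a] but not on
    the circle of radius [d / 2], against the maximum principle. *)
Lemma cinj_open f a d : 0 < d -> hol a d f -> cinj a d f ->
  exists2 e : R, 0 < e &
    forall w, normc (w - f a) < e -> exists2 z, normc (z - a) < d & f z = w.
Proof.
move=> d0 hf fi.
have [|z|m m0 hm] := @annulus_min (fun z => f z - f a) a (d / 2) (d / 2).
- by rewrite divr_gt0.
- move=> /andP[z1 z2]; have zd : normc (z - a) < d by lra.
  split; first by apply: ccontB; [have [l /cdiff_cont] := hf z zd|exact: ccont_cst].
  by apply: (cinj_sub d0) => //; rewrite -subr_eq0 -normc_gt0; lra.
exists (m / 2) => [|w wm]; first by rewrite divr_gt0.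
apply: contrapT => nw.
have fw z : normc (z - a) < d -> f z - w != 0.
  by move=> zd; rewrite subr_eq0; apply/eqP => fzw; apply: nw; exists z.
have dk z : normc (z - a) < d -> exists l, cdiff (fun z => (f z - w)^-1) z l.
  move=> zd; have [l dl] := hf z zd.
  by eexists; exact: (cdiffV (cdiffB dl (cdiff_cst w z)) (fw z zd)).
have ada : normc (a - a) < d by rewrite subrr normc0.
have := @disk_max_at (fun z => (f z - w)^-1) a (d / 2) d (m / 2)^-1.
have [l /cdiff_cont ck] := dk a ada.
move=> /(_ _ ck _ _); rewrite normcV lef_pV2 ?posrE ?normc_gt0 ?divr_gt0 ?fw //.
rewrite normcB => H; suff : m / 2 <= normc (w - f a) by move: wm; lra.
apply: H => [|z /andP[_]|z zd].
- by lra.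
- exact: dk.
have zd' : normc (z - a) < d by rewrite zd; lra.
rewrite normcV lef_pV2 ?posrE ?normc_gt0 ?divr_gt0 ?fw //.
have := hm z; rewrite zd lexx => /(_ isT).
by have := normc_triangle w (f z) (f a); lra.
Qed.

End CauchyEstimates.

(** * Mean value and Gronwall estimates along segments *)

Section Segments.
Variable R : realType.
Implicit Types (f g : R[i] -> R[i]) (z w l v : R[i]).

Lemma approx_is_derive (f : R -> R) (x l : R) :
  (forall e, 0 < e -> exists2 d, 0 < d & forall y, `|y - x| < d ->
    `|f y - f x - l * (y - x)| <= e * `|y - x|) -> is_derive x 1 f l.
Proof.
move=> H.
have Hl : h^-1 *: (f (h *: (1 : R) + x) - f x) @[h --> 0^'] --> l.
  apply/cvgrPdist_le => e /H[d d0 h]; rewrite near_withinE.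
  apply/nbhs_ballP; exists d => // y; rewrite /ball /= sub0r normrN => yd y0.
  have -> : y *: (1 : R) + x = y + x by rewrite [_ *: _]mulr1.
  have := h (y + x); rewrite addrK => /(_ yd) {}h.
  have -> : l - y^-1 *: (f (y + x) - f x) = - ((f (y + x) - f x - l * y) / y).
    by rewrite /GRing.scale /=; field.
  by rewrite normrN normrM normfV ler_pdivrMr ?normr_gt0.
apply: DeriveDef; first by apply/cvg_ex; exists l.
exact: cvg_lim Hl.
Qed.

Lemma cdiff_path f z v l (t : R) : cdiff f (z + t%:C%C * v) l ->
  is_derive t 1 (fun s : R => complex.Re (f (z + s%:C%C * v))) (complex.Re (l * v)) /\
  is_derive t 1 (fun s : R => complex.Im (f (z + s%:C%C * v))) (complex.Im (l * v)).
Proof.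
move=> /cdiff_approx df.
have path_approx e : 0 < e -> exists2 d, 0 < d & forall s, `|s - t| < d ->
    normc (f (z + s%:C%C * v) - f (z + t%:C%C * v) - (s - t)%:C%C * (l * v))
    <= e * `|s - t|.
  move=> e0; have v0 : 0 < normc v + 1 by rewrite ltr_wpDl ?normc_ge0.
  have [d d0 h] := df _ (divr_gt0 e0 v0).
  exists (d / (normc v + 1)) => [|s]; first by rewrite divr_gt0.
  rewrite ltr_pdivlMr // => sd.
  have E : z + s%:C%C * v - (z + t%:C%C * v) = (s - t)%:C%C * v.
    by rewrite rmorphB /=; ring.
  have nE : normc ((s - t)%:C%C * v) <= `|s - t| * (normc v + 1).
    by rewrite normcM normcR ler_wpM2l // lerDl.
  have := h (z + s%:C%C * v); rewrite E mulrCA => /(_ (le_lt_trans nE sd)).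
  move=> /le_trans; apply.
  apply: (le_trans (ler_wpM2l _ nE)); first by rewrite divr_ge0 ?ltW.
  by rewrite mulrCA divfK ?gt_eqF // mulrC.
have realM (x : R) w : complex.Re (x%:C%C * w) = complex.Re w * x /\
    complex.Im (x%:C%C * w) = complex.Im w * x.
  by rewrite cReM cImM /= !mul0r subr0 addr0; split; rewrite mulrC.
split; apply: approx_is_derive => e /path_approx[d d0 h]; exists d => // s /h;
  apply: le_trans.
- by have [<- _] := realM (s - t) (l * v); rewrite -!cReN -!cReD normRe_le.
- by have [_ <-] := realM (s - t) (l * v); rewrite -!cImN -!cImD normIm_le.
Qed.

Lemma real_mvt (phi dphi : R -> R) :
  (forall t : R, 0 <= t <= 1 -> is_derive t 1 phi (dphi t)) ->
  exists2 c : R, 0 <= c <= 1 & phi 1 - phi 0 = dphi c.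
Proof.
move=> H; have [|||c] := @MVT R phi dphi 0 1.
- exact: ltr01.
- by move=> x; rewrite in_itv /= => /andP[h1 h2]; apply: H; rewrite !ltW.
- apply: continuous_in_subspaceT => x; rewrite inE /= in_itv /= => hx.
  have [dx _] := H x hx.
  by apply: differentiable_continuous; exact/derivable1_diffP.
- rewrite in_itv /= subr0 mulr1 => /andP[c0 c1] ->.
  by exists c => //; rewrite !ltW.
Qed.

(** The mean value theorem for the real and the imaginary part yields two different intermediate
    points, whence the factor 2. *)
Lemma segment_lipschitz f z w (L : R) :
  (forall t : R, 0 <= t <= 1 ->
     exists2 l, cdiff f (z + t%:C%C * (w - z)) l & normc l <= L) ->
  normc (f w - f z) <= 2 * (L * normc (w - z)).
Proof.
move=> H.
pose l t := if pselect (0 <= t <= 1) is left h then projT1 (cid2 (H t h)) else 0.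
have lP t : 0 <= t <= 1 -> cdiff f (z + t%:C%C * (w - z)) (l t) /\ normc (l t) <= L.
  by rewrite /l; case: pselect => // h _; case: cid2.
have lB t : 0 <= t <= 1 -> normc (l t * (w - z)) <= L * normc (w - z).
  by move=> /lP[_ h]; rewrite normcM ler_wpM2r ?normc_ge0.
have E0 : z + 0%:C%C * (w - z) = z by rewrite mul0r addr0.
have E1 : z + 1%:C%C * (w - z) = w by rewrite mul1r addrC subrK.
have [c hc] := real_mvt (fun t ht => (cdiff_path (lP t ht).1).1).
have [c' hc'] := real_mvt (fun t ht => (cdiff_path (lP t ht).1).2).
rewrite E0 E1 -cReN -cReD -cImN -cImD => im re.
apply: (le_trans (normc_le_ReIm _)); rewrite im re.
have := le_trans (normRe_le _) (lB c hc).
have := le_trans (normIm_le _) (lB c' hc').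
lra.
Qed.

(** Along the segment [|g| ^ 2 * exp (- 2 c t)] is nonincreasing, with [c = L * |w - z|]; the
    squared modulus is differentiable even where [g] vanishes. *)
Lemma segment_gronwall g z w (L : R) :
  (forall t : R, 0 <= t <= 1 ->
     exists2 l, cdiff g (z + t%:C%C * (w - z)) l &
       normc l <= L * normc (g (z + t%:C%C * (w - z)))) ->
  normc (g w) <= expR (L * normc (w - z)) * normc (g z).
Proof.
move=> H.
pose l t := if pselect (0 <= t <= 1) is left h then projT1 (cid2 (H t h)) else 0.
have lP t : 0 <= t <= 1 -> cdiff g (z + t%:C%C * (w - z)) (l t) /\
    normc (l t) <= L * normc (g (z + t%:C%C * (w - z))).
  by rewrite /l; case: pselect => // h _; case: cid2.
pose c := L * normc (w - z).
pose G t := g (z + t%:C%C * (w - z)).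
pose U t := complex.Re (G t); pose V t := complex.Im (G t).
pose phi t := (U t * U t + V t * V t) * expR (t * (- (2 * c))).
pose u t := complex.Re (l t * (w - z)); pose v t := complex.Im (l t * (w - z)).
pose dphi t := 2 * (U t * u t + V t * v t - c * (U t * U t + V t * V t)) *
  expR (t * (- (2 * c))).
have [t ht|t0 ht0] := @real_mvt phi dphi.
  have [dU dV] := cdiff_path (lP t ht).1; rewrite -/G -/U -/V in dU dV.
  have dE : is_derive t 1 (expR \o (fun t => t * (- (2 * c))))
      (expR (t * (- (2 * c))) * (- (2 * c))).
    apply: is_derive1_comp.
    apply: approx_is_derive => e e0; exists 1 => // y _.
    have -> : y * - (2 * c) - t * - (2 * c) - - (2 * c) * (y - t) = 0 by ring.
    by rewrite normr0 mulr_ge0 // ltW.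
  have D := is_deriveM (is_deriveD (is_deriveM dU dU) (is_deriveM dV dV)) dE.
  apply: (is_derive_eq D); rewrite /dphi /GRing.scale /= -/(u t) -/(v t).
  by rewrite (_ : (U * U + V * V) t = U t * U t + V t * V t) //; ring.
have dphi_le0 : dphi t0 <= 0.
  rewrite /dphi pmulr_lle0 ?expR_gt0 // pmulr_rle0 // subr_le0.
  have -> : U t0 * u t0 + V t0 * v t0 =
      complex.Re ((G t0)^*%C * (l t0 * (w - z))).
    by rewrite [in RHS]cReM /U /V /u /v; case: (G t0) => a b /=; ring.
  have -> : U t0 * U t0 + V t0 * V t0 = normc (G t0) ^+ 2.
    by rewrite sqr_normcE -!expr2.
  apply: (le_trans (Re_le_normc _)); rewrite !normcM.
  have -> : normc (G t0)^*%C = normc (G t0) by rewrite !normcE; case: (G t0) => a b /=; rewrite sqrrN.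
  rewrite /c (_ : L * _ * _ = normc (G t0) * (L * normc (G t0) * normc (w - z))); last by ring.
  rewrite ler_wpM2l ?normc_ge0 // ler_wpM2r ?normc_ge0 //.
  by have [] := lP t0 ht0.
move=> phiE; have : phi 1 <= phi 0 by rewrite -subr_le0 phiE.
rewrite /phi mul0r expR0 mulr1 mul1r /U /V -!expr2 -!sqr_normcE /G.
rewrite mul0r addr0 mul1r addrCA subrr addr0 expRN ler_pdivrMr ?expR_gt0 //.
rewrite mulr_natl mulr2n expRD -expr2 mulrC -exprMn ler_pXn2r // nnegrE.
  exact: normc_ge0.
by rewrite mulr_ge0 ?expR_ge0 ?normc_ge0.
Qed.

Lemma segment_in_disk (a z w : R[i]) (d t : R) : normc (z - a) < d ->
  normc (w - a) < d -> 0 <= t <= 1 -> normc (z + t%:C%C * (w - z) - a) < d.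
Proof.
move=> za wa /andP[t0 t1].
rewrite (_ : _ - a = (1 - t)%:C%C * (z - a) + t%:C%C * (w - a)); last first.
  by rewrite rmorphB rmorph1 /=; ring.
apply: (le_lt_trans (le_normcD _ _)); rewrite !normcM !normcR.
rewrite !ger0_norm ?subr_ge0 //.
have [->|t_gt0] := eqVneq t 0; first by rewrite subr0 mul1r mul0r addr0.
have := ler_wpM2l (_ : 0 <= 1 - t) (ltW za).
have : t * normc (w - a) < t * d by rewrite ltr_pM2l // lt0r t_gt0.
rewrite subr_ge0 => h1 /(_ t1); lra.
Qed.

Lemma disk_gronwall g a (d L : R) :
  (forall z, normc (z - a) < d -> exists2 l, cdiff g z l & normc l <= L * normc (g z)) ->
  forall z w, normc (z - a) < d -> normc (w - a) < d ->
  normc (g w) <= expR (L * normc (w - z)) * normc (g z).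
Proof.
move=> H z w za wa; apply: segment_gronwall => t t01; apply: H.
exact: segment_in_disk.
Qed.

(** If the derivative vanishes at [a], so does the slope function, and the minimum principle is used
    at nearby points [z1] instead: there a nonzero derivative is at least [c0], whereas Cauchy's
    estimate makes it at most [c0 / 4]. Hence the derivative vanishes near [a] and [f] is constant
    there, against injectivity. *)
Lemma cinj_deriv_neq0 f a (d : R) l : 0 < d -> hol a d f -> cinj a d f ->
  cdiff f a l -> l != 0.
Proof.
move=> d0 hf fi df; apply/eqP => l0; rewrite {}l0 in df.
have [|z|m m0 hm] := @annulus_min _ (fun z => f z - f a) a (d / 4) (3 * d / 4).
- by rewrite divr_gt0.
- move=> /andP[z1 z2]; have zd : normc (z - a) < d by lra.
  split; first by apply: ccontB; [have [l0 /cdiff_cont] := hf z zd|exact: ccont_cst].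
  by apply: (cinj_sub d0) => //; rewrite -subr_eq0 -normc_gt0; lra.
have [d1 d10 h1] := cdiff_cont df (divr_gt0 m0 (ltr0n _ 2)).
(* For [z1] near [a], the slope function at [z1] is at least [(m / 2) / (d / 2)] in modulus on the
   circle of radius [d / 2]. *)
pose c0 := m / d; have c00 : 0 < c0 by rewrite divr_gt0.
have large z1 l1 : normc (z1 - a) < d1 -> normc (z1 - a) < d / 4 ->
    cdiff f z1 l1 -> l1 != 0 -> c0 <= normc l1.
  move=> /h1 fz1 z1d [q [cq <-]] fE q0.
  have sub_a z : normc (z - z1) < 3 * d / 4 -> normc (z - a) < d.
    by have := normc_triangle z1 z a; lra.
  have z1d' : normc (z1 - a) < d by lra.
  have qn0 z : normc (z - z1) < 3 * d / 4 -> q z != 0.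
    have [->//|zz1 zd] := eqVneq z z1.
    apply: contra_neq zz1 => qz; apply: fi => //; first exact: sub_a.
    by rewrite fE qz mul0r addr0.
  rewrite -[leRHS]invrK -normcV -[leLHS]invrK lef_pV2 ?posrE ?invr_gt0 //; last first.
    by rewrite normc_gt0 invr_eq0.
  apply: (@disk_max_at _ (fun z => (q z)^-1) z1 (d / 2) (3 * d / 4)).
  - by rewrite divr_gt0 //=; lra.
  - exact: ccontV.
  - move=> z /andP[z0 zd].
    have [|m1 dm1] := hf z; first exact: sub_a.
    have [|m2 dm2] := caratheodory_cdiff _ fE dm1.
      by rewrite -subr_eq0 -normc_gt0.
    by eexists; exact: (cdiffV dm2 (qn0 z zd)).
  - move=> z zd.
    have zq : q z != 0 by apply: qn0; rewrite zd; lra.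
    have mz : m / 2 <= normc (f z - f z1).
      have /hm : d / 4 <= normc (z - a) <= 3 * d / 4.
        have := normc_triangle z1 z a; have := normc_triangle a z z1.
        rewrite (normcB a z1); lra.
      by have := normc_triangle (f z1) (f z) (f a); lra.
    rewrite normcV /c0 invf_div.
    rewrite fE addrC addKr normcM zd in mz.
    by rewrite -[leRHS]invrK lef_pV2 ?posrE ?invr_gt0 ?divr_gt0 ?normc_gt0 // invf_div ler_pdivrMr //; lra.
have [d2 d20 h2] := cdiff_approx df (divr_gt0 c00 (ltr0n _ 16)).
pose r := Num.min (d2 / 4) (d / 4).
have [r0 r2 rd] : [/\ 0 < r, r <= d2 / 4 & r <= d / 4].
  by rewrite lt_min !divr_gt0 // !ge_min !lexx orbT.
have zero z1 : normc (z1 - a) < r -> normc (z1 - a) < d1 -> cdiff f z1 0.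
  move=> zr zd1; have [|l1 dl1] := hf z1; first by lra.
  have [<-//|l10] := eqVneq l1 0.
  have := large z1 l1 zd1 (lt_le_trans zr rd) dl1 l10.
  have : normc l1 <= 2 * (c0 / 16 * (2 * r)) / r.
    apply: (@cauchy_estimate _ (fun z => f z - f a) z1 l1 r (3 * d / 4)).
    - by rewrite r0 /=; lra.
    - move=> z zz; have [|lz dlz] := hf z; first by have := normc_triangle z1 z a; lra.
      by eexists; exact: (cdiffB dlz (cdiff_cst (f a) z)).
    - move=> z zr'; have zar : normc (z - a) <= 2 * r.
        by have := normc_triangle z1 z a; lra.
      have := h2 z; rewrite mul0r subr0 => /(_ _) h.
      apply: (le_trans (h _)); first by lra.
      by rewrite ler_wpM2l // divr_ge0 // ltW.
    - by rewrite -[l1]subr0; exact: (cdiffB dl1 (cdiff_cst (f a) z1)).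
  rewrite (_ : 2 * (c0 / 16 * (2 * r)) / r = c0 / 4); last by field; rewrite gt_eqF.
  lra.
have [d3 [d30 d3r d31]] : exists d3, [/\ 0 < d3, d3 < r & d3 < d1].
  exists (Num.min r d1 / 2); have : 0 < Num.min r d1 by rewrite lt_min r0.
  have : Num.min r d1 <= r by rewrite ge_min lexx.
  have : Num.min r d1 <= d1 by rewrite ge_min lexx orbT.
  by move=> ? ? ?; split; lra.
pose b := a + d3%:C%C.
have ba : b - a = d3%:C%C by rewrite /b addrC addKr.
have nba : normc (b - a) = d3 by rewrite ba normcR gtr0_norm.
have := @segment_lipschitz f a b 0; rewrite mul0r mulr0.
have H (t : R) : 0 <= t <= 1 -> exists2 l, cdiff f (a + t%:C%C * (b - a)) l & normc l <= 0.
  move=> /andP[t0 t1]; exists 0; last by rewrite normc0.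
  have tb : normc (a + t%:C%C * (b - a) - a) <= d3.
    rewrite addrC addKr normcM normcR nba ger0_norm //.
    by rewrite ler_piMl // ltW.
  by apply: zero; exact: le_lt_trans tb _.
move=> /(_ H) fab.
have : b = a.
  apply: fi; rewrite ?nba ?subrr ?normc0 //; first by lra.
  by apply/eqP; rewrite -subr_eq0 -normc_eq0 eq_le fab normc_ge0.
by move=> bE; move: nba; rewrite bE subrr normc0; lra.
Qed.

End Segments.

(** * Koebe's theorem and distortion *)

Section Koebe.
Variable R : realType.
Implicit Types (f g P F : R[i] -> R[i]) (z w l v : R[i]).

Lemma Re_sqrtc_ge0 z : 0 <= complex.Re (sqrtc z).
Proof. by case: z => a b; rewrite /sqrtc /= sqrtr_ge0. Qed.

Lemma Re_sqrtc_gt0 z : 0 < complex.Re z -> 0 < complex.Re (sqrtc z).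
Proof.
case: z => a b /= a0; rewrite sqrtr_gt0 divr_gt0 // ltr_wpDl ?sqrtr_ge0 //.
Qed.

(** The product of [|sqrtc w - sqrtc z|] and [|sqrtc w + sqrtc z|] is [|w - z|], and the second
    factor is at least the real part of [sqrtc z]. *)
Lemma ccont_sqrtc z : 0 < complex.Re z -> ccont (@sqrtc R) z.
Proof.
move=> /Re_sqrtc_gt0 z0 e e0.
exists (e * complex.Re (sqrtc z)) => [|w wz]; first by rewrite mulr_gt0.
have h : complex.Re (sqrtc z) <= normc (sqrtc w + sqrtc z).
  by apply: le_trans (Re_le_normc _); rewrite cReD lerDr Re_sqrtc_ge0.
rewrite -(ltr_pM2r z0); apply: le_lt_trans wz.
apply: (le_trans (ler_wpM2l (normc_ge0 _) h)); rewrite -normcM.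
by rewrite -subr_sqr !sqr_sqrtc.
Qed.

(** Dividing [g w ^+ 2 - g z ^+ 2] by [g w + g z] turns a slope function of [P] into one of [g]. *)
Lemma sqrt_cdiff g P z l (d : R) : 0 < d -> ccont g z -> g z != 0 ->
  (forall w, normc (w - z) < d -> g w ^+ 2 = P w) -> cdiff P z l ->
  cdiff g z (l / (g z + g z)).
Proof.
move=> d0 cg gz gP dP; case: dP => q [cq ql] PE.
have cs : ccont (fun w => g w + g z) z by apply: ccontD => //; exact: ccont_cst.
have s0 : g z + g z != 0 by rewrite -mulr2n mulrn_eq0.
have [d' d'0 hd] := ccont_neq0 cs s0.
have d3 : 0 < Num.min d d' by rewrite lt_min d0.
apply: (@cdiff_local _ g (fun w => g z + q w / (g w + g z) * (w - z)) z _ _ d3).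
  move=> w; rewrite lt_min => /andP[wd /hd wd'].
  have sw : g w + g z != 0.
    rewrite -normc_gt0; apply: le_lt_trans wd'.
    by rewrite divr_ge0 // normc_ge0.
  have zz : normc (z - z) < d by rewrite subrr normc0.
  have : g w ^+ 2 - g z ^+ 2 = q w * (w - z) by rewrite !gP // PE addrC addKr.
  rewrite subr_sqr => /(congr1 (fun x => x / (g w + g z))).
  rewrite mulfK // mulrAC => <-; by rewrite addrC subrK.
exists (fun w => q w / (g w + g z)); first split.
- apply: ccontM => //; exact: ccontV.
- by rewrite ql.
- by move=> w; rewrite subrr mulr0 addr0.
Qed.

(* A square root along rays: sqrt (P z / P 0) is the product of the principal
   roots of P (t_(k+1) z) / P (t_k z), each ratio lying in the right half plane
   if the subdivision 0 = t_0 < ... < t_n = 1 is fine enough. *)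
Lemma sqrt_exists P (r1 r2 : R) : 0 < r1 < r2 -> hol 0 r2 P ->
  (forall z, normc z < r2 -> P z != 0) ->
  exists2 g, g 0 = sqrtc (P 0) & forall z, normc z < r1 ->
    ccont g z /\ g z ^+ 2 = P z.
Proof.
move=> /andP[r1_gt0 r12] hP P0.
have in2 z : normc z < r2 -> normc (z - 0) < r2 by rewrite subr0.
have cP z : normc z < r2 -> ccont P z.
  by move=> /in2 /hP[l]; exact: cdiff_cont.
(* Half of the gap: disks of radius [rho] about the points of [|z| <= r1] leave room for Cauchy's
   estimate. *)
pose rho := (r2 - r1) / 2; have rho0 : 0 < rho by rewrite divr_gt0 // subr_gt0.
have [B hB] : exists B, forall z, normc z <= r1 + rho -> normc (P z) <= B.
  by apply: ccont_bounded => z hz; apply: cP; move: hz; rewrite /rho; lra.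
have [m m0 hm] : exists2 m : R, 0 < m & forall z, normc z <= r1 -> m <= normc (P z).
  have [|B' hB'] := @ccont_bounded R (fun z => (P z)^-1) r1.
    by move=> z hz; have zr2 := le_lt_trans hz r12; apply: ccontV; [exact: cP|exact: P0].
  exists (`|B'| + 1)^-1 => [|z zr1]; first by rewrite invr_gt0 ltr_wpDl.
  have pz : 0 < normc (P z) by rewrite normc_gt0 P0 // (le_lt_trans zr1).
  rewrite -[leRHS]invrK lef_pV2 ?posrE ?invr_gt0 ?ltr_wpDl //.
  by have := hB' z zr1; rewrite normcV; have := ler_norm B'; lra.
pose L := 2 * B / rho.
have PL z : normc z <= r1 -> exists2 l, cdiff P z l & normc l <= L.
  move=> zr1; have [l dl] := hP z (in2 z (le_lt_trans zr1 r12)); exists l => //.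
  have sum_le w r : normc (w - z) <= r -> normc w <= r1 + r.
    by have := normc_triangle z w 0; rewrite !subr0; lra.
  apply: (@cauchy_estimate _ P z l rho (2 * rho)) => //; first by lra.
    move=> w wz; apply: hP; rewrite subr0.
    have := normc_triangle z w 0; rewrite !subr0; rewrite /rho in wz *; lra.
  by move=> w wz; apply: hB; apply: sum_le; rewrite wz.
have B0 : 0 <= B by apply: le_trans (hB 0 _); rewrite ?normc_ge0 // normc0 /rho; lra.
have L0 : 0 <= L by apply: divr_ge0; [exact: mulr_ge0|exact: ltW].
(* So fine that consecutive values of [P] on a ray differ by less than [m], which keeps their ratio
   within distance 1 of 1; the factor 2 is that of [segment_lipschitz]. *)
pose n := (Num.truncn (2 * (L * r1) / m)).+1.
have nm : 2 * (L * r1) / n%:R < m.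
  by rewrite ltr_pdivrMr ?ltr0n // [ltRHS]mulrC -ltr_pdivrMr //; exact: truncnS_gt.
pose t k : R := k%:R / n%:R.
have t01 k : (k <= n)%N -> 0 <= t k <= 1.
  by move=> kn; rewrite divr_ge0 //= ler_pdivrMr ?ltr0n // mul1r ler_nat.
have tz k z : (k <= n)%N -> normc z < r1 -> normc ((t k)%:C%C * z) < r1.
  move=> /t01 /andP[tk0 tk1] zr; rewrite normcM normcR ger0_norm //.
  by apply: le_lt_trans zr; rewrite ler_piMl // normc_ge0.
pose ratio k z := P ((t k.+1)%:C%C * z) / P ((t k)%:C%C * z).
have ratio_pos k z : (k < n)%N -> normc z < r1 -> 0 < complex.Re (ratio k z).
  move=> kn zr; set a := (t k)%:C%C * z; set b := (t k.+1)%:C%C * z.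
  have ar : normc a < r1 by apply: tz => //; exact: ltnW.
  have br : normc b < r1 by apply: tz.
  have Pa : P a != 0 by apply: P0; exact: lt_trans r12.
  have ab : normc (b - a) <= r1 / n%:R.
    rewrite /a /b -mulrBl -rmorphB normcM normcR /t -natr1 mulrDl addrAC subrr add0r.
    by rewrite mul1r ger0_norm ?invr_ge0 // mulrC ler_wpM2r ?invr_ge0 // ltW.
  have h : normc (P b - P a) < normc (P a).
    apply: (lt_le_trans _ (hm a (ltW ar))); apply: le_lt_trans nm.
    apply: (le_trans (@segment_lipschitz _ P a b L _)) => [s s01|].
      apply: PL; apply: ltW; rewrite -[_ + _]subr0.
      by apply: segment_in_disk; rewrite ?subr0.
    by rewrite -mulrA -mulrA ler_pM2l // ler_wpM2l.
  have : normc (ratio k z - 1) < 1.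
    rewrite /ratio -/a -/b -[X in _ - X](divff Pa) -mulrBl normcM normcV.
    by rewrite ltr_pdivrMr ?mul1r // normc_gt0.
  by have := normRe_le (ratio k z - 1); rewrite cReD cReN /= ler_norml => /andP[h1 _]; lra.
pose G := fix G k z := if k is j.+1 then G j z * sqrtc (ratio j z) else sqrtc (P 0).
have GP k z : (k <= n)%N -> normc z < r1 ->
    ccont (G k) z /\ G k z ^+ 2 = P ((t k)%:C%C * z).
  move=> + zr; elim: k => [|k IH] kn /=.
    by rewrite /t mul0r mul0r sqr_sqrtc; split => //; exact: ccont_cst.
  have [cG G2] := IH (ltnW kn).
  have cPt j : (j <= n)%N -> ccont (fun z => P ((t j)%:C%C * z)) z.
    move=> jn; apply: (@ccont_comp _ (fun z => (t j)%:C%C * z)).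
      by apply: ccontM; [exact: ccont_cst|exact: ccont_id].
    by apply: cP; apply: lt_trans r12; exact: tz.
  have Pk : P ((t k)%:C%C * z) != 0.
    by apply: P0; apply: lt_trans r12; apply: tz => //; exact: ltnW.
  split.
    apply: ccontM => //; apply: (@ccont_comp _ (ratio k)); last first.
      by apply: ccont_sqrtc; exact: ratio_pos.
    by apply: ccontM; [exact: cPt|apply: ccontV => //; apply: cPt; exact: ltnW].
  by rewrite exprMn sqr_sqrtc G2 /ratio mulrC divfK.
exists (G n) => [|z zr].
  have P00 : P 0 != 0 by apply: P0; rewrite normc0; lra.
  have G0 k : G k 0 = sqrtc (P 0).
    elim: k => //= k ->; rewrite /ratio !mulr0 divff //.
    by rewrite sqrtc1 mulr1.
  exact: G0.
have [cG ->] := GP n z (leqnn n) zr; split => //.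
by rewrite /t divff ?mul1r // pnatr_eq0.
Qed.

(** Bisection with a predicate that ignores the second coordinate: on a short interval one of [A]
    and [B] holds throughout, and the common end point of two halves forbids a change. *)
Lemma segment_connected (A B : R -> Prop) :
  (forall t, 0 <= t <= 1 -> A t \/ B t) ->
  (forall t, 0 <= t <= 1 -> A t -> ~ B t) ->
  (forall t, 0 <= t <= 1 -> A t ->
     exists2 e, 0 < e & forall s, `|s - t| < e -> A s) ->
  (forall t, 0 <= t <= 1 -> B t ->
     exists2 e, 0 < e & forall s, `|s - t| < e -> B s) ->
  A 0 -> A 1.
Proof.
move=> AB nAB oA oB A0.
have h01 : 0 <= (1 : R) <= 1 by rewrite ler01 lexx.
have h00 : 0 <= (0 : R) <= 1 by rewrite lexx ler01.
have [|x y s s0 x0 xs _ _ H1 H2 _ _|p q hp hq|H|H] :=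
  @bisection R (fun x _ s => (forall t, x <= t <= x + s -> A t) \/
                         (forall t, x <= t <= x + s -> B t)) 0 0 1.
- exact: ltr01.
- have mid : 0 <= x + s / 2 <= 1 by lra.
  case: H1 H2 => H1 [H2|H2].
  + left => t /andP[t1 t2]; have [ts|ts] := leP t (x + s / 2).
      by apply: H1; rewrite t1.
    by apply: H2; lra.
  + exfalso; apply: (nAB _ mid); [apply: H1|apply: H2]; lra.
  + exfalso; apply: (nAB _ mid); [apply: H2|apply: H1]; lra.
  + right => t /andP[t1 t2]; have [ts|ts] := leP t (x + s / 2).
      by apply: H1; rewrite t1.
    by apply: H2; lra.
- rewrite add0r in hp; case: (AB p hp) => [/(oA _ hp)|/(oB _ hp)] [e e0 he];
    exists e => // x y s /andP[s0 se] _ _ _ _ hx _; [left|right] => t ht;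
    by apply: he; rewrite ltr_norml; lra.
- by apply: H; rewrite add0r.
- by exfalso; apply: (nAB 0 h00) => //; apply: H; rewrite add0r.
Qed.

Lemma koebe_normalized F w l : hol 0 1 F -> cinj 0 1 F -> F 0 = 0 -> cdiff F 0 l ->
  (forall z, normc z < 1 -> F z != w) -> normc l <= 512 * normc w.
Proof.
move=> hF iF F0 dF Fw.
have in1 z : normc z < 1 -> normc (z - 0) < 1 by rewrite subr0.
(* Covered radii; since they are bounded by |w|, one of them, delta for r1, is so
   close to the supremum that the slightly larger disk of radius r2 omits a
   value v with |v| < 3/2 delta. *)
pose T := [set delta : R | 0 < delta /\ exists r : R, [/\ 1 / 2 <= r, r < 1 &
  forall v, normc v < delta -> exists2 z, normc z < r & F z = v]].
have [e e0 he] : exists2 e : R, 0 < e & forall v, normc v < e ->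
    exists2 z, normc z < 1 / 2 & F z = v.
  have [|||e e0 he] := @cinj_open _ F 0 (1 / 2) _ _ _.
  - by lra.
  - by move=> z hz; apply: hF; lra.
  - by move=> z z' hz hz'; apply: iF; lra.
  exists e => // v ve; have [|z] := he v; first by rewrite F0 subr0.
  by rewrite subr0; exists z.
have Te : T e by split => //; exists (1 / 2); split => //; lra.
have Tub : ubound T (normc w).
  move=> d [d0 [r [_ r1 hr]]]; rewrite leNgt; apply/negP => /hr[z zr Fz].
  by have := Fw z (lt_trans zr r1); rewrite Fz eqxx.
have hsT : has_sup T by split; [exists e|exists (normc w)].
have s_gt0 : 0 < sup T by apply: lt_le_trans e0 (ub_le_sup hsT.2 Te).
have sw : sup T <= normc w by apply: ge_sup => //; exists e.
(* Here [delta > 2 / 3 * sup T], so that [3 / 2 * delta] is not in [T]. *)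
have [|delta [d0 [r1 [r1_ge r1_lt hr1]]] d_s] := @sup_adherent _ T (sup T / 3) _ hsT.
  by rewrite divr_gt0.
pose r2 := (1 + r1) / 2.
have [v vd Fv] : exists2 v, normc v < 3 / 2 * delta & forall z, normc z < r2 -> F z != v.
  apply: contrapT => nv.
  suff /(ub_le_sup hsT.2) : T (3 / 2 * delta) by lra.
  split; first by lra.
  exists r2; split; [by rewrite /r2; lra|by rewrite /r2; lra|move=> v vd].
  apply: contrapT => nz; apply: nv; exists v => // z zr.
  by apply/eqP => Fz; apply: nz; exists z.
have ds : delta <= sup T.
  by apply: (ub_le_sup hsT.2); split => //; exists r1.
(* Indeed [256 * |v| <= 384 * delta <= 512 * |w|]. The 256 is 8, from [k' = l / v / 8], times
   Cauchy's bound 32 for [k']. *)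
suff : normc l <= 256 * normc v by have := normc_ge0 w; lra.
have r2_1 z : normc z < r2 -> normc (z - 0) < 1 by rewrite subr0 /r2; lra.
have r12 : r1 < r2 by rewrite /r2; lra.
have r1_r2 z : normc z < r1 -> normc z < r2 by move=> /lt_trans; exact.
have v0 : v != 0.
  by rewrite eq_sym -F0; apply: Fv; rewrite normc0 /r2; lra.
pose P z := 1 - F z / v.
have dP z m : cdiff F z m -> cdiff P z (0 - v^-1 * m).
  move=> dm; apply: cdiffB; first exact: cdiff_cst.
  have -> : (fun w0 => F w0 / v) = (fun w0 => v^-1 * F w0) by apply/funext => x; rewrite mulrC.
  exact: cdiffZ.
have hP : hol 0 r2 P.
  move=> z; rewrite subr0 => /r2_1 /hF[m dm].
  by eexists; exact: dP dm.
have P_neq0 z : normc z < r2 -> P z != 0.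
  move=> /Fv; apply: contra_neq => /eqP; rewrite subr_eq0 eq_sym => /eqP.
  by move=> /(congr1 (fun x => x * v)); rewrite divfK // mul1r.
have Pinj z z' : normc z < r2 -> normc z' < r2 -> P z = P z' -> z = z'.
  move=> /r2_1 hz /r2_1 hz' PP; apply: iF => //.
  have : F z / v = F z' / v by apply: (@subrI _ 1); exact: PP.
  by move=> /(congr1 (fun x => x * v)); rewrite !divfK.
have [|g g0 hg] := @sqrt_exists P r1 r2 _ hP P_neq0; first by lra.
have P0 : P 0 = 1 by rewrite /P F0 mul0r subr0.
rewrite {}P0 sqrtc1 in g0.
have g_neq0 z : normc z < r1 -> g z != 0.
  move=> zr; have [_ g2] := hg z zr.
  by have := P_neq0 z (r1_r2 z zr); rewrite -g2 sqrf_eq0.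
have dg z m : normc z < r1 -> cdiff P z m -> cdiff g z (m / (g z + g z)).
  move=> zr dm; apply: (@sqrt_cdiff _ P z _ (r1 - normc z)) => //.
  - by rewrite subr_gt0.
  - by have [] := hg z zr.
  - exact: g_neq0.
  - move=> x xz; have [] // := hg x.
    by have := normc_triangle z x 0; rewrite !subr0; lra.
have hgol z : normc z < r1 -> exists m, cdiff g z m.
  move=> zr; have [|m dm] := hP z; first by rewrite subr0; exact: r1_r2.
  by eexists; exact: dg dm.
have gsq z z' : normc z < r1 -> normc z' < r1 -> g z ^+ 2 = g z' ^+ 2 -> z = z'.
  move=> zr zr'; have [_ ->] := hg z zr; have [_ ->] := hg z' zr'.
  by apply: Pinj; exact: r1_r2.
have gopp z z' : normc z < r1 -> normc z' < r1 -> g z != - g z'.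
  move=> zr zr'; apply/eqP => gz.
  have zz : z = z' by apply: gsq => //; rewrite gz sqrrN.
  move/eqP: gz; rewrite -{}zz -subr_eq0 opprK -mulr2n mulrn_eq0 /=.
  exact/negP/g_neq0.
have gopen z : normc z < r1 -> exists2 e1 : R, 0 < e1 &
    forall x, normc (x - g z) < e1 -> exists2 z', normc z' < r1 & g z' = x.
  move=> zr.
  have sub_r1 x : normc (x - z) < r1 - normc z -> normc x < r1.
    by have := normc_triangle z x 0; rewrite !subr0; lra.
  have [|||e1 e10 he1] := @cinj_open _ g z (r1 - normc z) _ _ _.
  - by rewrite subr_gt0.
  - by move=> x /sub_r1; exact: hgol.
  - by move=> x x' /sub_r1 xr /sub_r1 xr' gx; apply: gsq => //; rewrite gx.
  by exists e1 => // x /he1[z' /sub_r1 h1 h2]; exists z'.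
(* For [|u - 1| < 1 / 4] one has [|1 - u ^ 2| < 9 / 16], so [v * (1 - u ^ 2)] has modulus below
   [27 / 32 * delta] and is a value of [F]; hence [u] or [- u] is a value of [g]. Connectedness of
   the segment from [g 0 = 1] to [x] selects the sign. *)
have covered x : normc (x - 1) < 1 / 4 -> exists2 z, normc z < r1 & g z = x.
  move=> x1; pose u (t : R) := 1 + t%:C%C * (x - 1).
  have u_close t : 0 <= t <= 1 -> normc (u t - 1) < 1 / 4.
    move=> /andP[t0 t1]; rewrite /u addrC addKr normcM normcR ger0_norm //.
    by apply: le_lt_trans x1; rewrite ler_piMl // normc_ge0.
  have u_lip s t : normc (u s - u t) <= `|s - t|.
    rewrite (_ : u s - u t = (s - t)%:C%C * (x - 1)); last first.
      by rewrite /u rmorphB /=; ring.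
    by rewrite normcM normcR ler_piMr //; apply: ltW; apply: lt_le_trans x1 _; lra.
  have u1 : u 1 = x by rewrite /u mul1r addrC subrK.
  rewrite -u1.
  apply: (@segment_connected (fun t => exists2 z, normc z < r1 & g z = u t)
            (fun t => exists2 z, normc z < r1 & g z = - u t)).
  - move=> t /u_close ut.
    have uu : normc (u t ^+ 2 - 1) < 9 / 16.
      rewrite -[X in _ - X](expr1n _ 2) subr_sqr normcM.
      have : normc (u t + 1) <= 9 / 4.
        rewrite (_ : u t + 1 = (u t - 1) + 2); last by ring.
        apply: (le_trans (le_normcD _ _)).
        have -> : normc (2 : R[i]) = 2 :> R.
          by rewrite -[2]/(1 + 1) normcE /= !addr0 expr0n /= addr0 sqrtr_sqr ger0_norm.
        lra.
      have := normc_ge0 (u t - 1); have := normc_ge0 (u t + 1); nra.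
    have [|z zr Fz] := hr1 (v * (1 - u t ^+ 2)).
      rewrite normcM normcB; have := normc_ge0 v.
      have := normc_ge0 (u t ^+ 2 - 1); nra.
    have [_ g2] := hg z zr.
    have : g z ^+ 2 = u t ^+ 2 by rewrite g2 /P Fz mulrAC mulfV // mul1r opprB addrC subrK.
    move=> /eqP; rewrite eqf_sqr => /orP[] /eqP gz; [left|right]; by exists z.
  - move=> t _ [z zr gz] [z' zr' gz'].
    by have := gopp z z' zr zr'; rewrite gz gz' opprK eqxx.
  - move=> t _ [z zr gz]; have [e1 e10 he1] := gopen z zr; exists e1 => // s st.
    by apply: he1; rewrite gz; apply: le_lt_trans (u_lip s t) st.
  - move=> t _ [z zr gz]; have [e1 e10 he1] := gopen z zr; exists e1 => // s st.
    apply: he1; rewrite gz opprK -normcN opprD opprK.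
    by apply: le_lt_trans (u_lip s t) st.
  - by exists 0; [rewrite normc0; lra|rewrite g0 /u mul0r addr0].
have g1 z : normc z < r1 -> 1 / 4 <= normc (1 + g z).
  move=> zr; rewrite leNgt; apply/negP => h.
  have [|z' zr' gz'] := covered (- g z).
    by rewrite -normcN opprD !opprK addrC.
  by have := gopp z' z zr' zr; rewrite gz' eqxx.
have g1_neq0 z : normc z < r1 -> 1 + g z != 0.
  by move=> /g1 h; rewrite -normc_gt0; lra.
have zr0 : normc (0 : R[i]) < r1 by rewrite normc0; lra.
pose k z := (1 + g z)^-1.
have dk z m : normc z < r1 -> cdiff g z m -> cdiff k z (- (1 + g z)^-1 ^+ 2 * (0 + m)).
  by move=> zr dm; apply: (cdiffV (cdiffD (cdiff_cst 1 z) dm)); exact: g1_neq0.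
have := dk _ _ zr0 (dg _ _ zr0 (dP _ _ dF)).
set k' := (X in cdiff _ _ X) => dk0.
have : normc k' <= 2 * 4 / (1 / 4).
  apply: (@cauchy_estimate _ k 0 k' (1 / 4) (1 / 2)) => //.
  - lra.
  - move=> z; rewrite subr0 => zr; have zr1 : normc z < r1 by lra.
    by have [m dm] := hgol z zr1; eexists; exact: dk dm.
  - move=> z; rewrite subr0 => zr; have zr1 : normc z < r1 by lra.
    have := g1 z zr1; rewrite /k normcV => h.
    rewrite -[leRHS]invrK lef_pV2 ?posrE ?invr_gt0 //; last by lra.
    by apply: le_trans h; lra.
have -> : k' = l / v / 8.
  by rewrite /k' g0; field; rewrite v0.
rewrite !normcM !normcV.
have -> : normc (8 : R[i]) = 8 :> R.
  by rewrite -[8]/(8%:R) -(rmorph_nat (real_complex R)) normcR ger0_norm.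
rewrite ler_pdivrMr // ler_pdivrMr ?normc_gt0 //; lra.
Qed.

End Koebe.

(** * Koebe's theorem on arbitrary disks, growth and Harnack's inequality *)

Section Distortion.
Variable R : realType.
Implicit Types (f : R[i] -> R[i]) (a z w l v : R[i]).

Lemma hol_sub f a z (d e : R) : normc (z - a) + e <= d -> hol a d f -> hol z e f.
Proof.
by move=> ze hf w wz; apply: hf; have := normc_triangle z w a; lra.
Qed.

Lemma cinj_subdisk f a z (d e : R) : normc (z - a) + e <= d ->
  cinj a d f -> cinj z e f.
Proof.
move=> ze fi u v uz vz; apply: fi.
  by have := normc_triangle z u a; lra.
by have := normc_triangle z v a; lra.
Qed.

Lemma koebe f a w l (d : R) : 0 < d -> hol a d f -> cinj a d f -> cdiff f a l ->
  (forall z, normc (z - a) < d -> f z != w) -> d * normc l <= 512 * normc (w - f a).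
Proof.
move=> d0 hf fi df fw.
have dC0 : d%:C%C != 0 by rewrite -normc_gt0 normcR gtr0_norm.
pose h z := a + d%:C%C * z.
have dh z : cdiff h z (0 + d%:C%C * 1).
  by apply: cdiffD; [exact: cdiff_cst|apply: cdiffZ; exact: cdiff_id].
have h_in z : normc (z - 0) < 1 -> normc (h z - a) < d.
  rewrite subr0 /h addrC addKr normcM normcR gtr0_norm // => z1.
  by rewrite -[ltRHS]mulr1 ltr_pM2l.
pose F z := (f \o h) z - f a.
have dF z m : cdiff f (h z) m -> cdiff F z (m * (0 + d%:C%C * 1) - 0).
  by move=> dm; exact: (cdiffB (cdiff_comp (dh z) dm) (cdiff_cst (f a) z)).
have h0 : h 0 = a by rewrite /h mulr0 addr0.
suff : normc (l * (0 + d%:C%C * 1) - 0) <= 512 * normc (w - f a).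
  by rewrite subr0 add0r mulr1 normcM normcR gtr0_norm // mulrC.
apply: (@koebe_normalized R F).
- by move=> z /h_in /hf[m dm]; eexists; exact: dF dm.
- move=> u v /h_in hu /h_in hv /(addIr _) /= fuv.
  by have /addrI /(mulfI dC0) := fi _ _ hu hv fuv.
- by rewrite /F /= h0 subrr.
- by apply: dF; rewrite h0.
- move=> z z1; have /fw : normc (h z - a) < d by apply: h_in; rewrite subr0.
  by rewrite /F /=; apply: contra_neq => /addIr.
Qed.

Lemma koebe_cover f a v l (d : R) : 0 < d -> hol a d f -> cinj a d f -> cdiff f a l ->
  normc (v - f a) < d * normc l / 512 -> exists2 z, normc (z - a) < d & f z = v.
Proof.
move=> d0 hf fi df vl; apply: contrapT => nz.
have := @koebe f a v l d d0 hf fi df.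
suff : forall z, normc (z - a) < d -> f z != v by move=> H /(_ H); lra.
by move=> z zd; apply/eqP => fz; apply: nz; exists z.
Qed.

Lemma growth : exists2 C : R, 0 < C & forall f a z l (d : R),
  0 < d -> hol a d f -> cinj a d f -> cdiff f a l ->
  normc (z - a) <= d / 2 -> normc (f z - f a) <= C * (d * normc l).
Proof.
have [X X0 XE] : exists2 X : R, 0 <= X & expR 2048 <= X.
  by exists (expR 2048); [exact: expR_ge0|exact: lexx].
exists (2 * (1 + X)) => [|f a z l d d0 hf fi df zd]; first by rewrite mulr_gt0 // ltr_wpDr.
have l0 := cinj_deriv_neq0 d0 hf fi df.
have nl0 : 0 < normc l by rewrite normc_gt0.
have [q [cq qa] fE] := df.
have q0 u : normc (u - a) < d -> q u != 0.
  move=> ud; have [->|ua] := eqVneq u a; first by rewrite qa.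
  apply: contra_neq ua => qu; apply: fi; rewrite ?subrr ?normc0 //.
  by rewrite fE qu mul0r addr0.
have dq u : normc (u - a) < d -> u != a -> exists m, cdiff q u m.
  by move=> /hf[m dm] ua; exact: caratheodory_cdiff fE dm.
(* Otherwise [|q| > 2 * |l|] on the whole circle, and the maximum principle for the inverse of [q]
   gives [|l| = |q a| >= 2 * |l|]. *)
have [z1 z1d qz1] : exists2 z1, normc (z1 - a) = 3 * d / 4 & normc (q z1) <= 2 * normc l.
  apply: contrapT => nz1.
  have : normc (q a)^-1 <= (2 * normc l)^-1.
    apply: (@disk_max_at _ (fun u => (q u)^-1) a (3 * d / 4) d).
    - by lra.
    - by apply: ccontV => //; rewrite qa.
    - move=> u /andP[u0 ud]; have [|m dm] := dq u ud.
        by rewrite -subr_eq0 -normc_gt0.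
      by eexists; exact: (cdiffV dm (q0 u ud)).
    - move=> u ud; rewrite normcV lef_pV2 ?posrE ?mulr_gt0 //; last first.
        by rewrite normc_gt0 q0 // ud; lra.
      by rewrite leNgt; apply/negP => qu; apply: nz1; exists u => //; exact: ltW.
  rewrite qa normcV lef_pV2 ?posrE ?mulr_gt0 //; lra.
pose w := f z1.
(* The point [z1] is at distance at least [d / 8] from D(a, 5 d / 8), so [f - w] has no zero on
   disks of radius [d / 8] about its points: 4096 = 8 * 512 by Koebe's theorem. Over a distance
   [d / 2] the exponent becomes 2048. *)
have gw u : normc (u - a) < 5 * d / 8 ->
    exists2 m, cdiff (fun x => f x - w) u m & normc m <= 4096 / d * normc (f u - w).
  move=> ud; have [|m dm] := hf u; first by lra.
  exists m; first by rewrite -[m]subr0; exact: (cdiffB dm (cdiff_cst w u)).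
  have ud8 : normc (u - a) + d / 8 <= d by lra.
  have := @koebe f u w m (d / 8) _ (hol_sub ud8 hf) (cinj_subdisk ud8 fi) dm.
  rewrite (normcB w) => H; rewrite mulrAC ler_pdivlMr //.
  suff : d / 8 * normc m <= 512 * normc (f u - w) by rewrite mulrC; lra.
  apply: H => [|x xu]; first by rewrite divr_gt0.
  apply/eqP => fx.
  have xz1 : x = z1.
    apply: fi => //; last by rewrite z1d; lra.
    by have := normc_triangle u x a; lra.
  by move: z1d; rewrite -xz1; have := normc_triangle u x a; lra.
have zd8 : normc (z - a) < 5 * d / 8 by lra.
have ad8 : normc (a - a) < 5 * d / 8 by rewrite subrr normc0; lra.
have := disk_gronwall gw ad8 zd8.
have ga : normc (f a - w) <= 3 / 2 * (d * normc l).
  have := fE z1; rewrite -/w => ->; rewrite opprD addrA subrr add0r normcN normcM z1d.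
  have := ler_wpM2l (ltW d0) qz1; lra.
have E : expR (4096 / d * normc (z - a)) <= X.
  apply: le_trans XE.
  by rewrite ler_expR mulrAC ler_pdivrMr //; lra.
move=> gz.
have h1 := le_trans gz (ler_pM (expR_ge0 _) (normc_ge0 _) E ga).
have h2 := normc_triangle w (f z) (f a); rewrite (normcB w (f a)) in h2.
have Y0 := mulr_ge0 (ltW d0) (normc_ge0 l).
have XY0 := mulr_ge0 X0 Y0.
move: (d * normc l) ga h1 h2 Y0 XY0 => Y.
have -> : 2 * (1 + X) * Y = 2 * Y + 2 * (X * Y) by ring.
by clear; lra.
Qed.

Lemma harnack : exists2 C : R, 1 <= C & forall f a z (d : R),
  0 < d -> hol a d f -> cinj a d f ->
  (forall u, normc (u - a) < d -> f u != 0) -> normc (z - a) <= d / 2 ->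
  normc (f z) <= C * normc (f a) /\ normc (f a) <= C * normc (f z).
Proof.
have [X X1 XE] : exists2 X : R, 1 <= X & expR 1024 <= X.
  by exists (expR 1024); [rewrite -[leLHS]expR0 ler_expR ler0n|exact: lexx].
exists X => // f a z d d0 hf fi f0 zd.
(* Koebe's theorem with omitted value 0 on disks of radius [d / 4]: 2048 = 4 * 512. *)
have gw u : normc (u - a) < 3 * d / 4 ->
    exists2 m, cdiff f u m & normc m <= 2048 / d * normc (f u).
  move=> ud; have [|m dm] := hf u; first by lra.
  exists m => //.
  have ud4 : normc (u - a) + d / 4 <= d by lra.
  have := @koebe f u 0 m (d / 4) _ (hol_sub ud4 hf) (cinj_subdisk ud4 fi) dm.
  rewrite sub0r normcN => H; rewrite mulrAC ler_pdivlMr //.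
  suff : d / 4 * normc m <= 512 * normc (f u) by rewrite mulrC; lra.
  apply: H => [|x xu]; first by rewrite divr_gt0.
  by apply: f0; have := normc_triangle u x a; lra.
have zd8 : normc (z - a) < 3 * d / 4 by lra.
have ad8 : normc (a - a) < 3 * d / 4 by rewrite subrr normc0; lra.
have E : expR (2048 / d * normc (z - a)) <= X.
  apply: le_trans XE.
  by rewrite ler_expR mulrAC ler_pdivrMr //; lra.
split.
  apply: (le_trans (disk_gronwall gw ad8 zd8)).
  by rewrite ler_wpM2r ?normc_ge0.
apply: (le_trans (disk_gronwall gw zd8 ad8)).
by rewrite (normcB a) ler_wpM2r ?normc_ge0.
Qed.

End Distortion.

(** * Conformal mappings of the unit disk *)

Section Conformal.
Variable R : realType.
Implicit Types (z w l v : R[i]).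
Variable f : R[i] -> R[i].
Hypothesis conf_f : conformal f.

Lemma conf_hol : hol 0 1 f.
Proof. by move=> z; rewrite subr0 => /(conf_f.1)/derivable_cdiff. Qed.

Lemma conf_inj : cinj 0 1 f.
Proof.
move=> z w; rewrite !subr0 => z1 w1; apply: conf_f.2; rewrite inE /disk //=.
Qed.

Lemma conf_hol_at z (d : R) : normc z + d <= 1 -> hol z d f.
Proof. by move=> h; apply: hol_sub conf_hol; rewrite subr0. Qed.

Lemma conf_inj_at z (d : R) : normc z + d <= 1 -> cinj z d f.
Proof. by move=> h; apply: cinj_subdisk conf_inj; rewrite subr0. Qed.

Lemma conf_cdiff z : normc z < 1 -> exists l, cdiff f z l.
Proof. by move=> z1; apply: conf_hol; rewrite subr0. Qed.

Lemma conf_ccont z : normc z < 1 -> ccont f z.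
Proof. by move=> /conf_cdiff[l]; exact: cdiff_cont. Qed.

(** By injectivity there is at most one zero [a], and [2 * |z| >= 1 + |a|] keeps it out of the disk
    of center [z] and radius [1 - |z|]. *)
Lemma conf_neq0_near_boundary : exists r0 : R, [/\ 1 / 2 <= r0, r0 < 1 &
  forall z w, r0 <= normc z -> normc (w - z) < 1 - normc z -> f w != 0].
Proof.
have [[a a1 fa]|na] := pselect (exists2 a, normc a < 1 & f a = 0); last first.
  exists (1 / 2); split; [exact: lexx|lra|move=> z w _ wz].
  apply/eqP => fw; apply: na; exists w => //.
  by have := normc_triangle z w 0; rewrite !subr0; lra.
exists ((3 + normc a) / 4); have := normc_ge0 a.
split; [lra|lra|move=> z w hz wz; apply/eqP => fw].
have w1 : normc w < 1 by have := normc_triangle z w 0; rewrite !subr0; lra.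
have wa : w = a by apply: conf_inj; rewrite ?subr0 // fw fa.
by have := normc_triangle w z 0; rewrite !subr0 (normcB z) wa; rewrite wa in wz; lra.
Qed.

End Conformal.

(** * Area estimates *)

Section Packing.
Variable R : realType.
Implicit Types (c z v : R[i]).
Local Notation mu2 := ((@lebesgue_measure R) \x (@lebesgue_measure R))%E.

Definition square c (s : R) : set (R * R) :=
  `[complex.Re c - s, complex.Re c + s] `*` `[complex.Im c - s, complex.Im c + s].

Lemma squareP c s (w : R * R) : square c s w <->
  `|w.1 - complex.Re c| <= s /\ `|w.2 - complex.Im c| <= s.
Proof.
rewrite /square /= !in_itv /= !ler_norml; split=> -[/andP[a b] /andP[d e]].
  by split; lra.
by split; lra.
Qed.

Lemma square_normc c s (w : R * R) :
  square c s w -> normc (complex_of_pair w - c) <= 2 * s.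
Proof.
move=> /squareP[h1 h2]; apply: (le_trans (normc_le_ReIm _)).
by rewrite cReD cReN cImD cImN /=; lra.
Qed.

Lemma normc_square c s (w : R * R) :
  normc (complex_of_pair w - c) <= s -> square c s w.
Proof.
move=> h; apply/squareP; split; apply: le_trans h.
  by apply: le_trans (normRe_le _); rewrite cReD cReN.
by apply: le_trans (normIm_le _); rewrite cImD cImN.
Qed.

Lemma measurable_square c s : measurable (square c s).
Proof. by apply: measurableX; exact: measurable_itv. Qed.

Lemma measure_square c s : 0 <= s -> mu2 (square c s) = ((2 * s) ^+ 2)%:E.
Proof.
move=> s0; rewrite product_measure1E; [|exact: measurable_itv|exact: measurable_itv].
have itvE x : lebesgue_measure (`[x - s, x + s]%classic : set R) = (2 * s)%:E.
  rewrite (@lebesgue_measure_itv R) /= lte_fin; case: ltP => h.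
    by rewrite -EFinB; congr (_%:E); ring.
  by congr (_%:E); lra.
transitivity ((2 * s)%:E * (2 * s)%:E)%E; first by congr (_ * _)%E; exact: itvE.
by rewrite -EFinM expr2.
Qed.

(** The squares of half-side [s j / 4] about the [c j] lie in the disjoint disks and in the square
    of half-side [X] about 0; their areas [s j ^+ 2 / 4] add up to at most [4 * X ^+ 2]. *)
Lemma packing N (P : pred nat) (c : nat -> R[i]) (s : nat -> R) (X : R) :
  (forall j, (j < N)%N -> P j -> 0 < s j /\ normc (c j) + s j <= X) ->
  (forall j k v, (j < N)%N -> (k < N)%N -> P j -> P k ->
     normc (v - c j) < s j -> normc (v - c k) < s k -> j = k) ->
  \sum_(j < N | P j) s j ^+ 2 <= 16 * X ^+ 2.
Proof.
move=> hs disj.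
have [[j0 j0N Pj0]|nP] := pselect (exists2 j, (j < N)%N & P j); last first.
  rewrite big_pred0 => [|j]; first by have := sqr_ge0 X; lra.
  by apply/negbTE/negP => Pj; apply: nP; exists (val j) => //; exact: ltn_ord.
have X0 : 0 <= X.
  by have [h1 h2] := hs _ j0N Pj0; have := normc_ge0 (c j0); lra.
pose F j := if (j < N)%N && P j then square (c j) (s j / 4) else set0.
have mF j : measurable (F j).
  by rewrite /F; case: ifP => _; [exact: measurable_square|exact: measurable0].
have tF : trivIset setT F.
  move=> j k _ _; rewrite /F; case: ifP => [/andP[jN Pj]|_ [w [//]]].
  case: ifP => [/andP[kN Pk]|_ [w [_ //]]] [w [wj wk]].
  have [[sj _] [sk _]] := (hs j jN Pj, hs k kN Pk).
  apply: (disj j k (complex_of_pair w)) => //.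
    by apply: (le_lt_trans (square_normc wj)); lra.
  by apply: (le_lt_trans (square_normc wk)); lra.
have : (mu2 (\big[setU/set0]_(j < N) F j) <= mu2 (square 0%R X))%E.
  apply: le_measure; rewrite ?inE.
  - by apply: bigsetU_measurable => j _; exact: mF.
  - exact: measurable_square.
  rewrite -bigcup_mkord => w [j /= jN]; rewrite /F; case: ifP => // /andP[_ Pj] wj.
  have [sj cX] := hs j jN Pj; apply: normc_square.
  have := square_normc wj; have := normc_triangle (c j) (complex_of_pair w) 0.
  rewrite !subr0; lra.
rewrite measure_bigsetU // measure_square //.
have -> : (\sum_(j < N) mu2 (F j))%E = (\sum_(j < N | P j) (s j ^+ 2 / 4))%:E.
  rewrite -sumEFin [in RHS]big_mkcond /=; apply: eq_bigr => j _.
  rewrite /F ltn_ord /=; case: ifP => Pj; last by rewrite measure0.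
  have [sj _] := hs j (ltn_ord j) Pj.
  by rewrite measure_square; [congr (_%:E); field|rewrite divr_ge0 // ltW].
rewrite lee_fin -mulr_suml; lra.
Qed.

(* Dyadic shells in |c j|: the j with |c j| close to M / 2 ^ i contribute at
   most a multiple of (M / 2 ^ i) ^ p. *)
Lemma weighted_packing (p : R) : 0 < p -> exists2 C : R, 0 < C &
  forall N (c : nat -> R[i]) (s : nat -> R) (M : R),
  (forall j, (j < N)%N -> 0 < s j /\ s j <= normc (c j) <= M) ->
  (forall j k v, (j < N)%N -> (k < N)%N ->
     normc (v - c j) < s j -> normc (v - c k) < s k -> j = k) ->
  \sum_(j < N) normc (c j) `^ p * (s j / normc (c j)) ^+ 2 <= C * M `^ p.
Proof.
move=> p0; pose theta : R := (2^-1) `^ p.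
have theta0 : 0 < theta by rewrite powR_gt0 // invr_gt0.
have theta1 : theta < 1.
  apply: (@lt_le_trans _ _ (1 `^ p)); last by rewrite powR1.
  by apply: gt0_ltr_powR; rewrite ?nnegrE ?invr_ge0 //; lra.
exists (256 / (1 - theta)) => [|N c s M hs disj].
  by apply: divr_gt0; [rewrite ltr0n|rewrite subr_gt0].
case: N hs disj => [|N'] hs disj.
  rewrite big_ord0; apply: mulr_ge0 (powR_ge0 _ _).
  by apply: divr_ge0; [rewrite ler0n|rewrite subr_ge0 ltW].
set N := N'.+1 in hs disj *.
have M0 : 0 < M by have [h1 /andP[h2 h3]] := hs 0%N isT; lra.
pose m i : R := M / 2 ^+ i.
have m0 i : 0 < m i by rewrite divr_gt0 // exprn_gt0.
have mS i : m i = 2 * m i.+1 by rewrite /m exprS; field; rewrite expf_neq0.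
have mp i : m i `^ p = M `^ p * theta ^+ i.
  rewrite /m powRM ?ltW ?invr_gt0 ?exprn_gt0 //; congr (_ * _).
  rewrite -exprVn; elim: i => [|i IH]; first by rewrite !expr0 powR1.
  by rewrite !exprS powRM ?IH ?invr_ge0 // exprn_ge0 // invr_ge0.
have c0 j : (j < N)%N -> 0 < normc (c j).
  by move=> /hs[h1 /andP[h2 _]]; lra.
have [I hI] : exists I, forall j, (j < N)%N -> m I < normc (c j).
  have H j : (j < N)%N -> exists i, m i < normc (c j) by move=> /c0; exact: halving_lt.
  elim: N H {hs disj c0} => [|n IH] H; first by exists 0%N.
  have [|I hI] := IH; first by move=> j jn; apply: H; exact: ltnW.
  have [i hi] := H n (ltnSn n); exists (maxn I i) => j.
  have anti a b : (a <= b)%N -> m b <= m a.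
    move=> ab; rewrite /m ler_pM2l // lef_pV2 ?posrE ?exprn_gt0 //.
    by rewrite ler_eXn2l // ltr1n.
  rewrite ltnS leq_eqVlt => /predU1P[->|/hI].
    by apply: le_lt_trans hi; apply: anti; exact: leq_maxr.
  by apply: le_lt_trans; apply: anti; exact: leq_maxl.
(* If [m k.+1 < |c j| <= m k], the summand of index [k] alone is large enough. *)
have shell j : (j < N)%N -> normc (c j) `^ p * (s j / normc (c j)) ^+ 2 <=
    \sum_(i < I | normc (c j) <= m i) 4 * m i `^ p / m i ^+ 2 * s j ^+ 2.
  move=> jN; have [sj /andP[sc cM]] := hs j jN; have cj := c0 j jN.
  have [[|k] kc min_k] := @ex_minnP (fun i => m i < normc (c j)) (ex_intro _ I (hI j jN)).
    by move: kc; rewrite /m expr0 divr1; lra.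
  have ck : normc (c j) <= m k.
    by rewrite leNgt; apply/negP => /min_k; rewrite ltnn.
  have kI : (k < I)%N by apply: min_k; exact: hI.
  rewrite (bigD1 (Ordinal kI)) //= ler_wpDr //.
    apply: sumr_ge0 => i _; apply: mulr_ge0 (sqr_ge0 _).
    by apply: divr_ge0 (sqr_ge0 _); apply: mulr_ge0 (powR_ge0 _ _).
  have -> : 4 * m k `^ p / m k ^+ 2 * s j ^+ 2 = m k `^ p * (s j / m k.+1) ^+ 2.
    by rewrite (mS k); field; rewrite gt_eqF.
  apply: ler_pM; rewrite ?powR_ge0 ?sqr_ge0 //.
    by apply: ge0_ler_powR; rewrite ?nnegrE ?normc_ge0 ?(ltW p0) ?(ltW (m0 _)).
  have h1 : 0 <= s j / normc (c j) by apply: divr_ge0; [exact: ltW|exact: ltW].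
  have h2 : 0 <= s j / m k.+1 by apply: divr_ge0; [exact: ltW|exact: ltW].
  rewrite ler_pXn2r ?nnegrE // ler_pM2l // lef_pV2 ?posrE //.
  exact: ltW.
apply: (@le_trans _ _ (\sum_(j < N) \sum_(i < I | normc (c j) <= m i)
    4 * m i `^ p / m i ^+ 2 * s j ^+ 2)).
  by apply: ler_sum => j _; exact: shell.
rewrite (exchange_big_dep xpredT) //=.
apply: (@le_trans _ _ (\sum_(i < I) 256 * M `^ p * theta ^+ i)).
  apply: ler_sum => i _; rewrite -mulr_sumr.
  (* As [s j <= |c j|], the disks concerned lie in the one of radius [2 * m i] about 0. The 256 is 4
     * 16 * 2 ^ 2. *)
  have H : \sum_(j < N | normc (c j) <= m i) s j ^+ 2 <= 16 * (2 * m i) ^+ 2.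
    apply: (@packing N (fun j => normc (c j) <= m i) c s) => [j jN cm|j k v jN kN _ _].
      by have [sj /andP[sc _]] := hs j jN; split => //; lra.
    exact: disj.
  apply: (le_trans (ler_wpM2l _ H)).
    by apply: divr_ge0 (sqr_ge0 _); apply: mulr_ge0 (powR_ge0 _ _).
  rewrite mp le_eqVlt; apply/orP; left; apply/eqP; field.
  by rewrite gt_eqF.
rewrite -mulr_sumr.
have geo : \sum_(i < I) theta ^+ i <= (1 - theta)^-1.
  have t1 : 0 < 1 - theta by rewrite subr_gt0.
  rewrite -(ler_pM2l t1) divff ?gt_eqF // -opprB mulNr -subrX1 opprB gerBl.
  by rewrite exprn_ge0 // ltW.
rewrite -mulrA [M `^ p * _]mulrC mulrA -mulrA.
rewrite [leRHS](_ : _ = 256 * M `^ p * (1 - theta)^-1); last by ring.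
rewrite [leLHS](_ : _ = 256 * M `^ p * \sum_(i < I) theta ^+ i); last by ring.
by apply: ler_wpM2l geo; apply: mulr_ge0 (powR_ge0 _ _); rewrite ler0n.
Qed.

End Packing.

(** * Increments of real powers *)

Section PowerDifference.
Variable R : realType.

Lemma powR_mvt (q a b : R) : 0 < a -> 0 < b ->
  exists2 c, Num.min a b <= c <= Num.max a b &
    `|b `^ q - a `^ q| = `|q| * c `^ (q - 1) * `|b - a|.
Proof.
move=> a0 b0.
have H x y : 0 < x -> x < y -> exists2 c, x <= c <= y &
    y `^ q - x `^ q = q * c `^ (q - 1) * (y - x).
  move=> x0 xy; have [|||c] := @MVT R (fun t => t `^ q) (fun t => q * t `^ (q - 1)) x y.
  - exact: xy.
  - move=> t; rewrite in_itv /= => /andP[xt _].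
    by apply: is_derive1_powR; exact: lt_trans xt.
  - apply: continuous_in_subspaceT => t; rewrite inE /= in_itv /= => /andP[xt _].
    have [dt _] := is_derive1_powR q (lt_le_trans x0 xt).
    by apply: differentiable_continuous; exact/derivable1_diffP.
  - rewrite in_itv /= => /andP[xc cy] E; exists c => //.
    by rewrite !ltW.
have N x y c : 0 < x -> x < y ->
    y `^ q - x `^ q = q * c `^ (q - 1) * (y - x) ->
    `|y `^ q - x `^ q| = `|q| * c `^ (q - 1) * `|y - x|.
  by move=> x0 xy ->; rewrite !normrM (ger0_norm (powR_ge0 _ _)).
have [ab|ba|->] := ltgtP a b.
- have [c hc E] := H a b a0 ab; exists c => //.
  exact: N.
- have [c hc E] := H b a b0 ba; exists c => //.
  by rewrite distrC [in RHS]distrC; exact: N.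
- by exists b; rewrite ?lexx // !subrr normr0 mulr0.
Qed.

(** In the mean value theorem [c ^ (q - 1)] is split as [c ^ q / c], and the two factors are bounded
    separately by [c <= H * a] and [a / H <= c]; this works for both signs of [q - 1]. *)
Lemma powR_diff_le (q H : R) : 0 < q -> 1 <= H -> exists2 K, 0 < K &
  forall a b, 0 < a -> 0 < b -> b <= H * a -> a <= H * b ->
  `|b `^ q - a `^ q| <= K * a `^ q * (`|b - a| / a).
Proof.
move=> q0 H1; have H0 : 0 < H by lra.
exists (q * H `^ q * H) => [|a b a0 b0 bH aH]; first by rewrite !mulr_gt0 ?powR_gt0.
have [c /andP[c1 c2] ->] := powR_mvt q a0 b0.
have Ha : a <= H * a by rewrite ler_peMl // ltW.
have aHa : a / H <= a by rewrite ler_pdivrMr // mulrC.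
have c3 : c <= H * a by apply: (le_trans c2); rewrite ge_max Ha bH.
have c4 : a / H <= c.
  by apply: le_trans c1; rewrite le_min aHa /= ler_pdivrMr // mulrC.
have c0 : 0 < c by apply: lt_le_trans c4; rewrite divr_gt0.
rewrite powRB; last by rewrite (gt_eqF c0) implybT.
rewrite (powRr1 (ltW c0)) (gtr0_norm q0).
rewrite [leRHS](_ : _ = q * (H `^ q * a `^ q / (a / H)) * `|b - a|); last first.
  by field; rewrite !gt_eqF.
rewrite ler_wpM2r // ler_pM2l // -powRM ?(ltW H0) ?(ltW a0) //.
apply: ler_pM; rewrite ?powR_ge0 ?invr_ge0 ?(ltW c0) //.
  by apply: ge0_ler_powR; rewrite ?nnegrE ?mulr_ge0 ?(ltW q0) ?(ltW c0) ?(ltW a0) ?(ltW H0).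
by rewrite lef_pV2 ?posrE ?divr_gt0.
Qed.

End PowerDifference.

(** * Arcs and chords of the unit circle *)

Section Chords.
Variable R : realType.

Lemma sin_mvt (x : R) : exists2 c, 0 <= c <= 1 & sin x = cos (c * x) * x.
Proof.
have [t ht|c hc] := @real_mvt R (fun t => sin (t * x)) (fun t => cos (t * x) * x).
  apply: (@is_derive1_comp R sin (fun t => t * x)).
  apply: approx_is_derive => e e0; exists 1 => // y _.
  have -> : y * x - t * x - x * (y - t) = 0 by ring.
  by rewrite normr0 mulr_ge0 // ltW.
by rewrite mul1r mul0r sin0 subr0; exists c.
Qed.

Lemma normr_sin_le (x : R) : `|sin x| <= `|x|.
Proof.
have [c _ ->] := sin_mvt x.
by rewrite normrM ler_piMl // ler_norml cos_geN1 cos_le1.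
Qed.

Lemma normr_sin_ge (x : R) : `|x| <= 1 -> `|x| / 2 <= `|sin x|.
Proof.
move=> x1; have [c /andP[c0 c1] ->] := sin_mvt x.
rewrite normrM mulrC ler_wpM2r //; apply: le_trans (ler_norm _).
have : `|c * x| <= 1.
  by rewrite normrM (ger0_norm c0) mulr_ile1.
(* The half-angle formula yields [cos y >= 1 / 2] from [|sin (y / 2)| <= 1 / 2]. *)
move: (c * x) => y y1; have -> : cos y = 1 - 2 * sin (y / 2) ^+ 2.
  rewrite [in LHS](splitr y) cosD -!expr2 cos2sin2; ring.
have : sin (y / 2) ^+ 2 <= (1 / 2) ^+ 2.
  rewrite -real_normK ?num_real // ler_pXn2r ?nnegrE ?divr_ge0 //.
  apply: (le_trans (normr_sin_le _)).
  by rewrite normrM normfV (@ger0_norm _ 2) // ler_wpM2r ?invr_ge0.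
lra.
Qed.

Lemma normc_cisB (s t : R) : normc (cis s - cis t) = 2 * `|sin ((s - t) / 2)|.
Proof.
have -> : cis s - cis t = cis t * (cis (s - t) - 1).
  by rewrite mulrBr -cisD mulr1 [t + _]addrC subrK.
rewrite normcM normc_cis mul1r.
apply/eqP; rewrite -(@eqrXn2 _ 2) ?mulr_ge0 ?normc_ge0 // sqr_normcE exprMn.
rewrite real_normK ?num_real // !cReD !cImD !cReN !cImN /= oppr0 addr0.
set x := (s - t) / 2; have -> : s - t = x + x by rewrite /x -splitr.
rewrite cosD sinD; have := cos2Dsin2 x.
set c := cos x; set d := sin x => h; apply/eqP.
have -> : (c * c - d * d - 1) ^+ 2 + (d * c + c * d) ^+ 2 =
  (c ^+ 2 + d ^+ 2) ^+ 2 - 2 * (c ^+ 2 + d ^+ 2) + 1 + 4 * d ^+ 2 by ring.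
by rewrite h; ring.
Qed.

Lemma chord_le (s t : R) : normc (cis s - cis t) <= `|s - t|.
Proof.
rewrite normc_cisB; have := normr_sin_le ((s - t) / 2).
by rewrite normrM normfV (@ger0_norm _ 2) //; lra.
Qed.

Lemma chord_ge (s t : R) : `|s - t| <= 1 -> `|s - t| / 2 <= normc (cis s - cis t).
Proof.
move=> st; rewrite normc_cisB.
have E : `|(s - t) / 2| = `|s - t| / 2 by rewrite normrM normfV (@ger0_norm _ 2).
by have := @normr_sin_ge ((s - t) / 2); rewrite E => /(_ ltac:(lra)); lra.
Qed.

Lemma normc_polar (r t : R) : 0 <= r -> normc (r%:C%C * cis t) = r.
Proof. by move=> r0; rewrite normcM normc_cis mulr1 normcR ger0_norm. Qed.

Lemma normc_polarB (r s t : R) : 0 <= r ->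
  normc (r%:C%C * cis s - r%:C%C * cis t) = r * normc (cis s - cis t).
Proof. by move=> r0; rewrite -mulrBr normcM normcR ger0_norm. Qed.

Lemma normc_radialB (r s t : R) : normc (r%:C%C * cis t - s%:C%C * cis t) = `|r - s|.
Proof. by rewrite -mulrBl -rmorphB normcM normc_cis mulr1 normcR. Qed.

End Chords.

(** * Increments of the modulus between two circles *)

Section LevelSums.
Variable R : realType.

Definition nonvanishing_beyond (f : R[i] -> R[i]) (r0 : R) := forall z w,
  r0 <= normc z -> normc (w - z) < 1 - normc z -> f w != 0.

Lemma conf_harnack : exists2 C : R, 1 <= C & forall f r0 z w,
  conformal f -> nonvanishing_beyond f r0 -> r0 <= normc z -> normc z < 1 ->
  normc (w - z) <= (1 - normc z) / 2 ->
  normc (f w) <= C * normc (f z) /\ normc (f z) <= C * normc (f w).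
Proof.
have [C C1 HC] := harnack R; exists C => // f r0 z w cf f0 rz z1 wz.
have zz : normc z + (1 - normc z) <= 1 by lra.
apply: (HC f z w (1 - normc z)) => //.
- by rewrite subr_gt0.
- exact: conf_hol_at.
- exact: conf_inj_at.
- by move=> u uz; apply: (f0 z).
Qed.

(* Area estimate on one circle: the disks D(z_j, (1 - rho)/8) are disjoint, so by
   Koebe their images contain disjoint disks of radius comparable to
   |f z'_j - f z_j|, to which the packing bound applies. *)
Lemma level_sum (p : R) : 0 < p -> exists2 C : R, 0 < C &
  forall f r0 rho rho' N (theta : nat -> R) M,
  conformal f -> nonvanishing_beyond f r0 -> 1 / 2 <= r0 ->
  r0 <= rho < 1 -> rho <= rho' <= rho + (1 - rho) / 2 ->
  (forall j k, (j < N)%N -> (k < N)%N -> j <> k ->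
     1 - rho <= `|theta j - theta k| <= 1) ->
  (forall j, (j < N)%N -> normc (f (rho%:C%C * cis (theta j))) <= M) ->
  \sum_(j < N) (normc (f (rho'%:C%C * cis (theta j))) `^ (p / 2) -
                normc (f (rho%:C%C * cis (theta j))) `^ (p / 2)) ^+ 2 <= C * M `^ p.
Proof.
move=> p0; have [C1 C10 packC] := weighted_packing p0.
have [Cg Cg0 growthC] := growth R.
have [H H1 harnackC] := conf_harnack.
have p2 : 0 < p / 2 by rewrite divr_gt0.
have [K K0 diffK] := powR_diff_le p2 H1.
have [B [B0 BE]] : exists B : R, 0 < B /\ B = 8 * 512.
  by exists (8 * 512); split; [apply: mulr_gt0; rewrite ltr0n|reflexivity].
exists ((K * (Cg * B)) ^+ 2 * C1) => [|f r0 rho rho' N theta M cf f0 r02 hrho hrho' hth hM].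
  by rewrite mulr_gt0 // exprn_gt0 // !mulr_gt0.
pose d := 1 - rho; have d0 : 0 < d by rewrite /d; lra.
have rho0 : 0 <= rho by lra.
pose z j := rho%:C%C * cis (theta j); pose z' j := rho'%:C%C * cis (theta j).
have nz j : normc (z j) = rho by exact: normc_polar.
have z1 j : normc (z j) < 1 by rewrite nz; lra.
have r0z j : r0 <= normc (z j) by rewrite nz; lra.
have zz' j : normc (z' j - z j) <= d / 2.
  by rewrite normc_radialB ger0_norm; rewrite /d; lra.
pose l j := projT1 (cid (conf_cdiff cf (z1 j))).
have dl j : cdiff f (z j) (l j) by rewrite /l; case: cid.
have fz0 j w : normc (w - z j) < d -> f w != 0.
  by move=> wz; apply: (f0 (z j)) => //; rewrite nz.
have sub_hol j e : e <= d -> hol (z j) e f.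
  by move=> ed; apply: conf_hol_at => //; rewrite nz; move: ed; rewrite /d; lra.
have sub_inj j e : e <= d -> cinj (z j) e f.
  by move=> ed; apply: conf_inj_at => //; rewrite nz; move: ed; rewrite /d; lra.
have l0 j : 0 < normc (l j).
  by rewrite normc_gt0; apply: (cinj_deriv_neq0 d0 (sub_hol j d _) (sub_inj j d _) (dl j)).
(* Radius of the disk about [f (z j)] that the image of D(z j, d / 8) contains by Koebe's
   theorem. *)
pose s j := d / 8 * normc (l j) / 512.
have s0 j : 0 < s j by rewrite divr_gt0 ?ltr0n // mulr_gt0 // divr_gt0 // ltr0n.
have d8 : 0 < d / 8 by rewrite divr_gt0.
have d8d : d / 8 <= d by lra.
have cover j v : normc (v - f (z j)) < s j ->
    exists2 w, normc (w - z j) < d / 8 & f w = v.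
  exact: (koebe_cover d8 (sub_hol j _ d8d) (sub_inj j _ d8d) (dl j)).
(* Otherwise the covered disk would contain 0, which [f] omits on D(z j, d). *)
have sf j : s j <= normc (f (z j)).
  rewrite leNgt; apply/negP => lt_s.
  have [|w wz /eqP] := cover j 0; first by rewrite sub0r normcN.
  by apply/negP; apply: fz0; apply: lt_le_trans wz _.
have fz_gt0 j : 0 < normc (f (z j)) by apply: lt_le_trans (sf j).
(* A common value would force [|z j - z k| < d / 4], while angles at least [d] apart give a chord of
   length at least [rho * d / 2 >= d / 4]. *)
have disj j k v : (j < N)%N -> (k < N)%N ->
    normc (v - f (z j)) < s j -> normc (v - f (z k)) < s k -> j = k.
  move=> jN kN /cover[w wz fw] /cover[w' wz' fw'].
  apply: contrapT => jk; have /andP[th1 th2] := hth j k jN kN jk.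
  have ww' : w = w'.
    apply: (conf_inj cf); rewrite ?fw ?fw' // !subr0.
      by have := normc_triangle (z j) w 0; rewrite !subr0 nz; rewrite /d in wz; lra.
    by have := normc_triangle (z k) w' 0; rewrite !subr0 nz; rewrite /d in wz'; lra.
  have : normc (z j - z k) < d / 4.
    rewrite -ww' in wz'.
    by have := normc_triangle w (z j) (z k); rewrite (normcB (z j) w); lra.
  rewrite /z normc_polarB //; have := chord_ge th2.
  have rho12 : 1 / 2 <= rho by lra.
  move: (normc _) => t ht; have : d / 2 <= t by rewrite /d; lra.
  have [h1 h2] : 0 <= 1 / 2 :> R /\ 0 <= d / 2 by rewrite !divr_ge0 // ltW.
  move=> dt lt_d; have := le_lt_trans (ler_pM h1 h2 rho12 dt) lt_d.
  by rewrite (_ : 1 / 2 * (d / 2) = d / 4) ?ltxx //; field.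
(* The increment of [f] is at most a multiple of [d * |l j|], that is, of [s j]; Harnack's
   inequality supplies the comparability that [powR_diff_le] asks for. *)
have term j : (normc (f (z' j)) `^ (p / 2) - normc (f (z j)) `^ (p / 2)) ^+ 2 <=
    (K * (Cg * B)) ^+ 2 *
    (normc (f (z j)) `^ p * (s j / normc (f (z j))) ^+ 2).
  have wz : normc (z' j - z j) <= (1 - normc (z j)) / 2 by rewrite nz.
  have [h1 h2] := harnackC f r0 (z j) (z' j) cf f0 (r0z j) (z1 j) wz.
  have fz'0 : 0 < normc (f (z' j)).
    by rewrite normc_gt0; apply: (fz0 j); have := zz' j; lra.
  have g := growthC f (z j) (z' j) (l j) d d0 (sub_hol j d (lexx _)) (sub_inj j d (lexx _)) (dl j) (zz' j).
  have {}g : `|normc (f (z' j)) - normc (f (z j))| <= Cg * B * s j.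
    rewrite (_ : _ * s j = Cg * (d * normc (l j))); last first.
      by rewrite /s BE; field.
    apply: le_trans g; rewrite ler_norml ler_normcB andbT.
    by have := ler_normcB (f (z j)) (f (z' j)); rewrite (normcB (f (z j))); lra.
  have D := diffK _ _ (fz_gt0 j) fz'0 h1 h2.
  have E : (normc (f (z j)) `^ (p / 2)) ^+ 2 = normc (f (z j)) `^ p.
    rewrite expr2 -powRD; first by rewrite -splitr.
    by rewrite -splitr (gt_eqF p0).
  rewrite -E -exprMn -exprMn -real_normK ?num_real //.
  rewrite ler_pXn2r ?nnegrE //; last first.
    apply: mulr_ge0; first by rewrite ltW // !mulr_gt0.
    by apply: mulr_ge0 (powR_ge0 _ _) _; apply: divr_ge0; apply: ltW.
  apply: (le_trans D).
  rewrite [leRHS](_ : _ = K * normc (f (z j)) `^ (p / 2) *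
     (Cg * B * s j / normc (f (z j)))); last by ring.
  apply: ler_wpM2l; first by rewrite mulr_ge0 ?powR_ge0 // ltW.
  by rewrite ler_wpM2r // invr_ge0 normc_ge0.
apply: (@le_trans _ _ (\sum_(j < N) (K * (Cg * B)) ^+ 2 *
    (normc (f (z j)) `^ p * (s j / normc (f (z j))) ^+ 2))).
  by apply: ler_sum => j _; exact: term.
rewrite -mulr_sumr -[leRHS]mulrA; apply: ler_wpM2l; first exact: sqr_ge0.
apply: (packC N (fun j => f (z j)) s M) => [j jN|].
  by split => //; rewrite sf hM.
exact: disj.
Qed.

End LevelSums.

(** * Hardy spaces *)

Section Integrals.
Import HBNNSimple.

(** The integral of a nonnegative function is a supremum over the simple functions below it, hence
    monotone even for functions and domains not known to be measurable. *)
Lemma ge0_le_integral_any d (T : measurableType d) (R : realType)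
    (mu : {measure set T -> \bar R}) (D E : set T) (f g : T -> \bar R) :
  (forall x, D x -> (0 <= f x)%E) -> (forall x, E x -> (0 <= g x)%E) ->
  (forall x, D x -> E x /\ (f x <= g x)%E) ->
  (\int[mu]_(x in D) f x <= \int[mu]_(x in E) g x)%E.
Proof.
move=> f0 g0 fg; rewrite !(integral_mkcond _ f) !(integral_mkcond _ g).
rewrite !ge0_integralTE; [|by apply: erestrict_ge0..].
apply: ereal_sup_le => _ [h hf <-].
exists h => // x; apply: (le_trans (hf x)).
rewrite !patchE; case: ifPn => [|_].
  by rewrite inE => /fg[Ex ?]; rewrite mem_set.
by case: ifPn => // /set_mem /g0.
Qed.

Variable R : realType.
Implicit Types (phi psi : R -> R).

Lemma cintD (a b : R) phi psi : cont_on a b phi -> cont_on a b psi ->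
  cint a b (fun x => phi x + psi x) = cint a b phi + cint a b psi.
Proof.
by move=> /cont_on_integrable ? /cont_on_integrable ?; exact: RintegralD.
Qed.

Lemma cintZ (a b k : R) phi : cont_on a b phi ->
  cint a b (fun x => k * phi x) = k * cint a b phi.
Proof. by move=> /cont_on_integrable ?; exact: RintegralZl. Qed.

Lemma cont_onD (a b : R) phi psi : cont_on a b phi -> cont_on a b psi ->
  cont_on a b (fun x => phi x + psi x).
Proof. by move=> h1 h2 x xab; apply: cvgD; [exact: h1|exact: h2]. Qed.

Lemma cont_onM (a b : R) phi psi : cont_on a b phi -> cont_on a b psi ->
  cont_on a b (fun x => phi x * psi x).
Proof. by move=> h1 h2 x xab; apply: cvgM; [exact: h1|exact: h2]. Qed.

Lemma cint_ge0 (a b : R) phi : (forall x, 0 <= phi x) -> 0 <= cint a b phi.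
Proof. by move=> h; apply: Rintegral_ge0. Qed.

Lemma integral_cint (a b : R) phi : cont_on a b phi ->
  (\int[@lebesgue_measure R]_(x in `[a, b]) (phi x)%:E)%E = (cint a b phi)%:E.
Proof.
by move=> /cont_on_integrable iphi; rewrite /cint /Rintegral fineK // integrable_fin_num.
Qed.

Lemma cint_derive (a x : R) phi : (forall y, {for y, continuous phi}) -> a < x ->
  is_derive x 1 (fun y => cint a y phi) (phi x).
Proof.
move=> cphi ax.
have [|||dF F'] := @continuous_FTC1_closed R phi a x (x + 1) _ _ _ (cphi x).
- by rewrite ltrDl.
- by apply: cont_on_integrable => y _; exact: cphi.
- exact: ax.
by apply: DeriveDef; [exact: dF|rewrite -derive1E; exact: F'].
Qed.

(* The sum of a primitive of phi over the N + 1 points equispaced with step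
   1 / (N + 1) telescopes when shifted by one step; apply the mean value theorem
   to it. *)
Lemma cint_riemann_le (a B : R) N phi : (forall y, {for y, continuous phi}) ->
  (forall s, \sum_(j < N.+1) phi (a + s + j%:R / N.+1%:R) <= B) ->
  cint a (a + 1) phi <= B / N.+1%:R.
Proof.
move=> cphi hB; set n : R := N.+1%:R.
have n0 : 0 < n by rewrite ltr0n.
(* The primitive starts to the left of [a], so that it is differentiable at [a] as well. *)
pose P x := cint (a - 1) x phi.
pose Q (j : 'I_N.+1) t := P (a + j%:R / n + t * n^-1).
have dQ (j : 'I_N.+1) (t : R) : 0 <= t <= 1 ->
    is_derive t 1 (Q j) (phi (a + j%:R / n + t * n^-1) * n^-1).
  move=> /andP[t0 _]; apply: (@is_derive1_comp R P (fun t => a + j%:R / n + t * n^-1)).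
    apply: cint_derive => //.
    have h1 : 0 <= j%:R / n by rewrite divr_ge0 // ltW.
    have h2 : 0 <= t * n^-1 by rewrite divr_ge0 // ltW.
    apply: (@lt_le_trans _ _ a); first by rewrite gtrBl.
    by rewrite -addrA lerDl addr_ge0.
  apply: approx_is_derive => e e0; exists 1 => // y _.
  have -> : a + j%:R / n + y * n^-1 - (a + j%:R / n + t * n^-1) - n^-1 * (y - t) = 0.
    by ring.
  by rewrite normr0 mulr_ge0 // ltW.
have sumQ : (fun t => \sum_(j < N.+1) Q j t) = \sum_(j < N.+1) Q j.
  by apply/funext => t; rewrite fct_sumE.
have [c hc] := @real_mvt R (fun t => \sum_(j < N.+1) Q j t)
    (fun t => \sum_(j < N.+1) phi (a + j%:R / n + t * n^-1) * n^-1)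
    (fun t ht => eq_ind_r (fun h => is_derive t 1 h _)
       (is_derive_sum (fun j => dQ j t ht)) sumQ).
rewrite -sumrB.
have -> : \sum_(j < N.+1) (Q j 1 - Q j 0) = P (a + 1) - P a.
  rewrite (eq_bigr (fun j : 'I_N.+1 => P (a + j.+1%:R / n) - P (a + (val j)%:R / n))).
    rewrite -(big_mkord xpredT (fun j => P (a + j.+1%:R / n) - P (a + j%:R / n))).
    rewrite (telescope_sumr (fun j => P (a + j%:R / n))) // divff ?gt_eqF //.
    by rewrite mul0r addr0.
  move=> j _; rewrite /Q mul0r addr0; congr (P _ - _).
  by rewrite -natr1; field; rewrite gt_eqF.
have -> : P (a + 1) - P a = cint a (a + 1) phi.
  rewrite /P (@cint_split _ (a - 1) (a + 1) a); [ring|lra|].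
  by move=> y _; exact: cphi.
move=> ->; rewrite -mulr_suml ler_pM2r ?invr_gt0 //.
apply: le_trans (hB (c / n)); rewrite le_eqVlt; apply/orP; left; apply/eqP.
by apply: eq_bigr => j _; congr phi; ring.
Qed.

(** The product of the factors [1 + tau ^+ i] is at most the exponential of a geometric sum. *)
Lemma almost_nonincreasing_bounded (tau : R) (x : nat -> R) n0 : 0 < tau < 1 ->
  (forall n, (n0 <= n)%N -> 0 <= x n /\ x n.+1 <= (1 + tau ^+ n) * x n) ->
  forall n, (n0 <= n)%N -> x n <= expR (1 - tau)^-1 * x n0.
Proof.
move=> /andP[t0 t1] hx n /subnK <-; move: (n - n0)%N => {n} k.
have [x0 _] := hx n0 (leqnn _).
apply: (@le_trans _ _ (expR (\sum_(i < k) tau ^+ i) * x n0)); last first.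
  rewrite ler_wpM2r // ler_expR.
  have s0 : 0 < 1 - tau by rewrite subr_gt0.
  rewrite -(ler_pM2l s0) divff ?gt_eqF // -opprB mulNr -subrX1 opprB gerBl.
  by rewrite exprn_ge0 // ltW.
elim: k => [|k IH]; first by rewrite big_ord0 expR0 mul1r.
rewrite big_ord_recr /= expRD addSn.
have [_ h] := hx (k + n0)%N (leq_addl _ _); apply: (le_trans h).
rewrite mulrAC mulrC; apply: ler_pM => //.
- by have [] := hx (k + n0)%N (leq_addl _ _).
- by rewrite addr_ge0 // exprn_ge0 // ltW.
- apply: le_trans (expR_ge1Dx _); rewrite lerD2l exprD.
  by rewrite ler_piMr ?exprn_ge0 ?exprn_ile1 ?ltW.
Qed.

End Integrals.

(** * Hardy spaces and growth of the modulus *)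

Section HardySpaces.
Variable R : realType.
Implicit Types (f : R[i] -> R[i]) (p lam : R).

Definition growth_bound f lam :=
  exists C : R, forall z, normc z < 1 -> normc (f z) `^ lam * (1 - normc z) <= C.

Lemma conf_bounded f (r : R) : conformal f -> r < 1 ->
  exists2 B : R, 0 < B & forall z, normc z <= r -> normc (f z) <= B.
Proof.
move=> cf r1; have [B hB] := @ccont_bounded R f r (fun z zr =>
  conf_ccont cf (le_lt_trans zr r1)).
exists (`|B| + 1) => [|z /hB]; first by rewrite ltr_wpDl.
by have := ler_norm B; lra.
Qed.

Lemma conf_powR_bounded f lam (r : R) : conformal f -> 0 <= lam -> r < 1 ->
  exists2 C : R, 0 < C & forall z, normc z <= r -> normc (f z) `^ lam <= C.
Proof.
move=> cf l0 r1; have [B B0 hB] := conf_bounded cf r1.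
exists (B `^ lam) => [|z /hB h]; first exact: powR_gt0.
by apply: ge0_ler_powR; rewrite ?nnegrE ?normc_ge0 // ltW.
Qed.

Lemma near_boundary_growth_bound f lam (r : R) : conformal f -> 0 <= lam -> r < 1 ->
  (exists C : R, forall z, r <= normc z -> normc z < 1 ->
     normc (f z) `^ lam * (1 - normc z) <= C) ->
  growth_bound f lam.
Proof.
move=> cf l0 r1 [C hC]; have [C' C'0 hC'] := conf_powR_bounded cf l0 r1.
exists (Num.max C C') => z z1; rewrite le_max.
have [rz|/ltW zr] := leP r (normc z); first by rewrite hC.
apply/orP; right; apply: le_trans (hC' z zr).
by rewrite ler_piMr ?powR_ge0 //; have := normc_ge0 z; lra.
Qed.

Lemma hardy_growth f p : conformal f -> 0 < p -> hardy_space p f -> growth_bound f p.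
Proof.
move=> cf p0 [_ fin_sup].
have [r0 [r02 r01 f0]] := conf_neq0_near_boundary cf.
have [H H1 harnackC] := conf_harnack R.
apply: (near_boundary_growth_bound cf (ltW p0) r01).
set S := ereal_sup _ in fin_sup.
have [s sE] : exists s : R, forall r, 0 < r < 1 -> (circle_integral p f r <= s%:E)%E.
  have le_S r : 0 < r < 1 -> (circle_integral p f r <= S)%E.
    by move=> hr; apply: ereal_sup_ubound; exists r => //=; rewrite in_itv.
  move: fin_sup le_S; case: S => [s _ h|//|_ h]; first by exists s.
  by exists 0 => r /h; rewrite leeNy_eq => /eqP ->; rewrite leNye.
exists (2 * s * H `^ p) => z rz z1.
have [t0 /andP[t0_ge t0_le] zE] := polar_form z.
set r := normc z in rz z1 zE *; set d := 1 - r.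
have d0 : 0 < d by rewrite /d; lra.
have d2 : d <= 1 / 2 by rewrite /d; lra.
have pi2 : 2 <= pi :> R by exact: pi_ge2.
(* An arc of length [d / 2] that begins or ends at [t0], whichever stays within [[0, 2 pi]]. *)
have [a [ab0 [ab1 ab]]] : exists a, 0 <= a /\ a + d / 2 <= 2 * pi /\
    forall t, a <= t <= a + d / 2 -> `|t - t0| <= d / 2.
  have [h|h] := leP t0 pi.
    exists t0; split => //; split; first by lra.
    by move=> t /andP[h1 h2]; rewrite ler_norml; lra.
  exists (t0 - d / 2); split; [by lra|split; first by lra].
  by move=> t /andP[h1 h2]; rewrite ler_norml; lra.
have H0 : 0 < H by lra.
set c := (normc (f z) / H) `^ p.
have lower t : a <= t <= a + d / 2 ->
    c <= normc (f (Complex (r * cos t) (r * sin t))) `^ p.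
  move=> /ab tt0; rewrite polarE.
  have rr : 0 <= r by exact: normc_ge0.
  have wz : normc (r%:C%C * cis t - z) <= (1 - normc z) / 2.
    rewrite {1}zE normc_polarB //; apply: le_trans tt0.
    apply: le_trans (chord_le t t0).
    by rewrite ler_piMl ?normc_ge0 // ltW.
  have [_ h] := harnackC f r0 z (r%:C%C * cis t) cf f0 rz z1 wz.
  apply: ge0_ler_powR; rewrite ?nnegrE ?normc_ge0 ?(ltW p0) //.
    by rewrite divr_ge0 ?normc_ge0 // ltW.
  by rewrite ler_pdivrMr // mulrC.
have hr : 0 < r < 1 by lra.
have : (\int[@lebesgue_measure R]_(t in `[a, (a + d / 2)%R]) c%:E <= s%:E)%E.
  apply: le_trans (sE r hr); apply: ge0_le_integral_any.
  - by move=> t _; rewrite lee_fin powR_ge0.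
  - by move=> t _; rewrite lee_fin powR_ge0.
  - move=> t /=; rewrite !in_itv /= => tS; rewrite lee_fin lower //; split => //.
    by move: tS => /andP[h1 h2]; apply/andP; split; lra.
have cc : cont_on a (a + d / 2) (fun=> c) by exact: cont_on_cst.
rewrite (integral_cint cc) cint_cst; last by rewrite lerDl divr_ge0 // ltW.
rewrite lee_fin addrAC subrr add0r /c.
rewrite powRM ?normc_ge0 ?invr_ge0 ?(ltW H0) // -powR_inv1 ?(ltW H0) //.
rewrite -powRrM mulN1r powRN => h.
have Hp : 0 < H `^ p by exact: powR_gt0.
rewrite mulrAC ler_pdivrMr // in h.
by move: h; rewrite -/r -/d; lra.
Qed.

Definition dyad n : R := 1 - (2^-1) ^+ n.

Lemma dyad_lt1 n : dyad n < 1.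
Proof. by rewrite /dyad ltrBlDr ltrDl exprn_gt0 // invr_gt0. Qed.

Lemma dyad_mono m n : (m <= n)%N -> dyad m <= dyad n.
Proof.
move=> mn; rewrite /dyad lerD2l lerN2 ler_wiXn2l ?invr_ge0 //.
by rewrite invf_le1 // ler1n.
Qed.

Lemma dyad_ge0 n : 0 <= dyad n.
Proof. by apply: le_trans (dyad_mono (leq0n n)); rewrite /dyad expr0 subrr. Qed.

Lemma between_dyads (r : R) : dyad 0 <= r < 1 -> exists n, dyad n <= r <= dyad n.+1.
Proof.
move=> /andP[r_ge r_lt].
have [N hN] : exists N, 1 / 2 ^+ N < 1 - r by apply: halving_lt; rewrite subr_gt0.
have ex : exists n, r <= dyad n.
  by exists N; move: hN; rewrite /dyad exprVn mul1r; lra.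
have [[|n] hn min_n] := ex_minnP ex.
  by exists 0%N; rewrite r_ge (le_trans hn) // dyad_mono.
exists n; rewrite hn andbT leNgt; apply/negP => rn.
by have := min_n n (ltW rn); rewrite ltnn.
Qed.

Section GrowthHardy.
Variables (f : R[i] -> R[i]) (r0 : R).
Hypothesis (conf_f : conformal f) (f0 : nonvanishing_beyond f r0).

Let modulus_continuous (r t : R) : 0 <= r < 1 ->
  {for t, continuous (fun t => normc (f (r%:C%C * cis t)))}.
Proof.
move=> /andP[r_ge r_lt]; apply: real_continuous => e e0.
have [|d d0 hd] := conf_ccont conf_f (z := r%:C%C * cis t) _ e0.
  by rewrite normc_polar.
exists d => // s st; set w := r%:C%C * cis s.
have /hd h : normc (w - r%:C%C * cis t) < d.
  rewrite normc_polarB //; apply: le_lt_trans st; apply: le_trans (chord_le s t).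
  by rewrite ler_piMl ?normc_ge0 // ltW.
apply: le_lt_trans h; rewrite ler_norml ler_normcB andbT.
by have := ler_normcB (f (r%:C%C * cis t)) (f w); rewrite (normcB (f w)); lra.
Qed.

Let power_continuous (q r t : R) : 0 <= r -> r0 <= r < 1 ->
  {for t, continuous (fun t => normc (f (r%:C%C * cis t)) `^ q)}.
Proof.
move=> r_ge /andP[r0r r_lt].
apply: (@continuous_comp _ _ _ (fun t => normc (f (r%:C%C * cis t))) (fun x => x `^ q)).
  by apply: modulus_continuous; rewrite r_ge.
have pos : 0 < normc (f (r%:C%C * cis t)).
  rewrite normc_gt0; apply: (f0 (z := r%:C%C * cis t)); rewrite normc_polar //.
  by rewrite subrr normc0 subr_gt0.
have [dx _] := is_derive1_powR q pos.
by apply: differentiable_continuous; exact/derivable1_diffP.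
Qed.

Hypothesis r02 : 1 / 2 <= r0.
Variables (lam p C0 : R).
Hypotheses (p0 : 0 < p) (plam : p < lam) (C00 : 0 < C0).
Hypothesis growth_f : forall z, normc z < 1 -> normc (f z) `^ lam * (1 - normc z) <= C0.

Let growth_level n z : normc z <= dyad n -> normc (f z) <= (C0 * 2 ^+ n) `^ lam^-1.
Proof.
move=> zn; have e0 : 0 < (2^-1 : R) ^+ n by rewrite exprn_gt0 // invr_gt0.
have z1 : normc z < 1 by move: zn; rewrite /dyad; lra.
have lam0 : 0 < lam by exact: lt_trans plam.
have -> : normc (f z) = (normc (f z) `^ lam) `^ lam^-1.
  by rewrite -powRrM mulfV ?gt_eqF // powRr1 // normc_ge0.
apply: ge0_ler_powR; rewrite ?nnegrE ?powR_ge0 ?invr_ge0 ?(ltW lam0) //.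
  by rewrite mulr_ge0 ?exprn_ge0 // ltW.
rewrite -[2 ^+ n]invrK -exprVn ler_pdivlMr //.
apply: le_trans (growth_f z1); apply: ler_wpM2l; first exact: powR_ge0.
by move: zn; rewrite /dyad; lra.
Qed.

(** The quantity [M ^ p / 2 ^ n], with the growth bound for [M] at radius [dyad n], is a multiple of
    [tau ^ (2 n)], so [tau] is the rate at which the L^2 norms of the increments decay. *)
Let tau : R := (2^-1) `^ ((1 - p / lam) / 2).

Let tau01 : 0 < tau < 1.
Proof.
have lam0 : 0 < lam by exact: lt_trans plam.
rewrite powR_gt0 ?invr_gt0 //=.
have e0 : 0 < (1 - p / lam) / 2.
  by rewrite divr_gt0 // subr_gt0 ltr_pdivrMr // mul1r.
apply: (@lt_le_trans _ _ (1 `^ ((1 - p / lam) / 2))); last by rewrite powR1.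
by apply: gt0_ltr_powR; rewrite ?nnegrE ?invr_ge0 //; lra.
Qed.

Let level_power n : ((C0 * 2 ^+ n) `^ lam^-1) `^ p / 2 ^+ n = C0 `^ (p / lam) * (tau ^+ n * tau ^+ n).
Proof.
have lam0 : 0 < lam by exact: lt_trans plam.
rewrite -powRrM mulrC powRM ?exprn_ge0 ?(ltW C00) // [lam^-1 * p]mulrC.
rewrite mulrCA; congr (_ * _); rewrite -exprMn.
have -> : tau * tau = 2^-1 `^ (1 - p / lam).
  rewrite /tau -powRD; first by rewrite -splitr.
  by rewrite -splitr subr_eq0 gt_eqF // ltr_pdivrMr // mul1r.
elim: n => [|n IH]; first by rewrite !expr0 powR1 invr1 mulr1.
rewrite !exprS -IH powRM ?exprn_ge0 //.
have -> : 2^-1 `^ (1 - p / lam) = 2^-1 * 2 `^ (p / lam).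
  have nz : (2^-1 : R) != 0 by rewrite invr_eq0.
  rewrite powRB; last by rewrite nz implybT.
  rewrite powRr1 ?invr_ge0 //; congr (_ * _).
  by rewrite -(powR_inv1 (ler0n R 2)) -powRrM mulN1r powRN invrK.
by rewrite invfM; ring.
Qed.

Let v n t := normc (f ((dyad n)%:C%C * cis t)) `^ (p / 2).

Let v_cont n a b : r0 <= dyad n -> cont_on a b (v n).
Proof. by move=> h t _; apply: power_continuous; [exact: dyad_ge0|rewrite h dyad_lt1]. Qed.

(** On an arc of length 1, [2 ^ n] equispaced points have spacing [1 - dyad n], the separation
    required by [level_sum]; its bound is uniform in the rotation of the points and so passes to the
    integral by [cint_riemann_le]. *)
Lemma level_increment : exists2 K : R, 0 < K & forall n a, r0 <= dyad n ->
  cint a (a + 1) (fun t => (v n.+1 t - v n t) * (v n.+1 t - v n t)) <=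
  K * (tau ^+ n * tau ^+ n).
Proof.
have [C C_gt0 hC] := level_sum p0.
exists (C * C0 `^ (p / lam)) => [|n a hn]; first by rewrite mulr_gt0 ?powR_gt0.
have e0 : 0 < (2^-1 : R) ^+ n by rewrite exprn_gt0 // invr_gt0.
rewrite -mulrA -level_power mulrA.
case En : (2 ^ n)%N => [|N]; first by move: (expn_gt0 2 n); rewrite En.
have N2 : 2 ^+ n = N.+1%:R :> R by rewrite -natrX En.
rewrite [X in _ / X]N2; apply: cint_riemann_le => [y|s].
  have hn1 : r0 <= dyad n.+1 by apply: le_trans hn _; exact: dyad_mono.
  apply: (@cont_onM R y y); last by rewrite lexx.
    by apply: cont_onB; exact: v_cont.
  by apply: cont_onB; exact: v_cont.
pose theta (j : nat) := a + s + j%:R / N.+1%:R.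
under eq_bigr => j _ do rewrite -expr2.
apply: (hC f r0 (dyad n) (dyad n.+1) N.+1 theta) => //.
- by rewrite hn dyad_lt1.
- by rewrite dyad_mono //= /dyad exprS; lra.
- move=> j k jN kN jk.
  have -> : theta j - theta k = (j%:R - k%:R) / N.+1%:R by rewrite /theta; ring.
  rewrite normrM normfV.
  rewrite [`|N.+1%:R|]ger0_norm // ler_pdivrMr ?ltr0n // mul1r.
  have -> : 1 - dyad n = 1 / N.+1%:R by rewrite /dyad -N2 -exprVn; ring.
  rewrite ler_pM2r ?invr_gt0 ?ltr0n // -[1]/(1%:R).
  wlog le_jk : j k jN kN jk / (j < k)%N.
    move=> W; have [lt|lt|//] := ltngtP j k; first exact: W.
    by rewrite distrC; apply: W => // /esym.
  rewrite distrC -natrB ?(ltnW le_jk) // ger0_norm // !ler_nat subn_gt0 le_jk /=.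
  by apply: leq_trans (leq_subr _ _) _; exact: ltnW.
- by move=> j _; apply: growth_level; rewrite normc_polar ?dyad_ge0.
Qed.

(** Adding [2 * K] absorbs the increments: [I m + 2 * K] grows at most by the factor [1 + tau ^+ m]
    at each level, and these factors have a bounded product. *)
Lemma level_integrals_bounded : exists C : R, forall n a, r0 <= dyad n ->
  cint a (a + 1) (fun t => v n t * v n t) <= C.
Proof.
have [K K0 hK] := level_increment.
have [n0 hn0] : exists n0, forall n, r0 <= dyad n -> (n0 <= n)%N /\ r0 <= dyad n0.
  have [ex|nex] := pselect (exists n, r0 <= dyad n); last first.
    by exists 0%N => n hn; case: nex; exists n.
  have [n0 hn0 min_n0] := ex_minnP ex.
  by exists n0 => n hn; split => //; exact: min_n0.
pose M := ((C0 * 2 ^+ n0) `^ lam^-1) `^ p.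
exists (expR (1 - tau)^-1 * (M + 2 * K)) => n a hn.
have [n0n {}hn0] := hn0 n hn.
have hm m : (n0 <= m)%N -> r0 <= dyad m by move=> /dyad_mono; exact: le_trans.
have v0 m t : 0 <= v m t by exact: powR_ge0.
have cv m b c : (n0 <= m)%N -> cont_on b c (v m) by move=> /hm; exact: v_cont.
pose I m := cint a (a + 1) (fun t => v m t * v m t).
have I0 m : 0 <= I m by apply: cint_ge0 => t; rewrite mulr_ge0.
have /andP[tau0 tau1] := tau01.
have rec m : (n0 <= m)%N -> 0 <= I m + 2 * K /\
    I m.+1 + 2 * K <= (1 + tau ^+ m) * (I m + 2 * K).
  move=> n0m; split; first by rewrite addr_ge0 // mulr_ge0 // ltW.
  set eta := tau ^+ m; have eta0 : 0 < eta by rewrite exprn_gt0.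
  have eta1 : eta <= 1 by rewrite exprn_ile1 // ltW.
  have n0m1 : (n0 <= m.+1)%N by exact: leqW.
  pose w t := v m.+1 t - v m t.
  have cw : cont_on a (a + 1) w by apply: cont_onB; apply: cv.
  have c1 : cont_on a (a + 1) (fun t => v m t * v m t) by apply: cont_onM; apply: cv.
  have c2 : cont_on a (a + 1) (fun t => w t * w t) by apply: cont_onM.
  have c3 : cont_on a (a + 1) (fun t => v m.+1 t * v m.+1 t) by apply: cont_onM; apply: cv.
  have z1 : cont_on a (a + 1) (fun t => (1 + eta) * (v m t * v m t)).
    by apply: cont_onM => //; exact: cont_on_cst.
  have z2 : cont_on a (a + 1) (fun t => (1 + eta^-1) * (w t * w t)).
    by apply: cont_onM => //; exact: cont_on_cst.
  (* Integrated form of [(x + y) ^ 2 <= (1 + eta) x ^ 2 + (1 + 1 / eta) y ^ 2]. With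
     [eta = tau ^+ m] the second term is still of order [eta], since the squared increments are of
     order [eta ^ 2]. *)
  have : I m.+1 <= (1 + eta) * I m + (1 + eta^-1) * cint a (a + 1) (fun t => w t * w t).
    rewrite -(cintZ _ c1) -(cintZ _ c2) -(cintD z1 z2); apply: cint_le => //.
      exact: cont_onD.
    move=> t _; have -> : v m.+1 t = v m t + w t by rewrite /w addrC subrK.
    move: (v m t) (w t) => x y.
    have -> : (1 + eta) * (x * x) + (1 + eta^-1) * (y * y) =
        (x + y) * (x + y) + (eta * x - y) ^+ 2 / eta.
      by field; rewrite gt_eqF.
    by rewrite lerDl divr_ge0 ?sqr_ge0 // ltW.
  have := hK m a (hm m n0m); rewrite -/eta -/(w _).
  set D := cint _ _ _ => hD.
  have : (1 + eta^-1) * D <= 2 * K * eta.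
    have e1 : 0 <= 1 + eta^-1 by rewrite addr_ge0 ?invr_ge0 // ltW.
    apply: (le_trans (ler_wpM2l e1 hD)).
    have -> : (1 + eta^-1) * (K * (eta * eta)) = K * eta * (eta + 1).
      by field; rewrite gt_eqF.
    have -> : 2 * K * eta = K * eta * 2 by ring.
    by rewrite ler_pM2l ?mulr_gt0 //; lra.
  have -> : (1 + eta) * (I m + 2 * K) = (1 + eta) * I m + 2 * K * eta + 2 * K by ring.
  by move=> hD2 hI; rewrite lerD2r (le_trans hI) // lerD2l.
have := almost_nonincreasing_bounded tau01 rec n0n.
have In0 : I n0 <= M.
  rewrite -[M]mulr1 -[X in _ * X](_ : a + 1 - a = 1); last by ring.
  rewrite -cint_cst ?lerDl //; apply: cint_le.
  - by apply: cont_onM; apply: cv.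
  - exact: cont_on_cst.
  move=> t _; rewrite /v -powRD; first rewrite -splitr.
    apply: ge0_ler_powR; rewrite ?nnegrE ?normc_ge0 ?powR_ge0 ?(ltW p0) //.
    by apply: growth_level; rewrite normc_polar ?dyad_ge0.
  by rewrite -splitr gt_eqF.
move=> h; apply: (@le_trans _ _ (I n + 2 * K)); first by rewrite lerDl mulr_ge0 // ltW.
by apply: (le_trans h); rewrite ler_wpM2l ?expR_ge0 // lerD2r.
Qed.

Lemma growth_hardy_aux : r0 < 1 ->
  exists B : R, forall r, 0 < r < 1 -> (circle_integral p f r <= B%:E)%E.
Proof.
move=> r01; have [C hC] := level_integrals_bounded.
have [H H1 harnackC] := conf_harnack R.
have [n0 hn0] : exists n0, r0 <= dyad n0.
  have [n0 h] : exists n, 1 / 2 ^+ n < 1 - r0 by apply: halving_lt; rewrite subr_gt0.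
  by exists n0; move: h; rewrite /dyad exprVn mul1r; lra.
pose M := ((C0 * 2 ^+ n0) `^ lam^-1) `^ p.
have M0 : 0 <= M by exact: powR_ge0.
have Hp0 : 0 <= H `^ p by exact: powR_ge0.
(* Eight arcs of length 1 cover the circle. *)
have pi8 : 2 * pi <= 8 :> R.
  by have := pihalf_lt2 R; lra.
exists (Num.max (M * 8) (H `^ p * (C * 8))) => r /andP[r_gt r_lt].
have int8 (phi : R -> R) : cont_on 0 8 phi -> (forall t, 0 <= phi t) ->
    (forall t, normc (f (r%:C%C * cis t)) `^ p <= phi t) ->
    (circle_integral p f r <= (cint 0 8 phi)%:E)%E.
  move=> cphi phi0 le_phi; rewrite -(integral_cint cphi).
  apply: ge0_le_integral_any => [t _|t _|t /=]; first by rewrite lee_fin powR_ge0.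
    by rewrite lee_fin.
  rewrite !in_itv /= => /andP[h1 h2]; split; last by rewrite lee_fin polarE.
  by rewrite h1 (le_trans h2).
have [rn|rn] := leP r (dyad n0).
  have := int8 (fun=> M) (@cont_on_cst _ _ _ _) (fun=> M0).
  rewrite cint_cst // subr0 => h; apply: (le_trans (h _)); last first.
    by rewrite lee_fin le_max lexx.
  move=> t; apply: ge0_ler_powR; rewrite ?nnegrE ?normc_ge0 ?powR_ge0 ?(ltW p0) //.
  by apply: growth_level; rewrite normc_polar ?dyad_ge0 // ltW.
have [|n /andP[h1 h2]] := between_dyads (r := r).
  by rewrite r_lt andbT (le_trans _ (ltW rn)) // dyad_mono.
have r0n : r0 <= dyad n.
  apply: (le_trans hn0); apply: dyad_mono; rewrite leqNgt; apply/negP => lt_n.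
  by have := le_trans h2 (dyad_mono lt_n); rewrite leNgt rn.
have cvv a b : cont_on a b (fun t => v n t * v n t) by apply: cont_onM; exact: v_cont.
(* Harnack's inequality carries the bound from the circle of radius [dyad n] to that of radius
   [r]. *)
have := int8 (fun t => H `^ p * (v n t * v n t)).
rewrite cintZ // => h; apply: (le_trans (h _ _ _)).
- by apply: cont_onM => //; exact: cont_on_cst.
- by move=> t; rewrite !mulr_ge0 // powR_ge0.
- move=> t; rewrite /v -powRD; last by rewrite -splitr gt_eqF.
  rewrite -splitr -powRM ?normc_ge0 //; last by lra.
  apply: ge0_ler_powR; rewrite ?nnegrE ?normc_ge0 ?mulr_ge0 ?normc_ge0 ?(ltW p0) //; first by lra.
  have [] // := harnackC f r0 ((dyad n)%:C%C * cis t) (r%:C%C * cis t) conf_f f0 _ _ _.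
  + by rewrite normc_polar ?dyad_ge0.
  + by rewrite normc_polar ?dyad_ge0 ?dyad_lt1.
  + rewrite normc_radialB normc_polar ?dyad_ge0 // ger0_norm ?subr_ge0 //.
    by move: h2; rewrite /dyad exprS; lra.
rewrite lee_fin le_max; apply/orP; right; apply: ler_wpM2l => //.
have sum_k k : cint 0 k%:R (fun t => v n t * v n t) <= C * k%:R.
  elim: k => [|k IH].
    by rewrite mulr0 /cint set_itv1 Rintegral_set1.
  rewrite (@cint_split _ 0 _ k%:R) //; last by rewrite ler0n ler_nat leqnSn.
  rewrite -natr1 mulrDr mulr1; apply: lerD => //.
  exact: hC.
exact: (sum_k 8%N).
Qed.

End GrowthHardy.

Lemma growth_hardy f lam p : conformal f -> 0 < p < lam -> growth_bound f lam ->
  hardy_space p f.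
Proof.
move=> cf /andP[p0 plam] [C hC]; split; first exact: cf.1.
have [r0 [r02 r01 f0]] := conf_neq0_near_boundary cf.
have C0 : 0 < `|C| + 1 by rewrite ltr_wpDl.
have hC' z : normc z < 1 -> normc (f z) `^ lam * (1 - normc z) <= `|C| + 1.
  by move=> /hC; have := ler_norm C; lra.
have [B hB] := growth_hardy_aux cf f0 r02 p0 plam C0 hC' r01.
apply: (@le_lt_trans _ _ B%:E); last exact: ltry.
by apply: ge_ereal_sup => _ [r /= + <-]; rewrite in_itv; exact: hB.
Qed.

End HardySpaces.

(** * Bergman spaces *)

Section BergmanSpaces.
Variable R : realType.
Implicit Types (f : R[i] -> R[i]) (p lam : R).
Local Notation mu2 := ((@lebesgue_measure R) \x (@lebesgue_measure R))%E.

Lemma radial_point (z : R[i]) (r : R) : 0 < r <= normc z ->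
  exists2 w, normc w = r & normc (z - w) = normc z - r.
Proof.
move=> /andP[r0 rz]; have nz : 0 < normc z by lra.
have E : z = (normc z)%:C%C * (z / (normc z)%:C%C).
  by rewrite mulrC divfK // -normc_gt0 normcR gtr0_norm.
have n1 : normc (z / (normc z)%:C%C) = 1.
  by rewrite normcM normcV normcR gtr0_norm // divff // gt_eqF.
exists (r%:C%C * (z / (normc z)%:C%C)).
  by rewrite normcM n1 mulr1 normcR gtr0_norm.
rewrite {1}E -mulrBl -rmorphB normcM n1 mulr1 normcR ger0_norm //.
by rewrite subr_ge0.
Qed.

Lemma dyadE n : 1 - dyad R n = (2 ^+ n)^-1.
Proof. by rewrite /dyad exprVn; ring. Qed.

Lemma dyad_half n : (1 - dyad R n) / 2 = 1 - dyad R n.+1.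
Proof. by rewrite !dyadE exprS invfM mulrC. Qed.

(** For [|z|] between [dyad n] and [dyad n.+1], the power [|f z| ^ lam] is at most
    [A ^ lam * 2 ^ (n + 1)] while [1 - |z| <= 2 ^ - n]. *)
Lemma dyadic_growth f lam (A b : R) n0 : conformal f -> 0 < lam -> 0 < A ->
  0 < b -> b `^ lam <= 2 ->
  (forall n z, (n0 <= n)%N -> normc z <= dyad R n -> normc (f z) <= A * b ^+ n) ->
  growth_bound f lam.
Proof.
move=> cf lam0 A0 b0 b2 hA.
apply: (near_boundary_growth_bound cf (ltW lam0) (dyad_lt1 R n0)).
exists (A `^ lam * 2) => z zn z1.
have [|n /andP[h1 h2]] := @between_dyads R (normc z).
  by rewrite z1 andbT (le_trans _ zn) // dyad_mono.
have [n0n|lt_n] := leqP n0 n.+1; last first.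
  have := le_trans h2 (dyad_mono R (ltnW lt_n)) => z_le.
  have [E|//] : normc z = dyad R n0 \/ False.
    by left; apply/eqP; rewrite eq_le zn z_le.
  exfalso; have : dyad R n.+1 < dyad R n0.
    rewrite /dyad ltrD2l ltrN2 ltr_iXn2l ?invr_gt0 //; lra.
  by rewrite -E ltNge h2.
have fz := hA n.+1 z n0n h2.
have P : normc (f z) `^ lam <= A `^ lam * 2 ^+ n.+1.
  apply: (@le_trans _ _ ((A * b ^+ n.+1) `^ lam)).
    apply: ge0_ler_powR; rewrite ?nnegrE ?normc_ge0 ?(ltW lam0) //.
    by rewrite mulr_ge0 ?exprn_ge0 // ltW.
  rewrite powRM ?exprn_ge0 ?(ltW A0) ?(ltW b0) // ler_wpM2l ?powR_ge0 //.
  elim: (n.+1) => [|k IH]; first by rewrite !expr0 powR1.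
  rewrite !exprS powRM ?exprn_ge0 ?(ltW b0) //.
  by apply: ler_pM; rewrite ?powR_ge0.
have Q : 1 - normc z <= (2 ^+ n)^-1 by rewrite -dyadE; lra.
apply: (le_trans (ler_pM (powR_ge0 _ _) _ P Q)); first by rewrite subr_ge0 ltW.
rewrite exprS -mulrA -mulrA divff ?mulr1.
  by [].
by rewrite expf_neq0.
Qed.

(** Harnack's inequality lets [|f|] grow at most by a factor [H] per dyadic step, and
    [lam = ln 2 / ln H] makes [H ^ lam = 2]. The positive exponent is needed for the comparison with
    the lower limits. *)
Lemma conf_growth_exists f : conformal f ->
  exists2 lam : R, 0 < lam & growth_bound f lam.
Proof.
move=> cf; have [r0 [r02 r01 f0]] := conf_neq0_near_boundary cf.
have [H1 H11 harnackC1] := conf_harnack R.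
(* Adding 1 makes [ln H] positive even if Harnack's constant is 1. *)
pose H := H1 + 1; have H2 : 2 <= H by rewrite /H; lra.
have H0 : 0 < H by lra.
have lnH : 0 < ln H by rewrite ln_gt0 //; lra.
have [n0 h] : exists n, 1 / 2 ^+ n < 1 - r0 by apply: halving_lt; rewrite subr_gt0.
have hn0 : r0 <= dyad R n0 by move: h; rewrite mul1r -dyadE; lra.
have [B B0 hB] := conf_bounded cf (dyad_lt1 R n0).
exists (ln 2 / ln H); first by rewrite divr_gt0 // ln_gt0 // ltr1n.
apply: (@dyadic_growth f _ B H n0) => //.
- by rewrite divr_gt0 // ln_gt0 // ltr1n.
- rewrite /powR gt_eqF // divfK ?gt_eqF // lnK ?lexx // posrE //.
move=> n z /subnK <-; move: (n - n0)%N => {n} k; elim: k z => [|k IH] z.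
  rewrite add0n => /hB h1; apply: (le_trans h1).
  by rewrite ler_peMr ?(ltW B0) // exprn_ege1 //; lra.
rewrite addSn => zk; have [zk'|zk'] := leP (normc z) (dyad R (k + n0)).
  apply: (le_trans (IH z zk')).
  by rewrite exprS mulrCA ler_peMl ?mulr_ge0 ?exprn_ge0 ?(ltW B0) ?(ltW H0) //; lra.
have r0k : r0 <= dyad R (k + n0).
  by apply: (le_trans hn0); apply: dyad_mono; exact: leq_addl.
have [|w nw zw] := @radial_point z (dyad R (k + n0)).
  by rewrite (ltW zk') andbT; lra.
have [|||h1 _] := harnackC1 f r0 w z cf f0.
- by rewrite nw.
- by rewrite nw dyad_lt1.
- by rewrite nw zw; have := dyad_half (k + n0); lra.
have := IH w; rewrite nw lexx => /(_ isT) fw.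
apply: (le_trans h1); rewrite exprS mulrCA.
by apply: ler_pM; rewrite ?normc_ge0 // /H; lra.
Qed.

Lemma powRV (x r : R) : 0 <= x -> x^-1 `^ r = (x `^ r)^-1.
Proof. by move=> x0; rewrite -powR_inv1 // -powRrM mulN1r powRN. Qed.

(** The exponent may be negative, where the power decreases; the factor [4 ^ (- |alpha|)] covers
    both signs. *)
Lemma powR_comparable (alpha d x : R) : 0 < d -> d / 4 <= x <= 4 * d ->
  4 `^ (- `|alpha|) * d `^ alpha <= x `^ alpha.
Proof.
move=> d0 /andP[x1 x2]; have x0 : 0 < x by lra.
have [a0|a0] := leP 0 alpha.
  rewrite (ger0_norm a0) powRN mulrC -powRV // -powRM ?invr_ge0 ?(ltW d0) //.
  by apply: ge0_ler_powR; rewrite ?nnegrE ?divr_ge0 ?(ltW d0) ?(ltW x0).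
have na : 0 <= - alpha by rewrite oppr_ge0 ltW.
have E (y : R) : y `^ alpha = (y `^ (- alpha))^-1 by rewrite powRN invrK.
rewrite (ltr0_norm a0) opprK -powRM ?(ltW d0) // (E x) (E (4 * d)).
rewrite lef_pV2 ?posrE ?powR_gt0 ?mulr_gt0 //.
by apply: ge0_ler_powR; rewrite ?nnegrE ?mulr_ge0 ?(ltW d0) ?(ltW x0).
Qed.

Lemma bergman_growth f p alpha : conformal f -> 0 < p -> -1 < alpha ->
  bergman_space p alpha f -> growth_bound f (p / (alpha + 2)).
Proof.
move=> cf p0 alpha1 [_ fin_int].
have a2 : 0 < alpha + 2 by lra.
have [r0 [r02 r01 f0]] := conf_neq0_near_boundary cf.
have [H H1 harnackC] := conf_harnack R; have H0 : 0 < H by lra.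
apply: (near_boundary_growth_bound cf _ r01); first by rewrite divr_ge0 // ltW.
set I := (X in (X < +oo)%E) in fin_int.
have [S leS] : exists S : R, (I <= S%:E)%E.
  move: fin_int; case: (I) => [S _|//|_]; first by exists S.
  by exists 0; rewrite leNye.
pose K : R := 4 `^ (- `|alpha|); have K0 : 0 < K by exact: powR_gt0.
exists ((4 * S * H `^ p / K) `^ (alpha + 2)^-1) => z rz z1.
set d := 1 - normc z; have d0 : 0 < d by rewrite subr_gt0.
have d2 : d <= 1 / 2 by rewrite /d; lra.
have d4 : 0 <= d / 4 by rewrite divr_ge0 // ltW.
(* Lower bound of the integrand on the square of half-side [d / 4] about [z]; its area [d ^ 2 / 4]
   turns the power [alpha] of [d] into [alpha + 2]. *)
pose c := (normc (f z) / H) `^ p * (K * d `^ alpha).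
have c_ge0 : 0 <= c by rewrite !mulr_ge0 ?powR_ge0.
have lower w : square z (d / 4) w -> normc (complex_of_pair w) < 1 /\
    c <= normc (f (complex_of_pair w)) `^ p * (1 - normc (complex_of_pair w) ^+ 2) `^ alpha.
  move=> /square_normc; set u := complex_of_pair w => uz.
  have uz2 : normc (u - z) <= (1 - normc z) / 2 by rewrite -/d; lra.
  have nu1 : normc u <= normc z + d / 2.
    by have := normc_triangle z u 0; rewrite !subr0 -/d; lra.
  have nu2 : normc z - d / 2 <= normc u.
    by have := normc_triangle u z 0; rewrite !subr0 (normcB z); lra.
  have u1 : normc u < 1 by move: nu1; rewrite /d; lra.
  split => //; have [_ h] := harnackC f r0 z u cf f0 rz z1 uz2.
  apply: ler_pM; rewrite ?powR_ge0 ?mulr_ge0 ?powR_ge0 //.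
    apply: ge0_ler_powR; rewrite ?nnegrE ?normc_ge0 ?(ltW p0) //.
      by rewrite divr_ge0 ?normc_ge0 // ltW.
    by rewrite ler_pdivrMr // mulrC.
  apply: powR_comparable => //.
  have -> : 1 - normc u ^+ 2 = (1 - normc u) * (1 + normc u) by ring.
  have := normc_ge0 u; move: nu1 nu2 u1; rewrite /d; move: (normc u) (normc z) => x y.
  by move=> h1 h2 h3 h4; apply/andP; split; nra.
have : (\int[mu2]_(w in square z (d / 4)) c%:E <= S%:E)%E.
  apply: le_trans leS; apply: ge0_le_integral_any.
  - by move=> w _; rewrite lee_fin.
  - by move=> w _; rewrite lee_fin mulr_ge0 ?powR_ge0.
  - by move=> w /lower[h1 h2]; split => //; rewrite lee_fin.
rewrite integral_cst; last exact: measurable_square.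
rewrite [X in (_ * X)%E](measure_square z d4) -EFinM lee_fin /c => h.
have Hp : 0 < H `^ p by exact: powR_gt0.
have F : normc (f z) `^ p * d `^ (alpha + 2) <= 4 * S * H `^ p / K.
  rewrite ler_pdivlMr // -ler_pdivrMr //.
  have -> : d `^ (alpha + 2) = d `^ alpha * d ^+ 2.
    by rewrite powRD ?(gt_eqF a2) // powR_mulrn // ltW.
  have E : (normc (f z) / H) `^ p = normc (f z) `^ p / H `^ p.
    by rewrite powRM ?normc_ge0 ?invr_ge0 ?(ltW H0) // powRV // ltW.
  rewrite E in h; move: h.
  have -> : normc (f z) `^ p / H `^ p * (K * d `^ alpha) * (2 * (d / 4)) ^+ 2 =
      normc (f z) `^ p * (d `^ alpha * d ^+ 2) * K / H `^ p / 4.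
    by field; rewrite gt_eqF.
  by move=> h4; rewrite ler_pdivrMr // [leRHS]mulrC in h4.
have G : normc (f z) `^ (p / (alpha + 2)) * d =
    (normc (f z) `^ p * d `^ (alpha + 2)) `^ (alpha + 2)^-1.
  rewrite powRM ?powR_ge0 // -!powRrM mulfV ?gt_eqF // powRr1 //; exact: ltW.
rewrite G; apply: ge0_ler_powR; rewrite ?nnegrE ?invr_ge0 ?(ltW a2) //.
  by rewrite mulr_ge0 ?powR_ge0.
by apply: le_trans F; rewrite mulr_ge0 ?powR_ge0.
Qed.

Lemma growth_bergman f lam alpha : conformal f -> 0 < lam -> 0 < alpha ->
  growth_bound f lam -> bergman_space (lam * alpha) alpha f.
Proof.
move=> cf lam0 a0 [C hC]; split; first exact: cf.1.
have C0 : 0 <= C.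
  apply: le_trans (hC 0 _); last by rewrite normc0.
  by rewrite mulr_ge0 ?powR_ge0 // normc0 subr0.
(* The integrand is the power [alpha] of [|f| ^ lam (1 - |z| ^ 2)], and
   [1 - |z| ^ 2 <= 2 (1 - |z|)]. *)
pose K := (2 * C) `^ alpha.
apply: (@le_lt_trans _ _ (\int[mu2]_(w in square 0%R 1) K%:E)%E).
  apply: ge0_le_integral_any => [w _|w _|w /= w1].
  - by rewrite lee_fin mulr_ge0 ?powR_ge0.
  - by rewrite lee_fin powR_ge0.
  have w1' : normc (complex_of_pair w) < 1 by exact: w1.
  split; first by apply: normc_square; rewrite subr0 ltW.
  rewrite lee_fin powRrM -powRM ?powR_ge0 //; last first.
    by rewrite subr_ge0 exprn_ile1 ?normc_ge0 // ltW.
  have := hC _ w1'; have := normc_ge0 (complex_of_pair w).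
  set x := normc (complex_of_pair w) in w1' *.
  have := powR_ge0 (normc (f (complex_of_pair w))) lam; set y := _ `^ lam.
  move=> y0 x0 hy; apply: ge0_ler_powR; rewrite ?nnegrE ?(ltW a0) //.
  - by rewrite mulr_ge0 // subr_ge0 exprn_ile1 // ltW.
  - by rewrite mulr_ge0.
  have -> : y * (1 - x ^+ 2) = (y * (1 - x)) * (1 + x) by ring.
  rewrite mulrC; apply: ler_pM => //; [lra| |lra].
  by rewrite mulr_ge0 // subr_ge0 ltW.
rewrite integral_cst; last exact: measurable_square.
by rewrite [X in (_ * X)%E](measure_square 0 (ler01 : 0 <= 1 :> R)) -EFinM ltry.
Qed.

End BergmanSpaces.

(** * Area of the image *)

Section ImageArea.
Variable R : realType.
Implicit Types (f : R[i] -> R[i]) (p lam r : R).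
Local Notation mu2 := ((@lebesgue_measure R) \x (@lebesgue_measure R))%E.

(** An open set is the union of the countably many rational squares inside it. *)
Lemma measurable_open_plane (U : set R[i]) :
  (forall w, U w -> exists2 e : R, 0 < e & forall v, normc (v - w) < e -> U v) ->
  measurable (@complex_of_pair R @^-1` U).
Proof.
move=> oU; pose V := @complex_of_pair R @^-1` U.
pose S (i : rat * rat * rat) : set (R * R) :=
  square (Complex (ratr i.1.1) (ratr i.1.2)) (ratr i.2).
pose F i := if pselect (S i `<=` V) then S i else set0.
have -> : @complex_of_pair R @^-1` U = \bigcup_i F i.
  apply/seteqP; split => w; last first.
    by case=> i _; rewrite /F; case: pselect => //; apply.
  move=> /oU[e e0 he].
  have [q] : exists q : rat, ratr q \in `](0 : R), e / 4[.
    by apply: rat_in_itvoo; rewrite divr_gt0.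
  rewrite in_itv /= => /andP[q0 qe].
  have near (x : R) : exists a : rat, `|x - ratr a| <= ratr q.
    have [a] : exists a : rat, ratr a \in `]x - ratr q, x + ratr q[.
      by apply: rat_in_itvoo; lra.
    rewrite in_itv /= => /andP[h1 h2]; exists a.
    by rewrite ler_norml; lra.
  have [[a ha] [b hb]] := (near w.1, near w.2).
  have Sw : S (a, b, q) w by apply/squareP.
  exists (a, b, q) => //; rewrite /F; case: pselect => // -[] v Sv.
  apply: he; have := square_normc Sv; have := square_normc Sw.
  set c := Complex _ _ => h1 h2.
  have := normc_triangle c (complex_of_pair v) (complex_of_pair w).
  by move: h1 h2; rewrite (normcB c) /=; lra.
apply: countable_bigcupT_measurable => [|i]; first exact: countableP.
by rewrite /F; case: pselect => ?; [exact: measurable_square|exact: measurable0].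
Qed.

Lemma measurable_image f r : conformal f -> r <= 1 ->
  measurable (@complex_of_pair R @^-1` (f @` disk r)).
Proof.
move=> cf r1; apply: measurable_open_plane => _ [z zr <-].
have zr' : normc z < r by exact: zr.
have zd : normc z + (r - normc z) <= 1 by lra.
have [|||e e0 he] := @cinj_open R f z (r - normc z).
- by rewrite subr_gt0.
- exact: conf_hol_at.
- exact: conf_inj_at.
- exists e => // v /he[w wz <-]; exists w => //.
  by rewrite /disk /=; have := normc_triangle z w 0; rewrite !subr0; lra.
Qed.

Lemma area_le f r M : conformal f -> r <= 1 -> 0 <= M ->
  (forall z, normc z < r -> normc (f z) <= M) ->
  (area (f @` disk r) <= ((2 * M) ^+ 2)%:E)%E.
Proof.
move=> cf r1 M0 hM; rewrite -(measure_square 0 M0); apply: le_measure.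
- by rewrite inE; exact: measurable_image.
- by rewrite inE; exact: measurable_square.
- by move=> w [z /hM zM fz]; apply: normc_square; rewrite subr0 -fz.
Qed.

Lemma area_fin f r : conformal f -> r < 1 -> area (f @` disk r) = (image_area f r)%:E.
Proof.
move=> cf r1; have [B B0 hB] := conf_bounded cf r1.
rewrite /image_area fineK // ge0_fin_numE; last exact: measure_ge0.
apply: (@le_lt_trans _ _ ((2 * B) ^+ 2)%:E); last exact: ltry.
by apply: area_le => //; [exact: ltW|exact: ltW|move=> z /ltW/hB].
Qed.

Lemma image_area_ge0 f r : 0 <= image_area f r.
Proof. by rewrite fine_ge0 // measure_ge0. Qed.

Lemma image_area_le f r M : conformal f -> r < 1 -> 0 <= M ->
  (forall z, normc z < r -> normc (f z) <= M) -> image_area f r <= (2 * M) ^+ 2.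
Proof.
by move=> cf r1 M0 hM; rewrite -lee_fin -area_fin // area_le // ltW.
Qed.

(** By Koebe's theorem the image contains the disk of radius [e * |l| / 512] about [f z], hence the
    square of half-side [e * |l| / 2048], whose points are within [e * |l| / 1024] of [f z]. *)
Lemma image_area_deriv f r : conformal f -> r < 1 -> forall z (e : R) l,
  0 < e -> normc z + e <= r -> cdiff f z l ->
  (e * normc l / (2 * 1024)) ^+ 2 <= image_area f r.
Proof.
move=> cf r1 z e l e0 ze dl.
have [s [s0 sE E]] : exists s : R, [/\ 0 <= s, 2 * s < e * normc l / 512 \/ s = 0 &
    e * normc l / (2 * 1024) = s].
  exists (e * normc l / (2 * 1024)); have := normc_ge0 l.
  rewrite le_eqVlt => /predU1P[<-|l0].
    by rewrite mulr0 mul0r; split => //; right.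
  by have := mulr_gt0 e0 l0; split; [lra|left; lra|].
have [sE'|s00] := sE; last by rewrite E s00 expr0n image_area_ge0.
have /ltW s_le : s < e * normc l / 512 by lra.
rewrite E; apply: (@le_trans _ _ ((2 * s) ^+ 2)).
  by rewrite ler_pXn2r ?nnegrE ?mulr_ge0 //; lra.
rewrite -lee_fin -(measure_square (f z) s0) -area_fin //; apply: le_measure.
- by rewrite inE; exact: measurable_square.
- by rewrite inE; apply: measurable_image => //; exact: ltW.
move=> w /square_normc hw.
have ze1 : normc z + e <= 1 by lra.
have [|w' w'z fw'] := koebe_cover e0 (conf_hol_at cf ze1) (conf_inj_at cf ze1) dl
    (v := complex_of_pair w).
  by apply: le_lt_trans hw _.
exists w' => //; rewrite /disk /=.
by have := normc_triangle z w' 0; rewrite !subr0; lra.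
Qed.

Definition eventually_growth (g : R -> R) lam :=
  exists C r1 : R, r1 < 1 /\ forall r, r1 < r < 1 -> g r `^ lam * (1 - r) <= C.

Lemma growth_image_area f lam : conformal f -> 0 < lam ->
  growth_bound f (2 * lam) -> eventually_growth (image_area f) lam.
Proof.
move=> cf lam0 [C hC].
have C0 : 0 <= C.
  apply: le_trans (hC 0 _); last by rewrite normc0.
  by rewrite mulr_ge0 ?powR_ge0 // normc0 subr0.
have l20 : 0 < 2 * lam by rewrite mulr_gt0.
exists (4 `^ lam * C), 0; split => // r /andP[r0 r1].
have d0 : 0 < 1 - r by rewrite subr_gt0.
pose M := (C / (1 - r)) `^ (2 * lam)^-1.
have M0 : 0 <= M by exact: powR_ge0.
have hM z : normc z < r -> normc (f z) <= M.
  move=> zr; have -> : normc (f z) = (normc (f z) `^ (2 * lam)) `^ (2 * lam)^-1.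
    by rewrite -powRrM mulfV ?gt_eqF // powRr1 // normc_ge0.
  apply: ge0_ler_powR; rewrite ?nnegrE ?powR_ge0 ?invr_ge0 ?(ltW l20) //.
    by rewrite divr_ge0 // ltW.
  rewrite ler_pdivlMr //; apply: le_trans (hC z (lt_trans zr r1)).
  by apply: ler_wpM2l; [exact: powR_ge0|lra].
have M2 : ((2 * M) ^+ 2) `^ lam = 4 `^ lam * (C / (1 - r)).
  have -> : (2 * M) ^+ 2 = 4 * M `^ 2.
    by rewrite powR_mulrn // exprMn; congr (_ * _); ring.
  rewrite powRM ?powR_ge0 // /M -!powRrM mulVf ?gt_eqF // powRr1 //.
  by rewrite divr_ge0 // ltW.
rewrite -ler_pdivlMr // -mulrA -M2.
apply: ge0_ler_powR; rewrite ?nnegrE ?image_area_ge0 ?sqr_ge0 ?(ltW lam0) //.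
exact: image_area_le.
Qed.

(* Along the dyadic radii the increments of f are at most a multiple of the
   square root of the area, whence a geometric sum. *)
Lemma image_area_growth f lam : conformal f -> 0 < lam ->
  eventually_growth (image_area f) lam -> growth_bound f (2 * lam).
Proof.
move=> cf lam0 [C [r1 [r11 hC]]].
have [Cg Cg0 growthC] := growth R.
have l20 : 0 < 2 * lam by rewrite mulr_gt0.
have [n0 h0] : exists n, 1 / 2 ^+ n < Num.min (1 - r1) 1.
  by apply: halving_lt; rewrite lt_min subr_gt0 r11 ltr01.
move: h0; rewrite lt_min mul1r -dyadE => /andP[hn0 hn0'].
have [B B0 hB] := conf_bounded cf (dyad_lt1 R n0).
(* By hypothesis the square root of the area at radius [dyad n] is at most a multiple of [b ^ n];
   moreover [b ^ (2 lam) = 2], as [dyadic_growth] requires. *)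
pose b : R := 2 `^ (2 * lam)^-1.
have b1 : 1 < b.
  rewrite /b -[X in X < _](_ : 1 `^ (2 * lam)^-1 = 1); last by rewrite powR1.
  by apply: gt0_ltr_powR; rewrite ?invr_gt0 ?nnegrE // ltr1n.
have b0 : 0 < b by lra.
have C1 : 0 < `|C| + 1 by rewrite ltr_wpDl.
pose K : R := (`|C| + 1) `^ (2 * lam)^-1.
have K0 : 0 < K by exact: powR_gt0.
have sqrt_area n : (n0 <= n)%N ->
    Num.sqrt (image_area f (dyad R n.+1)) <= K * b ^+ n.+1.
  move=> n0n; have dn : dyad R n0 <= dyad R n.+1 by apply: dyad_mono; exact: leqW.
  have r1n : r1 < dyad R n.+1 < 1 by rewrite dyad_lt1 andbT; lra.
  have := hC _ r1n; rewrite dyadE => h.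
  have {}h : image_area f (dyad R n.+1) `^ lam <= (`|C| + 1) * 2 ^+ n.+1.
    rewrite -ler_pdivrMr ?exprn_gt0 //; apply: le_trans h _.
    by have := ler_norm C; lra.
  have -> : Num.sqrt (image_area f (dyad R n.+1)) =
      (image_area f (dyad R n.+1) `^ lam) `^ (2 * lam)^-1.
    rewrite -powRrM -powR12_sqrt ?image_area_ge0 //; congr (_ `^ _).
    by field; rewrite gt_eqF.
  have -> : K * b ^+ n.+1 = ((`|C| + 1) * 2 ^+ n.+1) `^ (2 * lam)^-1.
    rewrite powRM ?exprn_ge0 ?(ltW C1) //; congr (_ * _).
    elim: (n.+1) => [|k IH]; first by rewrite !expr0 powR1.
    by rewrite !exprS powRM ?exprn_ge0 // IH.
  by apply: ge0_ler_powR; rewrite ?nnegrE ?powR_ge0 ?mulr_ge0 ?exprn_ge0 ?invr_ge0 ?(ltW l20) ?(ltW C1).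
have [L L0 step] : exists2 L : R, 0 < L & forall n w z, (n0 <= n)%N ->
    normc w = dyad R n -> normc (z - w) <= (1 - dyad R n) / 2 ->
    normc (f z - f w) <= L * b ^+ n.+1.
  have [N [N0 NE]] : exists N : R, 0 < N /\ N = 2 * 1024.
    by exists (2 * 1024); split; [apply: mulr_gt0; rewrite ltr0n|reflexivity].
  exists (Cg * (2 * N * K)) => [|n w z n0n nw zw].
    by rewrite !mulr_gt0.
  have d0 : 0 < 1 - dyad R n by rewrite subr_gt0 dyad_lt1.
  have w1 : normc w < 1 by rewrite nw dyad_lt1.
  have [l dl] := conf_cdiff cf w1.
  have wd : normc w + (1 - dyad R n) <= 1 by rewrite nw; lra.
  have g := growthC f w z l _ d0 (conf_hol_at cf wd) (conf_inj_at cf wd) dl zw.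
  apply: (le_trans g); rewrite -!mulrA ler_pM2l //.
  (* The disk of this radius about [w] just reaches the circle of radius [dyad R n.+1], where the
     area is controlled. *)
  have e0 : 0 < (1 - dyad R n) / 2 by rewrite divr_gt0.
  have we : normc w + (1 - dyad R n) / 2 <= dyad R n.+1.
    by rewrite nw; have := dyad_half R n; lra.
  have := image_area_deriv cf (dyad_lt1 R n.+1) e0 we dl; rewrite -NE => A.
  have x0 : 0 <= (1 - dyad R n) / 2 * normc l / N.
    by rewrite divr_ge0 ?mulr_ge0 ?normc_ge0 // ltW.
  have : (1 - dyad R n) / 2 * normc l / N <= K * b ^+ n.+1.
    apply: le_trans (sqrt_area n n0n).
    by rewrite -(ger0_norm x0) -sqrtr_sqr ler_wsqrtr.
  by rewrite ler_pdivrMr //; lra.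
(* Chosen so that [L * b + A <= A * b], which reproduces the bound [A * b ^+ n] from one level to
   the next. *)
pose A := Num.max B (L * b / (b - 1)).
have A0 : 0 < A by rewrite lt_max B0.
have AL : L * b <= A * (b - 1).
  by rewrite -ler_pdivrMr ?subr_gt0 // le_max lexx orbT.
have AB : B <= A by rewrite le_max lexx.
have hA n z : (n0 <= n)%N -> normc z <= dyad R n -> normc (f z) <= A * b ^+ n.
  move=> /subnK <-; move: (n - n0)%N => {n} k; elim: k z => [|k IH] z.
    rewrite add0n => /hB h1; apply: (le_trans h1); apply: (le_trans AB).
    by rewrite ler_peMr ?(ltW A0) // exprn_ege1 // ltW.
  rewrite addSn => zk; have [zk'|zk'] := leP (normc z) (dyad R (k + n0)).
    apply: (le_trans (IH z zk')).
    rewrite exprS mulrCA ler_peMl ?(ltW b1) //.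
    by rewrite mulr_ge0 ?exprn_ge0 ?(ltW A0) ?(ltW b0).
  have pos : 0 < dyad R (k + n0).
    have := dyad_mono R (leq_addl k n0); lra.
  have [|w nw zw] := @radial_point R z (dyad R (k + n0)).
    by rewrite pos ltW.
  have n0k : (n0 <= k + n0)%N by exact: leq_addl.
  have := step (k + n0)%N w z n0k nw.
  rewrite zw => /(_ _) h.
  have {}h : normc (f z - f w) <= L * b ^+ (k + n0).+1.
    by apply: h; have := dyad_half R (k + n0); lra.
  have fw : normc (f w) <= A * b ^+ (k + n0) by apply: IH; rewrite nw.
  have fz : normc (f z) <= normc (f z - f w) + normc (f w).
    by have := ler_normcB (f z) (f w); lra.
  apply: (le_trans fz); apply: (le_trans (lerD h fw)).
  rewrite exprS mulrA -mulrDl [A * (b * _)]mulrA ler_wpM2r ?exprn_ge0 ?(ltW b0) //.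
  by move: AL; rewrite mulrBr mulr1; lra.
apply: (@dyadic_growth R f _ A b n0) => //.
by rewrite /b -powRrM mulVf ?gt_eqF // powRr1.
Qed.

End ImageArea.

(** * Growth exponents *)

Section GrowthExponents.
Variable R : realType.
Implicit Types (g : R -> R) (l t r : R).

Lemma ereal_sup_le_approx (A : set R) (y : \bar R) :
  (forall a e, A a -> 0 < e -> (a%:E <= y + e%:E)%E) ->
  (ereal_sup [set a%:E | a in A] <= y)%E.
Proof.
move=> H; apply: ge_ereal_sup => _ [a Aa <-].
by apply/lee_addgt0Pr => e; exact: H.
Qed.

Lemma near_one_leftP (P : set R) : (1^'- P) <->
  exists2 r1 : R, r1 < 1 & forall r, r1 < r < 1 -> P r.
Proof.
rewrite /at_left; split.
  rewrite /within /= => /nbhs_ballP[d /= d0 hd]; exists (1 - d); first by rewrite gtrBl.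
  move=> r /andP[h1 h2]; apply: (hd r) => //.
  by rewrite /ball /= ger0_norm ?subr_ge0 ?ltW //; lra.
move=> [r1 r11 hP]; apply/nbhs_ballP; exists (1 - r1) => /=; first by rewrite subr_gt0.
move=> r; rewrite /ball /= => h r1'; apply: hP; rewrite r1' andbT.
by move: h; rewrite ger0_norm ?subr_ge0 ?ltW //; lra.
Qed.

Lemma cvg_one_left0P (h : R -> R) : h r @[r --> 1^'-] --> 0 <->
  forall e, 0 < e -> exists2 r1 : R, r1 < 1 & forall r, r1 < r < 1 -> `|h r| < e.
Proof.
split=> [/cvgrPdist_lt hcvg e /hcvg /near_one_leftP[r1 r11 h1]|H].
  by exists r1 => // r /h1; rewrite sub0r normrN.
apply/cvgrPdist_lt => e /H[r1 r11 h1]; apply/near_one_leftP; exists r1 => // r /h1.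
by rewrite sub0r normrN.
Qed.

Definition limit_exponents g : set R :=
  [set l | 0 < l /\ (1 - r) * g r `^ l @[r --> 1^'-] --> 0].

Definition bound_exponents g : set R := [set l | 0 < l /\ eventually_growth g l].

Definition eventually_ge0 g := exists2 r1 : R, r1 < 1 & forall r, r1 < r < 1 -> 0 <= g r.

Lemma limit_bound_exponents g : limit_exponents g `<=` bound_exponents g.
Proof.
move=> l [l0 /cvg_one_left0P /(_ _ ltr01)[r1 r11 h1]]; split => //.
exists 1, r1; split => // r /h1 h; rewrite mulrC.
by apply: le_trans (ltW h); exact: ler_norm.
Qed.

(** Raising the bound on [g r ^ l] to the power [t / l] gives [(1 - r) * g r ^ t <= K * (1 - r) ^ (1
    - t / l)], which tends to 0. *)
Lemma bound_limit_exponents g l t : eventually_ge0 g -> bound_exponents g l ->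
  0 < t < l -> limit_exponents g t.
Proof.
move=> [r0 r01 g0] [l0 [C [r1 [r11 hC]]]] /andP[t0 tl]; split => //.
apply/cvg_one_left0P => e e0.
pose th := t / l; have th0 : 0 < th by rewrite divr_gt0.
have th1 : 0 < 1 - th by rewrite subr_gt0 ltr_pdivrMr // mul1r.
have C1 : 0 < `|C| + 1 by rewrite ltr_wpDl.
pose K := (`|C| + 1) `^ th; have K0 : 0 < K by exact: powR_gt0.
(* The solution of [K * d ^ (1 - th) = e]. *)
pose d := (e / K) `^ (1 - th)^-1; have d0 : 0 < d by rewrite powR_gt0 // divr_gt0.
exists (Num.max (Num.max r0 r1) (1 - d)).
  by rewrite !gt_max r01 r11 gtrBl.
move=> r; rewrite !gt_max => /andP[/andP[/andP[r0r r1r] rd] r_lt1].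
have x0 : 0 < 1 - r by rewrite subr_gt0.
have gr0 : 0 <= g r by apply: g0; rewrite r0r.
rewrite ger0_norm; last by rewrite mulr_ge0 ?powR_ge0 // ltW.
have h1 : g r `^ t <= K * (1 - r) `^ (- th).
  have -> : g r `^ t = (g r `^ l) `^ th.
    by rewrite -powRrM /th mulrC divfK // gt_eqF.
  rewrite powRN -powRV ?(ltW x0) // -powRM ?invr_ge0 ?(ltW x0) ?(ltW C1) //.
  apply: ge0_ler_powR; rewrite ?(ltW th0) ?nnegrE ?powR_ge0 ?divr_ge0 ?(ltW x0) ?(ltW C1) //.
  rewrite ler_pdivlMr //; have := hC r; rewrite r1r r_lt1 => /(_ isT).
  by have := ler_norm C; lra.
apply: (@le_lt_trans _ _ (K * (1 - r) `^ (1 - th))).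
  apply: (le_trans (ler_wpM2l (ltW x0) h1)).
  rewrite mulrCA ler_pM2l // powRD; last by rewrite (gt_eqF th1).
  by rewrite powRr1 // ltW.
rewrite mulrC -ltr_pdivlMr //.
have -> : e / K = d `^ (1 - th).
  by rewrite /d -powRrM mulVf ?gt_eqF // powRr1 // divr_ge0 // ltW.
by apply: gt0_ltr_powR; rewrite ?nnegrE ?(ltW x0) ?(ltW d0) //; lra.
Qed.

Lemma sup_limit_exponents g : eventually_ge0 g ->
  ereal_sup [set l%:E | l in limit_exponents g] =
  ereal_sup [set l%:E | l in bound_exponents g].
Proof.
move=> g0; apply/eqP; rewrite eq_le; apply/andP; split.
  by apply: ereal_sup_le => _ [l hl <-]; exists l => //; exact: limit_bound_exponents.
apply: ereal_sup_le_approx => l e hl e0.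
have l0 : 0 < l by case: hl.
(* The term [l / 2] keeps [t] positive when [e >= l]. *)
pose t := Num.max (l - e) (l / 2).
have tl : 0 < t < l.
  by rewrite lt_max gt_max divr_gt0 // orbT /=; apply/andP; split; lra.
have tt : l <= t + e by rewrite -lerBlDr le_max lexx.
apply: (@le_trans _ _ (t%:E + e%:E)%E); first by rewrite -EFinD lee_fin.
rewrite leeD2r //; apply: ereal_sup_ubound; exists t => //.
exact: bound_limit_exponents hl tl.
Qed.

(** Where [g r > 1], the inequality [t <= log_quotient r (g r)] means [(1 - r) * g r ^ t <= 1];
    where [g r <= 1] the quotient is [+oo] and the latter holds for [t > 0]. A positive exponent
    [l1] ensures that only positive [t] have to be considered. *)
Lemma liminf_log_quotient g : eventually_ge0 g -> bound_exponents g !=set0 ->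
  limf_einf (fun r => log_quotient r (g r)) 1^'- =
  ereal_sup [set l%:E | l in bound_exponents g].
Proof.
move=> g0 [l1 hl1]; rewrite limf_einfE; apply/eqP; rewrite eq_le; apply/andP; split.
- apply: ge_ereal_sup => _ [V /near_one_leftP[r1 r11 hV] <-].
  set S := ereal_sup [set l%:E | l in _].
  rewrite leNgt; apply/negP => S_lt.
  have l1S : (l1%:E <= S)%E by apply: ereal_sup_ubound; exists l1.
  have [s sE] : exists s, S = s%:E.
    case: S S_lt l1S => [s _ _|h|//]; first by exists s.
    by rewrite ltNge leey in h.
  (* A real number strictly above the supremum [s] and at most the infimum, which may be [+oo]. *)
  have [t [st tV]] : exists t, s < t /\
      (t%:E <= ereal_inf [set log_quotient x (g x) | x in V])%E.
    move: S_lt; rewrite sE; case: (ereal_inf _) => [m|_|//].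
      by rewrite lte_fin => sm; exists ((s + m) / 2); rewrite lee_fin; split; lra.
    by exists (s + 1); rewrite leey; split => //; lra.
  have t0 : 0 < t.
    have [l10 _] := hl1; move: l1S; rewrite sE lee_fin; lra.
  suff /ereal_sup_ubound : [set l%:E | l in bound_exponents g] t%:E.
    by rewrite -/S sE lee_fin leNgt st.
  (* The 0 ensures [1 - r < 1], used where [g r <= 1]. *)
  exists t => //; split => //; exists 1, (Num.max r1 0); split.
    by rewrite gt_max r11 ltr01.
  move=> r; rewrite gt_max => /andP[/andP[r1r r_gt0] r_lt1].
  have Vr : V r by apply: hV; rewrite r1r.
  have : (t%:E <= log_quotient r (g r))%E.
    by apply: le_trans tV _; apply: ereal_inf_lbound; exists r.
  have x0 : 0 < 1 - r by rewrite subr_gt0.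
  rewrite /log_quotient; case: ltP => [g1|g1 _]; last first.
    (* On part of [V] the value of [g] may be negative, and [powR] of a negative number is 1. *)
    have [gr0|gr0] := leP 0 (g r); last first.
      rewrite /powR ifF; last by rewrite lt_eqF.
      by rewrite ln0 ?mulr0 ?expR0 ?mul1r ?(ltW gr0) //; lra.
    rewrite mulr_ile1 ?powR_ge0 ?(ltW x0) //; last by lra.
    rewrite -[leRHS](_ : 1 `^ t = 1); last by rewrite powR1.
    by apply: ge0_ler_powR; rewrite ?nnegrE ?(ltW t0).
  have lng : 0 < ln (g r) by exact: ln_gt0.
  rewrite lee_fin ler_pdivlMr // => h.
  rewrite -ler_pdivlMr // mul1r /powR gt_eqF; last by lra.
  rewrite -[leRHS]lnK ?posrE ?invr_gt0 // ler_expR lnV ?posrE //.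
- apply: ereal_sup_le_approx => l e hl e0.
  have l0 : 0 < l by case: hl.
  pose t := Num.max (l - e) (l / 2).
  have tl : 0 < t < l.
    by rewrite lt_max gt_max divr_gt0 // orbT /=; apply/andP; split; lra.
  have tt : l <= t + e by rewrite -lerBlDr le_max lexx.
  apply: (@le_trans _ _ (t%:E + e%:E)%E); first by rewrite -EFinD lee_fin.
  rewrite leeD2r //.
  have [_ /cvg_one_left0P /(_ _ ltr01)[r1 r11 h1]] := bound_limit_exponents g0 hl tl.
  apply: (@le_trans _ _ (ereal_inf [set log_quotient r (g r) | r in
      [set r | r1 < r < 1]])); last first.
    by apply: ereal_sup_ubound; exists [set r | r1 < r < 1] => //; apply/near_one_leftP; exists r1.
  apply: le_ereal_inf_tmp => _ [r /= /[dup] hr /h1 h <-].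
  have x0 : 0 < 1 - r by lra.
  rewrite /log_quotient; case: ltP => [g1|_]; last by rewrite leey.
  have lng : 0 < ln (g r) by exact: ln_gt0.
  rewrite lee_fin ler_pdivlMr // -lnV ?posrE // -ler_expR lnK ?posrE ?invr_gt0 //.
  have {}h : (1 - r) * g r `^ t < 1 by exact: le_lt_trans (ler_norm _) h.
  rewrite -[leRHS]mul1r ler_pdivlMr // mulrC; apply: ltW; move: h.
  by rewrite /powR gt_eqF //; lra.
Qed.

End GrowthExponents.

(** * The Hardy and Bergman numbers, maximum modulus and area in terms of growth exponents *)

Section ConformalExponents.
Variable R : realType.
Variable f : R[i] -> R[i].
Hypothesis conf_f : conformal f.

Definition growth_exponents : set R := [set l | 0 < l /\ growth_bound f l].

Lemma hardy_number_growth :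
  hardy_number f = ereal_sup [set l%:E | l in growth_exponents].
Proof.
apply/eqP; rewrite eq_le; apply/andP; split.
  apply: ereal_sup_le => _ [p [p0 hp] <-]; exists p => //; split => //.
  exact: hardy_growth.
apply: ereal_sup_le_approx => l e [l0 hl] e0.
pose t := Num.max (l - e) (l / 2).
have tl : 0 < t < l.
  by rewrite lt_max gt_max divr_gt0 // orbT /=; apply/andP; split; lra.
have tt : l <= t + e by rewrite -lerBlDr le_max lexx.
apply: (@le_trans _ _ (t%:E + e%:E)%E); first by rewrite -EFinD lee_fin.
rewrite leeD2r //; apply: ereal_sup_ubound; exists t => //.
have [t0 _] := andP tl.
by split => //; exact: growth_hardy hl.
Qed.

Lemma bergman_number_growth :
  bergman_number f = ereal_sup [set l%:E | l in growth_exponents].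
Proof.
apply/eqP; rewrite eq_le; apply/andP; split.
  apply: ereal_sup_le => _ [p [alpha [p0 alpha1 hp ->]]].
  exists (p / (alpha + 2)) => //; split; first by rewrite divr_gt0 //; lra.
  exact: bergman_growth.
apply: ereal_sup_le_approx => l e [l0 hl] e0.
(* The loss [l - l * alpha / (alpha + 2) = 2 * l / (alpha + 2)] is then below
   [2 * l / alpha = e]. *)
pose alpha := 2 * l / e; have alpha0 : 0 < alpha by rewrite divr_gt0 // mulr_gt0.
have ll : l <= l * alpha / (alpha + 2) + e.
  have a2 : 0 < alpha + 2 by lra.
  have -> : l * alpha / (alpha + 2) + e = (l * alpha + e * alpha + 2 * e) / (alpha + 2).
    by field; rewrite gt_eqF.
  have -> : e * alpha = 2 * l by rewrite /alpha mulrC divfK // gt_eqF.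
  by rewrite ler_pdivlMr //; lra.
apply: (@le_trans _ _ ((l * alpha / (alpha + 2))%:E + e%:E)%E).
  by rewrite -EFinD lee_fin.
rewrite leeD2r //; apply: ereal_sup_ubound; exists (l * alpha), alpha.
split => //; [by rewrite mulr_gt0|lra|exact: growth_bergman].
Qed.

Lemma max_modulus_ub z : normc z < 1 -> normc (f z) <= max_modulus f (normc z).
Proof.
move=> z1; have [B B0 hB] := conf_bounded conf_f z1.
apply: ub_le_sup; last by exists z.
by exists B => _ [w /= wz <-]; apply: hB; rewrite wz.
Qed.

Lemma max_modulus_le (r B : R) : 0 <= r ->
  (forall z, normc z = r -> normc (f z) <= B) -> max_modulus f r <= B.
Proof.
move=> r0 hB; apply: ge_sup; last by move=> _ [z /= zr <-]; exact: hB.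
by exists (normc (f r%:C%C)), r%:C%C => //; exact: (etrans (normcR r) (ger0_norm r0)).
Qed.

Lemma max_modulus_ge0 : eventually_ge0 (max_modulus f).
Proof.
exists 0 => [|r /andP[r0 r1]]; first exact: ltr01.
have nr : normc (r%:C%C : R[i]) = r by rewrite normcR gtr0_norm.
rewrite -nr; apply: le_trans (max_modulus_ub _); first exact: normc_ge0.
by rewrite nr.
Qed.

Lemma max_modulus_exponents : bound_exponents (max_modulus f) = growth_exponents.
Proof.
apply/seteqP; split => l [l0 hl]; split => //.
  have [C [r1 [r11 hC]]] := hl.
  have r21 : (1 + Num.max r1 0) / 2 < 1.
    have : Num.max r1 0 < 1 by rewrite gt_max r11 ltr01.
    by lra.
  apply: (near_boundary_growth_bound conf_f (ltW l0) r21).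
  exists C => z rz z1; have r1z : r1 < normc z < 1.
    have : r1 <= Num.max r1 0 by rewrite le_max lexx.
    by lra.
  apply: le_trans (hC _ r1z); apply: ler_wpM2r; first by rewrite subr_ge0 ltW.
  have := max_modulus_ub z1 => h.
  by apply: ge0_ler_powR; rewrite ?nnegrE ?normc_ge0 ?(ltW l0) ?(le_trans _ h) ?normc_ge0.
have [C hC] := hl; exists C, 0; split => // r /andP[r0 r1].
have x0 : 0 < 1 - r by rewrite subr_gt0.
have C0 : 0 <= C.
  apply: le_trans (hC 0 _); last by rewrite normc0.
  by rewrite mulr_ge0 ?powR_ge0 // normc0 subr0.
have h : max_modulus f r <= (C / (1 - r)) `^ l^-1.
  apply: max_modulus_le => [|z zr]; first exact: ltW.
  have -> : normc (f z) = (normc (f z) `^ l) `^ l^-1.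
    by rewrite -powRrM mulfV ?gt_eqF // powRr1 // normc_ge0.
  apply: ge0_ler_powR; rewrite ?nnegrE ?powR_ge0 ?invr_ge0 ?divr_ge0 ?(ltW l0) ?(ltW x0) //.
  by rewrite ler_pdivlMr // -zr; apply: hC; rewrite zr.
have [r2 r21 g0] := max_modulus_ge0.
rewrite -ler_pdivlMr //.
have nr : normc (r%:C%C : R[i]) = r by rewrite normcR gtr0_norm.
have m0 : 0 <= max_modulus f r.
  by rewrite -nr; apply: le_trans (max_modulus_ub _); rewrite ?normc_ge0 // nr.
have -> : C / (1 - r) = ((C / (1 - r)) `^ l^-1) `^ l.
  by rewrite -powRrM mulVf ?gt_eqF // powRr1 // divr_ge0 // ltW.
by apply: ge0_ler_powR; rewrite ?nnegrE ?powR_ge0 ?(ltW l0).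
Qed.

Lemma image_area_exponents :
  (2%:E * ereal_sup [set l%:E | l in bound_exponents (image_area f)])%E =
  ereal_sup [set l%:E | l in growth_exponents].
Proof.
rewrite -ereal_sup_pZl //; congr ereal_sup; apply/seteqP; split => x.
  move=> [_ [l [l0 hl] <-] <-]; exists (2 * l); last by rewrite EFinM.
  by split; [rewrite mulr_gt0|exact: image_area_growth].
move=> [l [l0 hl] <-]; exists (l / 2)%:E; last by rewrite -EFinM mulrC divfK.
have l20 : 0 < l / 2 by rewrite divr_gt0.
exists (l / 2) => //; split => //; apply: growth_image_area => //.
by rewrite mulrC divfK.
Qed.

End ConformalExponents.

Theorem theorem1p4 (R : realType) (f : R[i] -> R[i]) (hf : conformal f) :
  [/\ bergman_number f = hardy_number f /\
      hardy_number f =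
        limf_einf (fun r : R => log_quotient r (max_modulus f r)) 1^'-,
      bergman_number f = hardy_number f /\
      hardy_number f =
        (2%:E *
         limf_einf (fun r : R => log_quotient r (image_area f r)) (1^'-)%R)%E,
      bergman_number f = hardy_number f /\
      hardy_number f =
        ereal_sup [set l%:E | l in [set l : R | 0 < l /\
          (1 - r) * max_modulus f r `^ l @[r --> 1^'-] --> 0]]
    & bergman_number f = hardy_number f /\
      hardy_number f =
        (2%:E *
         ereal_sup [set l%:E | l in [set l : R | (0 < l)%R /\
           ((1 - r) * image_area f r `^ l @[r --> 1^'-] --> 0)%R]])%E].
Proof.
have bh : bergman_number f = hardy_number f.
  by rewrite bergman_number_growth // hardy_number_growth.
(* This exponent makes the sets of exponents of [max_modulus f] and [image_area f] nonempty, as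
   [liminf_log_quotient] requires. *)
have [l l0 hl] := conf_growth_exists hf.
have area_ge0 : eventually_ge0 (image_area f).
  by exists 0 => [|r _]; [exact: ltr01|exact: image_area_ge0].
have M_ex : bound_exponents (max_modulus f) !=set0.
  by rewrite max_modulus_exponents //; exists l.
have area_ex : bound_exponents (image_area f) !=set0.
  exists (l / 2); split; first by rewrite divr_gt0.
  by apply: growth_image_area; rewrite ?divr_gt0 // mulrC divfK.
split; split => //; rewrite hardy_number_growth //.
- by rewrite liminf_log_quotient // ?max_modulus_exponents //; exact: max_modulus_ge0.
- by rewrite liminf_log_quotient // image_area_exponents.
- rewrite -max_modulus_exponents // -sup_limit_exponents //.
  exact: max_modulus_ge0.
- by rewrite -image_area_exponents // -sup_limit_exponents.
Qed.
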